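(* Let $\xi\in\mathbb{C}$ and $\mu,a\in\mathbb{C}$ with $\Re(\mu)>-1$, $\Re(a)>-1$, $\Re(\mu+a)>-1$ and $\mu+a\notin\mathbb{Z}_{\ge0}$. Assume that the hard edge limit $\tilde{E}^{\rm hard}_2(s;a,\mu;\xi)=\lim_{N\to\infty}\tilde{E}_{2,N}((0,\frac{s}{4N});a,\mu;\xi)$ exists for small $s>0$ and can be taken term-by-term in the small $s$ expansion of $\tilde{E}_{2,N}$ (in the precise sense given in the context). Then, as $s\to0^+$, $$\tilde{E}^{\rm hard}_{2}(s;a,\mu;\xi)=1-\frac{\mu}{4(a+\mu)}s+O(s^2)$$ $$\quad+\frac{\Gamma(\mu+1)\Gamma(a+1)}{\Gamma(\mu+a+2)^2\,\Gamma(\mu+a+1)}\left((1-\xi)e^{\pi i\mu}-\frac{\sin\pi a}{\sin\pi(\mu+a)}\right)\left(\frac{s}{4}\right)^{\mu+a+1}\{1+O(s)\}+O(s^{2(\mu+a+1)}),$$ and consequently the function $\sigma_{\rm III'}(s)$ has the small $s$ expansion $$\sigma_{\rm III'}(s)=-\frac{\mu(\mu+a)}{2}+\frac{\mu}{4(\mu+a)}s+O(s^2)$$ $$\quad-\frac{\Gamma(\mu+1)\Gamma(a+1)}{\Gamma(\mu+a+2)\,\Gamma(\mu+a+1)^2}\left((1-\xi)e^{\pi i\mu}-\frac{\sin\pi a}{\sin\pi(\mu+a)}\right)\left(\frac{s}{4}\right)^{\mu+a+1}\{1+O(s)\}+O(s^{2(\mu+a+1)}).$$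
   Context: For $s>0$, let $g_s(\lambda)=(\lambda-s)^{\mu}$ for $\lambda>s$ and $g_s(\lambda)=(1-\xi)e^{\pi i\mu}(s-\lambda)^{\mu}$ for $0<\lambda<s$. For $N\ge1$ the normalised Laguerre unitary ensemble average is $$\tilde{E}_{2,N}((0,s);a,\mu;\xi):=\frac{1}{N!\,C_{N,a+\mu}}\int_{[0,\infty)^N}\prod_{l=1}^N g_s(\lambda_l)\lambda_l^{a}e^{-\lambda_l}\prod_{1\le j<k\le N}(\lambda_k-\lambda_j)^2\,d\lambda_1\cdots d\lambda_N,\qquad C_{N,\alpha}:=\prod_{j=0}^{N-1}\Gamma(j+1)\Gamma(j+\alpha+1),$$ which equals $\frac{1}{C_{N,a+\mu}}\det[w_{j+k}]_{j,k=0,\ldots,N-1}$ with $w_n=\int_0^\infty g_s(\lambda)\lambda^{n+a}e^{-\lambda}d\lambda=a_n(s)+s^{n+\mu+a+1}b_n(s)$, where $a_n,b_n$ are the entire functions $$a_n(s)=\Gamma(\mu+n+a+1)e^{-s}{}_1F_1(-a-n;-\mu-a-n;s),$$ $$b_n(s)=\frac{\Gamma(\mu+1)\Gamma(n+a+1)}{\Gamma(\mu+n+a+2)}\left((1-\xi)e^{\pi i\mu}-\frac{\sin\pi a}{\sin\pi(\mu+a)}\right)e^{-s}{}_1F_1(\mu+1;\mu+a+n+2;s).$$ Hence $\tilde{E}_{2,N}((0,s);a,\mu;\xi)=\sum_{m=0}^{N}\sum_{p=0}^{\infty}e^{(N)}_{m,p}\,s^{m(\mu+a+1)+p}$, where $\sum_p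 e^{(N)}_{m,p}s^p$ is the Taylor series of $\frac{1}{C_{N,a+\mu}}$ times the coefficient of $t^m$ in $\det[a_{j+k}(s)+t\,s^{j+k}b_{j+k}(s)]_{j,k=0,\ldots,N-1}$ (set $e^{(N)}_{m,p}=0$ for $m>N$). Term-by-term assumption: for all $m,p\ge0$ the limit $e_{m,p}:=\lim_{N\to\infty}(4N)^{-(m(\mu+a+1)+p)}e^{(N)}_{m,p}$ exists; there is $s_0>0$ such that $\sum_{m,p}e_{m,p}s_0^{m(\mu+a+1)+p}$ converges absolutely; and $\tilde{E}^{\rm hard}_2(s;a,\mu;\xi)=\sum_{m,p\ge0}e_{m,p}s^{m(\mu+a+1)+p}$ for $0<s\le s_0$. The function $\sigma_{\rm III'}$ is defined for small $s>0$ by $\tilde{E}^{\rm hard}_2(t;a,\mu;\xi)=\exp\int_0^t u^h(s)\frac{ds}{s}$ and $u^h(s)=-\left(\sigma_{\rm III'}(s)+\frac{\mu(\mu+a)}{2}\right)$, i.e. $\sigma_{\rm III'}(s)=-\frac{\mu(\mu+a)}{2}-s\,\frac{d}{ds}\log\tilde{E}^{\rm hard}_2(s;a,\mu;\xi)$. $O(s^\beta)$ with complex $\beta$ means $O(s^{\Re\beta})$. *)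

(* Defs.v *)
From HB Require Import structures.
From mathcomp Require Import all_boot all_order all_algebra.
From mathcomp Require Import complex.
From mathcomp Require Import all_classical all_reals all_analysis.
Import Order.TTheory GRing.Theory Num.Theory.
Import numFieldNormedType.Exports.

Set Implicit Arguments.
Unset Strict Implicit.
Unset Printing Implicit Defensive.

Local Open Scope classical_set_scope.
Local Open Scope ring_scope.
Local Open Scope complex_scope.

(* The complex numbers are R[i] over a realType R; the alias R[i]^o carries the
   norm and topology used for limits and complex derivatives. *)

Notation cabs := ComplexField.Normc.normc.

Section complex_functions.
Context {R : realType}.
Implicit Types (x s : R) (z : R[i]).

Definition cexp z : R[i] :=
  (expR (complex.Re z) * cos (complex.Im z)) +i*
  (expR (complex.Re z) * sin (complex.Im z)).

Definition csin z : R[i] :=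
  (cexp ((0 +i* 1) * z) - cexp (- ((0 +i* 1) * z))) / (0 +i* 2).

(* x ^ z for x > 0.  The value at x = 0 is arbitrary: below it only matters on
   null sets of integration. *)
Definition cpow x z : R[i] := cexp (z * (ln x)%:C).

(* Principal argument in ]-pi, pi] by the half-angle formula, which degenerates
   exactly on the closed negative real axis. *)
Definition carg z : R :=
  if (complex.Im z == 0) && (complex.Re z < 0) then pi
  else 2 * atan (complex.Im z / (cabs z + complex.Re z)).

Definition clog z : R[i] := ln (cabs z) +i* carg z.

(* Derivative and Lebesgue integral of a complex-valued function of a real
   variable, by real and imaginary parts. *)
Definition cderivable (f : R -> R[i]) x : Prop :=
  derivable (fun t => complex.Re (f t)) x 1 /\
  derivable (fun t => complex.Im (f t)) x 1.

Definition cderive (f : R -> R[i]) x : R[i] :=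
  derive1 (fun t => complex.Re (f t)) x +i* derive1 (fun t => complex.Im (f t)) x.

Definition cintegral (D : set R) (f : R -> R[i]) : R[i] :=
  Rintegral lebesgue_measure D (fun x => complex.Re (f x)) +i*
  Rintegral lebesgue_measure D (fun x => complex.Im (f x)).

(* The integral over D^n as an iterated Lebesgue integral, which agrees with the
   n-dimensional one for the absolutely integrable integrands used below. *)
Fixpoint cintegral_iter (D : set R) (n : nat) :
    (n.-tuple R -> R[i]) -> R[i] :=
  match n return (n.-tuple R -> R[i]) -> R[i] with
  | 0%N => fun F => F [tuple]
  | n'.+1 => fun F =>
      cintegral D (fun x => cintegral_iter D (fun v => F (cons_tuple x v)))
  end.

(* Euler's integral; only used for Re z > 0. *)
Definition cGamma z : R[i] :=
  cintegral `]0, +oo[ (fun t => cpow t (z - 1) * (expR (- t))%:C).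

Definition pochhammer z (k : nat) : R[i] := \prod_(i < k) (z + i%:R).

Definition hyp1F1 (A B z : R[i]) : R[i] :=
  limn (series (fun k : nat =>
    pochhammer A k / pochhammer B k * z ^+ k / k`!%:R : R[i]^o)).

End complex_functions.

Section hard_edge.
Context {R : realType}.
Variables a mu xi : R[i].

(* The value at lambda = s is immaterial. *)
Definition gweight (s lambda : R) : R[i] :=
  if s < lambda then cpow (lambda - s) mu
  else (1 - xi) * cexp ((0 +i* pi) * mu) * cpow (s - lambda) mu.

Definition Cnorm (N : nat) (alpha : R[i]) : R[i] :=
  \prod_(j < N) (cGamma (j%:R + 1) * cGamma (j%:R + alpha + 1)).

Definition E2N (N : nat) (s : R) : R[i] :=
  (N`!%:R * Cnorm N (a + mu))^-1 *
  cintegral_iter `[0, +oo[ (fun lambda : N.-tuple R =>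
    \prod_(l < N) (gweight s (tnth lambda l) * cpow (tnth lambda l) a
                   * (expR (- tnth lambda l))%:C)
    * (\prod_(k < N) \prod_(j < N | (j < k)%N)
         (tnth lambda k - tnth lambda j) ^+ 2)%:C).

Definition E2hard (s : R) : R[i] :=
  limn (fun N : nat => E2N N (s / (4 * N%:R)) : R[i]^o).

Definition connection_factor : R[i] :=
  (1 - xi) * cexp ((0 +i* pi) * mu)
  - csin (pi%:C * a) / csin (pi%:C * (mu + a)).

Definition acoef (n : nat) (s : R[i]) : R[i] :=
  cGamma (mu + n%:R + a + 1) * cexp (- s)
  * hyp1F1 (- a - n%:R) (- mu - a - n%:R) s.

Definition bcoef (n : nat) (s : R[i]) : R[i] :=
  cGamma (mu + 1) * cGamma (n%:R + a + 1) / cGamma (mu + n%:R + a + 2)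
  * connection_factor * cexp (- s)
  * hyp1F1 (mu + 1) (mu + a + n%:R + 2) s.

(* 'X is the bookkeeping variable t. *)
Definition det_poly (N : nat) (s : R[i]) : {poly R[i]} :=
  \det (\matrix_(j < N, k < N)
    ((acoef (j + k) s)%:P + (s ^+ (j + k) * bcoef (j + k) s) *: 'X)).

(* Complex Taylor coefficients at 0; they vanish for m > N because det_poly N s
   has degree at most N. *)
Definition ecoefN (N m p : nat) : R[i] :=
  derive1n p (fun s : R[i] => (Cnorm N (a + mu))^-1 * (det_poly N s)`_m : R[i]^o)
    0 / p`!%:R.

Definition exponent (m p : nat) : R[i] := m%:R * (mu + a + 1) + p%:R.

Definition scaled_ecoefN (m p N : nat) : R[i]^o :=
  cpow (4 * N%:R) (- exponent m p) * ecoefN N m p.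

Definition ecoef (m p : nat) : R[i] := limn (scaled_ecoefN m p).

Definition hard_term (s : R) (m p : nat) : R[i] :=
  ecoef m p * cpow s (exponent m p).

(* The value of the double series is taken along square partial sums, which is
   its unambiguous sum once it converges absolutely. *)
Definition term_by_term : Prop :=
  (forall m p : nat, cvgn (scaled_ecoefN m p)) /\
  exists2 s0 : R, 0 < s0 &
    summable [set: nat * nat]
      (fun mp => (cabs (hard_term s0 mp.1 mp.2))%:E) /\
    forall s : R, 0 < s <= s0 ->
      (fun n : nat => \sum_(m < n) \sum_(p < n) hard_term s m p : R[i]^o)
        @ \oo --> (E2hard s : R[i]^o).

(* E2hard s tends to 1 as s tends to 0+, so the principal logarithm is smooth
   along it for small s. *)
Definition sigmaIII (s : R) : R[i] :=
  - (mu * (mu + a) / 2) - s%:C * cderive (fun t => clog (E2hard t)) s.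

End hard_edge.

(* Main.v *)
Require Import Defs.
From HB Require Import structures.
From mathcomp Require Import all_boot all_order all_algebra.
From mathcomp Require Import fingroup perm complex ring lra.
From mathcomp Require Import all_classical all_reals all_analysis measurable_realfun.
Import Order.TTheory GRing.Theory Num.Theory.
Import numFieldNormedType.Exports.
Local Open Scope classical_set_scope.
Local Open Scope ring_scope.
Local Open Scope complex_scope.
Set Implicit Arguments.
Unset Strict Implicit.

(** The term-by-term assumption presents the hard edge limit as an absolutely
   convergent series in the powers [s^(m be + p)], where [be = mu + a + 1] has
   positive real part.  Sorting it by the blocks [m = 0], [m = 1] and [m >= 2],
   everything that the first expansion says follows from the values of
   [e_{0,0}], [e_{0,1}] and [e_{1,0}], and from one more remark: the relative
   remainder [1 + O(s)] of the block [m = 1] is meaningful when [e_{1,0} = 0]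
   only because that forces the connection factor to vanish, and then the whole
   block vanishes with it ([ecoef1_eq0], [wsum_expansion]).

   The three coefficients are found at finite [N].  With [al = mu + a], the
   functions [acoef n] have to first order the form
   [g ((al)_(n+1) - mu (al)_n s)], so both their values and their derivatives are
   multiples of moments of a Gamma law ([approx_acoef]).  The Hankel determinant of the values
   is evaluated by taking differences ([det_hankel_pochhammer]) and cancels the
   normalisation, whence [e_{0,0} = 1].  To first order in [s] the determinant
   only sees the trace of the matrix that carries the Hankel matrix
   [(al)_(j+k+1)] to [(al)_(j+k)].  By the orthogonality of a Laguerre polynomial
   this is a companion matrix, of trace [N / al] ([det_hankel_linear]), whence
   [e_{0,1}].  For [e_{1,0}] only the corner entry matters at [s = 0], the minor
   is again a Hankel determinant, and the quotient telescopes to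
   [Gamma (N + be) / (N - 1)!] ([ecoefN10]).  This is equivalent to [N^be], since
   a variable of Gamma law of shape [N] divided by [N] concentrates at [1]
   ([cGamma_ratio_cvg2]).  The same asymptotics shows that [Gamma] has no zero in
   the right half-plane ([cGamma_neq0]).

   For the second expansion the series is differentiated term by term in the
   variable [ln s], where each term is an exponential ([series_is_derive]).  This
   multiplies each coefficient by its exponent, and the sorting lemma applies
   again.  The quotient of the two expansions is expanded in
   [quotient_expansion], and it is the logarithmic derivative because the hard
   edge limit stays in the right half-plane near the origin ([is_derive_clog]). *)

(** * Modulus and convergence of complex numbers *)

Section ComplexNorm.
Context {R : realType}.
Implicit Types (x y : R) (z w : R[i]).

Lemma normc_ge0 z : 0 <= cabs z.
Proof. by case: z => x y; rewrite /= sqrtr_ge0. Qed.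

Lemma normCE z : `|z| = (cabs z)%:C.
Proof. by []. Qed.

Lemma cabs_real x : cabs x%:C = `|x|.
Proof. by rewrite /= expr0n /= addr0 sqrtr_sqr. Qed.

Lemma cabs_nat n : cabs (n%:R : R[i]) = n%:R.
Proof. by rewrite -(rmorph_nat (real_complex R)) cabs_real ger0_norm. Qed.

Lemma normr_Re z : `|complex.Re z| <= cabs z.
Proof. by case: z => x y /=; rewrite -sqrtr_sqr ler_wsqrtr// lerDl sqr_ge0. Qed.

Lemma normr_Im z : `|complex.Im z| <= cabs z.
Proof. by case: z => x y /=; rewrite -sqrtr_sqr ler_wsqrtr// lerDr sqr_ge0. Qed.

Lemma cabs_le z : cabs z <= `|complex.Re z| + `|complex.Im z|.
Proof.
rewrite {1}[z]complexE (le_trans (le_normcD _ _))// cabs_real lerD2l.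
by rewrite ComplexField.Normc.normcM cabs_real /= expr0n expr1n add0r sqrtr1 mul1r.
Qed.

Lemma cabs_eq0 z : (cabs z == 0) = (z == 0).
Proof.
apply/eqP/eqP => [/ComplexField.Normc.eq0_normc//|->].
exact: ComplexField.Normc.normc0.
Qed.

Lemma cabs_gt0 z : (0 < cabs z) = (z != 0).
Proof. by rewrite lt_def normc_ge0 andbT cabs_eq0. Qed.

Lemma cabsM z w : cabs (z * w) = cabs z * cabs w.
Proof. exact: ComplexField.Normc.normcM. Qed.

Lemma cabsV z : cabs z^-1 = (cabs z)^-1.
Proof. exact: ComplexField.Normc.normcV. Qed.

Lemma cabsX z n : cabs (z ^+ n) = cabs z ^+ n.
Proof.
elim: n => [|n IH]; first by rewrite !expr0 ComplexField.Normc.normc1.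
by rewrite !exprS cabsM IH.
Qed.

Lemma cabsD z w : cabs (z + w) <= cabs z + cabs w.
Proof. exact: le_normcD. Qed.

Lemma cabsN z : cabs (- z) = cabs z.
Proof. exact: normcN. Qed.

Lemma cabsB z w : cabs (z - w) <= cabs z + cabs w.
Proof. by rewrite -(cabsN w) cabsD. Qed.

Lemma cabsBC z w : cabs (z - w) = cabs (w - z).
Proof. by rewrite -cabsN opprB. Qed.

Lemma cabs_sum I (r : seq I) (P : pred I) (F : I -> R[i]) :
  cabs (\sum_(i <- r | P i) F i) <= \sum_(i <- r | P i) cabs (F i).
Proof.
elim/big_rec2 : _ => [|i x z _ h]; first by rewrite ComplexField.Normc.normc0.
by rewrite (le_trans (cabsD _ _))// lerD2l.
Qed.

Lemma Re_mul z w : complex.Re (z * w) = complex.Re z * complex.Re w - complex.Im z * complex.Im w.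
Proof. by case: z; case: w. Qed.
Lemma Im_mul z w : complex.Im (z * w) = complex.Re z * complex.Im w + complex.Im z * complex.Re w.
Proof. by case: z; case: w => a b c d /=; rewrite addrC. Qed.
Lemma Re_add z w : complex.Re (z + w) = complex.Re z + complex.Re w.
Proof. by case: z; case: w. Qed.
Lemma Im_add z w : complex.Im (z + w) = complex.Im z + complex.Im w.
Proof. by case: z; case: w. Qed.
Lemma Re_opp z : complex.Re (- z) = - complex.Re z.
Proof. by case: z. Qed.
Lemma Im_opp z : complex.Im (- z) = - complex.Im z.
Proof. by case: z. Qed.
Lemma Re_nat n : complex.Re (n%:R : R[i]) = n%:R.
Proof. by rewrite -(rmorph_nat (real_complex R)). Qed.
Lemma Im_nat n : complex.Im (n%:R : R[i]) = 0.
Proof. by rewrite -(rmorph_nat (real_complex R)). Qed.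
Lemma Re_sum I (r : seq I) (P : pred I) (F : I -> R[i]) :
  complex.Re (\sum_(i <- r | P i) F i) = \sum_(i <- r | P i) complex.Re (F i).
Proof. by rewrite (big_morph _ Re_add (erefl : complex.Re (0 : R[i]) = 0)). Qed.
Lemma Im_sum I (r : seq I) (P : pred I) (F : I -> R[i]) :
  complex.Im (\sum_(i <- r | P i) F i) = \sum_(i <- r | P i) complex.Im (F i).
Proof. by rewrite (big_morph _ Im_add (erefl : complex.Im (0 : R[i]) = 0)). Qed.

Lemma complexP z w : complex.Re z = complex.Re w -> complex.Im z = complex.Im w -> z = w.
Proof. by case: z; case: w => a b c d /= -> ->. Qed.

(** The norm of [R[i]^o] takes its values in [R[i]]; this brings convergence
   back to the real modulus. *)
Lemma cvgcP T (F : set_system T) (FF : Filter F) (f : T -> R[i]) (l : R[i]) :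
  (f @ F --> (l : R[i]^o)) <-> ((fun t => cabs (f t - l)) @ F --> (0 : R)).
Proof.
split.
- move=> /(@cvgrPdist_lt _ R[i]^o) h; apply/cvgrPdist_lt => e e0.
  have e0' : (0 : R[i]) < e%:C by rewrite ltcR.
  have := h _ e0'; apply: filterS => t.
  by rewrite normCE ltcR sub0r normrN ger0_norm ?normc_ge0// cabsBC.
- move=> /cvgrPdist_lt h; apply/(@cvgrPdist_lt _ R[i]^o) => e e0.
  have /andP[/eqP e1 e2] : (complex.Im e == 0) && (0 < complex.Re e).
    by move: e0; rewrite ltcE /=.
  have := h _ e2; apply: filterS => t.
  rewrite normCE sub0r normrN ger0_norm ?normc_ge0// cabsBC => h'.
  by rewrite ltcE /= e1 eqxx.
Qed.

Lemma cvgc_ReIm T (F : set_system T) (FF : Filter F) (f : T -> R[i]) (l : R[i]) :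
  (f @ F --> (l : R[i]^o)) <->
  ((fun t => complex.Re (f t)) @ F --> complex.Re l) /\
  ((fun t => complex.Im (f t)) @ F --> complex.Im l).
Proof.
split.
- move=> /cvgcP h; split; apply/cvgrPdist_lt => e e0;
  move/cvgrPdist_lt : h => /(_ _ e0); apply: filterS => t;
  rewrite sub0r normrN ger0_norm ?normc_ge0//; apply: le_lt_trans; rewrite cabsBC.
  + by rewrite -Re_opp -Re_add normr_Re.
  + by rewrite -Im_opp -Im_add normr_Im.
- case=> h1 h2; apply/cvgcP/cvgrPdist_lt => e e0.
  have e2 : 0 < e / 2 by rewrite divr_gt0.
  near=> t.
  rewrite sub0r normrN ger0_norm ?normc_ge0// cabsBC.
  apply: (le_lt_trans (cabs_le _)); rewrite Re_add Re_opp Im_add Im_opp.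
  rewrite (splitr e) ltrD//; near: t.
  + by move/cvgrPdist_lt : h1; apply.
  + by move/cvgrPdist_lt : h2; apply.
Unshelve. all: by end_near. Qed.

Lemma limnc (f : nat -> R[i]) (l : R[i]) :
  f @ \oo --> (l : R[i]^o) -> limn (f : nat -> R[i]^o) = l.
Proof. by move=> h; apply: cvg_lim => //; exact: (@norm_hausdorff R[i] R[i]^o). Qed.

Lemma cabs_lim_le (f : nat -> R[i]) (l c : R[i]) (M : R) :
  f @ \oo --> (l : R[i]^o) -> (\forall n \near \oo, cabs (f n - c) <= M) ->
  cabs (l - c) <= M.
Proof.
move=> /cvgcP h hM; apply/ler_addgt0Pr => e e0.
move/cvgrPdist_lt : h => /(_ _ e0) h.
have /filter_ex[n [h1 h2]] :
    \forall n \near \oo, `|0 - cabs (f n - l)| < e /\ cabs (f n - c) <= M.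
  by apply: filterS2 h hM => n ? ?; split.
rewrite (_ : l - c = (f n - c) - (f n - l)); last by ring.
apply: (le_trans (cabsB _ _)); rewrite lerD// ltW//.
by move: h1; rewrite sub0r normrN ger0_norm ?normc_ge0.
Qed.

(** The functions below are only controlled up to a quadratic error near the
   origin; this is enough to have a complex derivative there. *)
Lemma derive1_quadratic (f : R[i] -> R[i]) (d : R[i]) (K : R) :
  (forall h, cabs h <= 1 -> cabs (f h - f 0 - d * h) <= K * cabs h ^+ 2) ->
  derive1 (f : R[i] -> R[i]^o) 0 = d.
Proof.
move=> H; rewrite /derive1; apply: cvg_lim; first exact: (@norm_hausdorff R[i] R[i]^o).
have K0 : 0 <= K.
  have := H 1; rewrite !ComplexField.Normc.normc1 expr1n !mulr1 => /(_ (lexx _)).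
  exact: le_trans (normc_ge0 _).
apply/(@cvgrPdist_lt _ R[i]^o) => e' e'0.
have /andP[/eqP e1 e0] : (complex.Im e' == 0) && (0 < complex.Re e').
  by move: e'0; rewrite ltcE /=.
set e := complex.Re e' in e0.
have q0 : 0 < Num.min 1 (e / (K + 1)).
  by rewrite lt_min ltr01 /= divr_gt0// ltr_wpDl.
near=> h.
have hq : `|h : R[i]^o| < (Num.min 1 (e / (K + 1)))%:C.
  by near: h; apply: dnbhs0_lt; rewrite ltcR.
have h0 : h != 0 by near: h; exact: nbhs_dnbhs_neq.
move: hq; rewrite normCE ltcR lt_min => /andP[h1 h2].
rewrite normCE ltcE /= e1 eqxx /= cabsBC addr0.
have -> : h^-1 *: (f h - f 0 : R[i]^o) - d = (f h - f 0 - d * h) / h.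
  rewrite /GRing.scale /=; by field.
rewrite cabsM cabsV ltr_pdivrMr ?cabs_gt0//.
apply: (le_lt_trans (H _ (ltW h1))).
rewrite expr2 mulrA ltr_pM2r ?cabs_gt0//.
have hK : 0 < K + 1 by rewrite ltr_wpDl.
move: h2; rewrite ltr_pdivlMr//; apply: le_lt_trans.
by rewrite mulrC ler_wpM2l ?normc_ge0// lerDl.
Unshelve. all: by end_near. Qed.

End ComplexNorm.

(** * The complex exponential *)

Section ComplexExp.
Context {R : realType}.
Implicit Types (x y : R) (z w : R[i]).

Lemma cexpD z w : cexp (z + w) = cexp z * cexp w.
Proof.
by case: z w => a b [c d]; apply: complexP => /=; rewrite expRD ?cosD ?sinD; ring.
Qed.

Lemma cexp0 : cexp (0 : R[i]) = 1.
Proof. by rewrite /cexp /= expR0 cos0 sin0 mulr1 mulr0. Qed.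

Lemma cabs_cexp z : cabs (cexp z) = expR (complex.Re z).
Proof.
rewrite /cexp /= !exprMn -mulrDr cos2Dsin2 mulr1 sqrtr_sqr ger0_norm//.
Qed.

Lemma cexp_neq0 z : cexp z != 0.
Proof. by rewrite -cabs_eq0 cabs_cexp gt_eqF// expR_gt0. Qed.

Lemma cexpN z : cexp (- z) = (cexp z)^-1.
Proof.
apply: (mulfI (cexp_neq0 z)); rewrite mulfV ?cexp_neq0//.
by rewrite -cexpD subrr cexp0.
Qed.

Lemma cexp_real x : cexp x%:C = (expR x)%:C.
Proof. by rewrite /cexp /= cos0 sin0 mulr1 mulr0. Qed.

(** The elementary bounds below are proved one from the other, along the chain
   of derivatives of [sin], [cos] and [expR]. *)
Lemma MVT_bound (f f' : R -> R) (x M : R) :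
  (forall y, is_derive y 1 f (f' y)) -> f 0 = 0 ->
  (forall y, `|y| <= `|x| -> `|f' y| <= M) -> `|f x| <= M * `|x|.
Proof.
move=> df f0 hM.
have cf : continuous f.
  by move=> y; apply: differentiable_continuous; apply/derivable1_diffP; apply: ex_derive.
have [x0|x0|->] := ltgtP x 0; last by rewrite f0 !normr0 mulr0.
- have [c cx] := @MVT _ f f' x 0 x0 (fun y _ => df y) (continuous_subspaceT cf).
  rewrite f0 !sub0r => /eqP; rewrite eqr_oppLR => /eqP ->.
  move: cx; rewrite in_itv /= => /andP[c1 c2].
  rewrite normrN normrM normrN ler_wpM2r// hM// !ltr0_norm//.
  by rewrite lerN2 ltW.
- have [c cx] := @MVT _ f f' 0 x x0 (fun y _ => df y) (continuous_subspaceT cf).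
  rewrite f0 !subr0 => ->.
  move: cx; rewrite in_itv /= => /andP[c1 c2].
  by rewrite normrM ler_wpM2r// hM// !gtr0_norm// ltW.
Qed.

Lemma sin_le x : `|sin x| <= `|x|.
Proof.
rewrite -[leRHS]mul1r; apply: (@MVT_bound (@sin R) (@cos R)).
- exact: sin0.
- by move=> y _; rewrite ler_norml cos_geN1 cos_le1.
Qed.

Lemma cosB1_le x : `|cos x - 1| <= `|x|.
Proof.
rewrite -[leRHS]mul1r; apply: (@MVT_bound (fun x => cos x - 1) (fun x => - sin x)).
- by move=> y; apply: is_derive_eq; rewrite oppr0 addr0.
- by rewrite cos0 subrr.
- by move=> y _; rewrite normrN ler_norml sin_geN1 sin_le1.
Qed.

Lemma cosB1_le2 x : `|cos x - 1| <= `|x| ^+ 2.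
Proof.
rewrite expr2; apply: (@MVT_bound (fun x => cos x - 1) (fun x => - sin x)).
- by move=> y; apply: is_derive_eq; rewrite oppr0 addr0.
- by rewrite cos0 subrr.
- by move=> y hy; rewrite normrN; apply: le_trans hy; exact: sin_le.
Qed.

Lemma sinB_le2 x : `|sin x - x| <= `|x| ^+ 2.
Proof.
rewrite expr2; apply: (@MVT_bound (fun x => sin x - x) (fun x => cos x - 1)).
- by rewrite sin0 subrr.
- by move=> y hy; apply: le_trans hy; exact: cosB1_le.
Qed.

Lemma expRB1_le x : `|expR x - 1| <= `|x| * expR `|x|.
Proof.
rewrite mulrC; apply: (@MVT_bound (fun x => expR x - 1) (@expR R)).
- by move=> y; apply: is_derive_eq; rewrite oppr0 addr0.
- by rewrite expR0 subrr.
- move=> y hy; rewrite ger0_norm ?expR_ge0// ler_expR.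
  exact: le_trans (ler_norm _) hy.
Qed.

Lemma expRB1D_le2 x : `|expR x - 1 - x| <= `|x| ^+ 2 * expR `|x|.
Proof.
rewrite expr2 -mulrA mulrC.
apply: (@MVT_bound (fun x => expR x - 1 - x) (fun x => expR x - 1)).
- by move=> y; apply: is_derive_eq; rewrite oppr0 addr0.
- by rewrite expR0 subrr subr0.
- move=> y hy; apply: (le_trans (expRB1_le _)).
  by rewrite ler_pM ?expR_ge0// ler_expR.
Qed.

(** With [expR x] in place of [expR |x|], the bound involves no negative power of
   [t] when [x] is a positive multiple of [ln t]. *)
Lemma expRB1_le_max x : `|expR x - 1| <= `|x| * (1 + expR x).
Proof.
have [x0|x0] := leP 0 x.
- have := expRB1_le x; rewrite (ger0_norm x0) => h; apply: (le_trans h).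
  by rewrite ler_wpM2l// lerDr.
- rewrite ler0_norm; last by rewrite subr_le0 expR_le1 ltW.
  rewrite ltr0_norm//.
  have := expR_ge1Dx x; have := expR_gt0 x; nra.
Qed.

Lemma cexpB1_le w :
  cabs (cexp w - 1) <= 3 * cabs w * (1 + expR (complex.Re w)).
Proof.
apply: (le_trans (cabs_le _)); rewrite /cexp Re_add Im_add /= oppr0 addr0.
have := normr_Re w; have := normr_Im w.
case: w => p q /=; set W := Num.sqrt _ => hq hp.
have e0 := expR_gt0 p.
have h1 : `|expR p * cos q - 1| <= expR p * `|q| + `|p| * (1 + expR p).
  rewrite (_ : _ - 1 = expR p * (cos q - 1) + (expR p - 1)); last by ring.
  apply: (le_trans (ler_normD _ _)); rewrite lerD ?expRB1_le_max//.
  by rewrite normrM gtr0_norm// ler_pM2l// cosB1_le.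
have h2 : `|expR p * sin q| <= expR p * `|q|.
  by rewrite normrM gtr0_norm// ler_pM2l// sin_le.
have := normr_ge0 p; have := normr_ge0 q; nra.
Qed.

Lemma cexpB1D_le2 w :
  cabs (cexp w - 1 - w) <= 4 * cabs w ^+ 2 * expR (cabs w).
Proof.
apply: (le_trans (cabs_le _)); rewrite /cexp !Re_add !Im_add !Re_opp !Im_opp /= oppr0 addr0.
have := normr_Re w; have := normr_Im w.
case: w => p q /=; set W := Num.sqrt _ => hq hp.
have e0 := expR_gt0 p.
have e1 : expR p <= expR W by rewrite ler_expR (le_trans (ler_norm _)).
have e2 : expR `|p| <= expR W by rewrite ler_expR.
have W0 : 0 <= W by exact: le_trans hp.
have e3 : 1 <= expR W by rewrite -expR0 ler_expR.
have q0 := normr_ge0 q; have p0 := normr_ge0 p.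
have q2 : `|q| ^+ 2 <= W ^+ 2 by rewrite lerXn2r ?nnegrE.
have p2 : `|p| ^+ 2 <= W ^+ 2 by rewrite lerXn2r ?nnegrE.
have h1 : `|expR p * cos q - 1 - p| <= 2 * W ^+ 2 * expR W.
  rewrite (_ : _ - 1 - p = expR p * (cos q - 1) + (expR p - 1 - p)); last by ring.
  apply: (le_trans (ler_normD _ _)).
  apply: (@le_trans _ _ (expR W * W ^+ 2 + W ^+ 2 * expR W)); last by nra.
  rewrite lerD//.
    by rewrite normrM gtr0_norm// ler_pM// (le_trans (cosB1_le2 _)).
  by apply: (le_trans (expRB1D_le2 _)); rewrite ler_pM// ?exprn_ge0// expR_ge0.
have h2 : `|expR p * sin q - q| <= 2 * W ^+ 2 * expR W.
  rewrite (_ : _ - q = expR p * (sin q - q) + (expR p - 1) * q); last by ring.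
  apply: (le_trans (ler_normD _ _)).
  apply: (@le_trans _ _ (expR W * W ^+ 2 + (W * expR W) * W)); last by nra.
  rewrite lerD//.
    by rewrite normrM gtr0_norm// ler_pM// (le_trans (sinB_le2 _)).
  rewrite normrM ler_pM// (le_trans (expRB1_le _))// ler_pM// expR_ge0.
by nra.
Qed.

End ComplexExp.

(** * Derivatives of real functions *)

Lemma ln_le_subr1 {R : realType} (y : R) : 0 < y -> ln y <= y - 1.
Proof.
move=> y0; rewrite -{1}[y](_ : 1 + (y - 1) = y); last by ring.
by rewrite le_ln1Dx// ltrBrDr addrC subrr.
Qed.

Section Derivation.
Context {R : realType}.
Implicit Types (f g : R -> R) (t a b c : R).

Lemma is_derive_compR f g t a b : is_derive (g t) 1 f a -> is_derive t 1 g b ->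
  is_derive t 1 (fun u => f (g u)) (a * b).
Proof. by move=> fa gb; exact: is_derive1_comp. Qed.

Lemma is_derive_mulR f g t a b : is_derive t 1 f a -> is_derive t 1 g b ->
  is_derive t 1 (fun u => f u * g u) (a * g t + f t * b).
Proof.
move=> fa gb; apply: (@is_derive_eq _ _ _ _ _ _ _ _ (@is_deriveM _ _ f g t 1 a b fa gb)).
by rewrite /GRing.scale /=; ring.
Qed.

Lemma is_derive_addR f g t a b : is_derive t 1 f a -> is_derive t 1 g b ->
  is_derive t 1 (fun u => f u + g u) (a + b).
Proof. by move=> fa gb; exact: is_deriveD. Qed.

Lemma is_derive_subR f g t a b : is_derive t 1 f a -> is_derive t 1 g b ->
  is_derive t 1 (fun u => f u - g u) (a - b).
Proof. by move=> fa gb; exact: is_deriveB. Qed.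

Lemma is_derive_scaleR f t a c : is_derive t 1 f a ->
  is_derive t 1 (fun u => c * f u) (c * a).
Proof. by move=> fa; exact: is_deriveZ. Qed.

Lemma is_derive_expR_comp g t b : is_derive t 1 g b ->
  is_derive t 1 (fun u => expR (g u)) (expR (g t) * b).
Proof. by move=> gb; exact: is_derive1_comp. Qed.

Lemma is_derive_cos_comp g t b : is_derive t 1 g b ->
  is_derive t 1 (fun u => cos (g u)) (- sin (g t) * b).
Proof. by move=> gb; exact: is_derive1_comp. Qed.

Lemma is_derive_sin_comp g t b : is_derive t 1 g b ->
  is_derive t 1 (fun u => sin (g u)) (cos (g t) * b).
Proof. by move=> gb; exact: is_derive1_comp. Qed.

Lemma is_derive_continuous f t a : is_derive t 1 f a -> {for t, continuous f}.
Proof.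
move=> h; apply: differentiable_continuous; apply/derivable1_diffP.
exact: ex_derive.
Qed.

Lemma is_derive_ln1D t : 0 < t -> is_derive t 1 (fun u => ln (1 + u) : R) (1 + t)^-1.
Proof.
move=> t0; have h : is_derive (1 + t) 1 (@ln R) (1 + t)^-1.
  by apply: is_derive1_ln; rewrite addr_gt0.
have h2 : is_derive t 1 (fun u : R => 1 + u) 1.
  by have := is_derive_addR (is_derive_cst (1 : R) t (1 : R)) (is_derive_id t (1 : R)); rewrite add0r.
by have := is_derive_compR h h2; rewrite mulr1.
Qed.

End Derivation.

(** * Integration over the half-line *)

Section HalfLine.
Context {R : realType}.
Local Notation mu := (@lebesgue_measure R).
Implicit Types (f F : R -> R) (x t : R) (z w : R[i]).

Definition halfline : set R := `]0, +oo[%classic.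
Local Notation D := halfline.

Lemma measurable_halfline : measurable D.
Proof. exact: measurable_itv. Qed.

Arguments measurable_halfline : clear implicits.

Lemma halflineE x : D x = (0 < x).
Proof. by rewrite /halfline /= in_itv /= andbT. Qed.

Lemma measurable_halfline_continuous f :
  (forall x, 0 < x -> {for x, continuous f}) -> measurable_fun D f.
Proof.
move=> cf; apply: open_continuous_measurable_fun; first exact: interval_open.
by move=> x; rewrite inE halflineE => /cf.
Qed.

(** Monotone convergence along the half-lines starting at [1 / (n + 1)] gives the
   fundamental theorem of calculus without any continuity at the origin, where
   Euler's integrand may be unbounded. *)
Lemma ge0_FTC_halfline f F (l0 l1 : R) :
  (forall x, 0 < x -> 0 <= f x) ->
  (forall x, 0 < x -> {for x, continuous f}) ->
  (forall x, 0 < x -> is_derive x 1 F (f x)) ->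
  F x @[x --> 0^'+] --> l0 -> F x @[x --> +oo%R] --> l1 ->
  (\int[mu]_(x in D) (f x)%:E)%E = (l1 - l0)%:E.
Proof.
move=> f0 cf dF F0 F1.
pose a (n : nat) : R := n.+1%:R^-1.
have a0 n : 0 < a n by rewrite /a invr_gt0.
have cF x : 0 < x -> {for x, continuous F}.
  by move=> /dF dFx; apply: differentiable_continuous; apply/derivable1_diffP; apply: ex_derive.
pose A (n : nat) : set R := `[a n, +oo[%classic.
have AD : \bigcup_n A n = D.
  apply/seteqP; split => x.
  - by move=> [n _]; rewrite /A halflineE /= in_itv /= andbT; exact: lt_le_trans.
  - rewrite halflineE => x0.
    exists (Num.truncn x^-1) => //; rewrite /A /= in_itv /= andbT /a invf_ple ?posrE//.
    by rewrite ltW// truncnS_gt.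
have ndA : nondecreasing_seq A.
  move=> n m nm; rewrite subsetEset => x; rewrite /A /= !in_itv /= !andbT.
  apply: le_trans; rewrite /a lef_pV2 ?posrE// ler_nat; by rewrite ltnS.
have mf : measurable_fun D f by exact: measurable_halfline_continuous.
have h : (\int[mu]_(x in A i) (f x)%:E)%E @[i --> \oo] --> (\int[mu]_(x in D) (f x)%:E)%E.
  rewrite -AD; apply: ge0_nondecreasing_set_cvg_integral => //.
  - by move=> i; exact: measurable_itv.
  - move=> i; apply/measurable_EFinP; apply: measurable_funS mf; first exact: measurable_halfline.
    by rewrite -AD; exact: bigcup_sup.
  - move=> i x; rewrite /A /= in_itv /= andbT => xi; rewrite lee_fin f0//.
    exact: lt_le_trans xi.
have E n : (\int[mu]_(x in A n) (f x)%:E)%E = (l1 - F (a n))%:E.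
  rewrite (@ge0_continuous_FTC2y _ f F (a n) l1)//.
  - by move=> x /(lt_le_trans (a0 n)) /f0.
  - apply/continuous_within_itvcyP; split.
      move=> x; rewrite in_itv /= andbT => /(lt_trans (a0 n)) x0; exact: cf.
    by apply: cvg_at_right_filter; exact: cf.
  - by move=> x /(lt_trans (a0 n)) x0; apply: ex_derive; exact: dF.
  - by apply: cvg_at_right_filter; exact: cF.
  - move=> x; rewrite in_itv /= andbT => /(lt_trans (a0 n)) x0.
    by rewrite derive1E; have [_ ->] := dF _ x0.
have h2 : (l1 - F (a i))%:E @[i --> \oo] --> (l1 - l0)%:E.
  apply: cvg_EFin; first by near=> i.
  apply: cvgB; first exact: cvg_cst.
  move/cvg_at_rightP : F0; apply; split; first exact: a0.
  exact: cvg_harmonic.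
move: h; rewrite (funext E) => h.
exact: (cvg_unique _ h h2).
Unshelve. all: by end_near. Qed.

(** [t^(x-1) / (1 + t)^(x+1)], the derivative of [(t / (1 + t))^x / x]: it behaves
   like [t^(x-1)] at the origin and like [t^-2] at infinity, which suits both
   ends of Euler's integral. *)
Definition gdom x t : R := expR ((x - 1) * ln t - (x + 1) * ln (1 + t)).

Let Gdom x t : R := expR (x * ln t - x * ln (1 + t)).

Let is_derive_Gdom x t : 0 < t -> is_derive t 1 (Gdom x) (x * gdom x t).
Proof.
move=> t0; have t1 : 0 < 1 + t by rewrite addr_gt0.
have h := is_derive_expR_comp
  (is_derive_subR (is_derive_scaleR x (is_derive1_ln t0))
                  (is_derive_scaleR x (is_derive_ln1D t0))).
apply: (is_derive_eq h).
rewrite /gdom (_ : (x - 1) * _ - _ =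
  x * ln t - x * ln (1 + t) + (- ln t) + (- ln (1 + t))); last by ring.
rewrite !expRD !expRN !lnK ?posrE//.
by field; rewrite !gt_eqF// expR_gt0.
Qed.

Let is_derive_gdom x t : 0 < t -> exists d, is_derive t 1 (gdom x) d.
Proof.
move=> t0; have h := is_derive_expR_comp
  (is_derive_subR (is_derive_scaleR (x - 1) (is_derive1_ln t0))
                  (is_derive_scaleR (x + 1) (is_derive_ln1D t0))).
by eexists; exact: h.
Qed.

Lemma expR_xln_cvg0 x : 0 < x -> expR (x * ln t) @[t --> (0 : R)^'+] --> (0 : R).
Proof.
move=> x0; apply/cvgrPdist_lt => e e0; near=> t.
have t0 : 0 < t by near: t; exact: nbhs_right_gt.
rewrite sub0r normrN ger0_norm ?expR_ge0// -[ltRHS]lnK ?posrE// ltr_expR.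
rewrite mulrC -ltr_pdivlMr// -(expRK (ln e / x)) ltr_ln ?posrE ?expR_gt0//.
by near: t; apply: nbhs_right_lt; rewrite expR_gt0.
Unshelve. all: by end_near. Qed.

Let Gdom_cvg0 x : 0 < x -> Gdom x t @[t --> 0^'+] --> (0 : R).
Proof.
move=> x0; apply: (@squeeze_cvgr _ _ _ _ (cst 0) (fun t => expR (x * ln t))).
- near=> t; have t0 : 0 < t by near: t; exact: nbhs_right_gt.
  rewrite [X in X && _]expR_ge0 /= ler_expR gerBl.
  by rewrite mulr_ge0 ?(ltW x0)// ln_ge0// lerDl ltW.
- exact: cvg_cst.
- exact: expR_xln_cvg0.
Unshelve. all: by end_near. Qed.

Let Gdom_cvgy x : 0 < x -> Gdom x t @[t --> +oo%R] --> (1 : R).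
Proof.
move=> x0; apply: (@squeeze_cvgr _ _ _ _ (fun t => 1 - x * t^-1) (cst 1)).
- near=> t; have t0 : 0 < t by near: t; exact: nbhs_pinfty_gt.
  have t1 : 0 < 1 + t by rewrite addr_gt0.
  have h : ln (1 + t) - ln t <= t^-1.
    rewrite -ln_div ?posrE// mulrDl divff ?gt_eqF// mul1r addrC le_ln1Dx//.
    by rewrite (lt_trans _ (_ : 0 < _)) ?invr_gt0.
  apply/andP; split.
    apply: le_trans (expR_ge1Dx _); rewrite -mulrBr lerD2l -lerN2 -mulrN opprB.
    by rewrite opprK ler_pM2l.
  have -> : cst 1 t = expR 0 :> R by rewrite expR0.
  rewrite ler_expR -mulrBr pmulr_rle0// subr_le0 ler_ln ?posrE//.
  by rewrite lerDr.
- rewrite (_ : nbhs (1 : R) = nbhs (1 - x * 0 : R)); last by rewrite mulr0 subr0.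
  apply: cvgB; first exact: cvg_cst.
  apply: cvgMr; apply/gtr0_cvgV0; last exact: cvg_id.
  by near=> t; near: t; exact: nbhs_pinfty_gt.
- exact: cvg_cst.
Unshelve. all: by end_near. Qed.

Let Gdom_FTC x : 0 < x -> (\int[mu]_(t in D) (x * gdom x t)%:E)%E = 1%:E.
Proof.
move=> x0; have -> : 1 = 1 - 0 :> R by rewrite subr0.
apply: (@ge0_FTC_halfline _ (Gdom x) 0 1).
- by move=> t t0; rewrite mulr_ge0 ?expR_ge0// ltW.
- move=> t t0; have [d hd] := is_derive_gdom x t0.
  exact: is_derive_continuous (is_derive_scaleR x hd).
- exact: is_derive_Gdom.
- exact: Gdom_cvg0.
- exact: Gdom_cvgy.
Qed.

Let measurable_gdom x : measurable_fun D (gdom x).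
Proof.
apply: measurable_halfline_continuous => t t0.
by have [d hd] := is_derive_gdom x t0; exact: is_derive_continuous hd.
Qed.

(** The kernel is nonnegative and has a bounded primitive. *)
Lemma integrable_gdom x : 0 < x -> mu.-integrable D (EFin \o gdom x).
Proof.
move=> x0; apply/integrableP; split; first by apply/measurable_EFinP; exact: measurable_gdom.
under eq_integral do rewrite /= ger0_norm ?expR_ge0//.
have : (\int[mu]_(t in D) (x%:E * (gdom x t)%:E))%E = 1%:E by exact: Gdom_FTC.
rewrite ge0_integralZl_EFin //; last first.
- exact: ltW.
- by apply/measurable_EFinP; exact: measurable_gdom.
- by move=> t _; rewrite lee_fin expR_ge0.
- exact: measurable_halfline.
case: (\int[mu]_(t in D) (gdom x t)%:E)%E => [r _| |]; first by rewrite ltry.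
- by rewrite gt0_muley ?lte_fin.
- by rewrite gt0_muleNy ?lte_fin.
Qed.

Lemma integrable_dominated f x C : 0 < x -> measurable_fun D f ->
  (forall t, 0 < t -> `|f t| <= C * gdom x t) -> mu.-integrable D (EFin \o f).
Proof.
move=> x0 mf hf.
have h := @integrableZl _ _ R mu D measurable_halfline C _ (integrable_gdom x0).
apply: le_integrable h; first exact: measurable_halfline.
  exact/measurable_EFinP.
move=> t; rewrite halflineE => t0 /=; rewrite lee_fin.
by rewrite (le_trans (hf _ t0))// ler_norm.
Qed.

(** The nonnegative case, applied to the integrand shifted by a multiple of
   the dominating kernel. *)
Lemma FTC_dominated f F x C (l0 l1 : R) : 0 < x ->
  (forall t, 0 < t -> `|f t| <= C * gdom x t) ->
  (forall t, 0 < t -> {for t, continuous f}) ->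
  (forall t, 0 < t -> is_derive t 1 F (f t)) ->
  F t @[t --> 0^'+] --> l0 -> F t @[t --> +oo%R] --> l1 ->
  Rintegral mu D f = l1 - l0.
Proof.
move=> x0 hf cf dF F0 F1.
pose c := C / x.
have cE : c * x = C by rewrite /c divfK// gt_eqF.
have fi : mu.-integrable D (EFin \o f).
  by apply: integrable_dominated hf => //; exact: measurable_halfline_continuous.
have gi : mu.-integrable D (EFin \o (fun t => c * (x * gdom x t))).
  apply: (@integrable_dominated _ x C) => //.
  - apply: measurable_funM => //; apply: measurable_funM => //; exact: measurable_gdom.
  - move=> t t0; rewrite mulrA cE ger0_norm//.
    by apply: le_trans (hf _ t0).
have e1 : (\int[mu]_(t in D) (c * (x * gdom x t) + f t)%:E)%E = (c * 1 + l1 - (c * 0 + l0))%:E.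
  apply: (@ge0_FTC_halfline _ (fun t => c * Gdom x t + F t)).
  - move=> t t0; have := hf _ t0; rewrite mulrA cE ler_norml => /andP[h _].
    by rewrite addrC -lerBlDr sub0r.
  - move=> t t0; have [d hd] := is_derive_gdom x t0.
    apply: cvgD; last exact: cf.
    exact: is_derive_continuous (is_derive_scaleR c (is_derive_scaleR x hd)).
  - move=> t t0; apply: is_derive_addR; last exact: dF.
    by apply: is_derive_scaleR; exact: is_derive_Gdom.
  - by apply: cvgD => //; apply: cvgMr; exact: Gdom_cvg0.
  - by apply: cvgD => //; apply: cvgMr; exact: Gdom_cvgy.
have e2 : Rintegral mu D (fun t => c * (x * gdom x t) + f t) = c + l1 - l0.
  by rewrite /Rintegral e1 /= mulr1 mulr0 add0r.
move: e2; rewrite RintegralD//; last exact: measurable_halfline.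
have -> : \int[mu]_(t in D) (c * (x * gdom x t)) = c.
  rewrite RintegralZl; first by rewrite /Rintegral Gdom_FTC//= mulr1.
  - exact: measurable_halfline.
  - apply: (@integrable_dominated _ x x) => //.
    + by apply: measurable_funM => //; exact: measurable_gdom.
    + by move=> t t0; rewrite ger0_norm// mulr_ge0 ?expR_ge0// ltW.
by move=> h; apply: (addrI c); rewrite h; ring.
Qed.

(** The extra factor [1 + t] lets one bound dominate the integrands of both
   [Gamma z] and [Gamma (z + 1)].  The constant comes from the tangent of the
   logarithm at [x + 2]. *)
Lemma euler_dominated x t : 0 < x -> 0 < t ->
  expR ((x - 1) * ln t - t) * (1 + t) <=
  expR (1 - (x + 2) + (x + 2) * ln (x + 2)) * gdom x t.
Proof.
move=> x0 t0; have t1 : 0 < 1 + t by rewrite addr_gt0.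
have m0 : 0 < x + 2 by rewrite addr_gt0.
rewrite -[1 + t]lnK ?posrE// /gdom -!expRD ler_expR.
suff : (x + 2) * ln (1 + t) <= (1 + t) - (x + 2) + (x + 2) * ln (x + 2).
  set a := ln (1 + t); set b := ln t; set c := ln (x + 2); lra.
have h : ln (1 + t) - ln (x + 2) <= (1 + t) / (x + 2) - 1.
  by rewrite -ln_div ?posrE// ln_le_subr1// divr_gt0.
have : (x + 2) * (ln (1 + t) - ln (x + 2)) <= (x + 2) * ((1 + t) / (x + 2) - 1).
  by rewrite ler_pM2l.
rewrite !mulrBr mulr1 mulrCA divff ?gt_eqF// mulr1; lra.
Qed.

End HalfLine.

(** * Complex integrals over the half-line *)

Section ComplexIntegral.
Context {R : realType}.
Local Notation mu := (@lebesgue_measure R).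
Local Notation D := (@halfline R).
Implicit Types (f g : R -> R[i]) (t : R) (z w c : R[i]).

Definition cmeasurable f :=
  measurable_fun D (fun t => complex.Re (f t)) /\
  measurable_fun D (fun t => complex.Im (f t)).

Definition cintegrable f :=
  mu.-integrable D (EFin \o (fun t => complex.Re (f t))) /\
  mu.-integrable D (EFin \o (fun t => complex.Im (f t))).

Lemma cintegrable_dominated f (x C : R) : 0 < x -> cmeasurable f ->
  (forall t, 0 < t -> cabs (f t) <= C * gdom x t) -> cintegrable f.
Proof.
move=> x0 [m1 m2] h; split.
- apply: (integrable_dominated x0 m1) => t t0.
  exact: le_trans (normr_Re _) (h _ t0).
- apply: (integrable_dominated x0 m2) => t t0.
  exact: le_trans (normr_Im _) (h _ t0).
Qed.

Lemma cintegralD f g : cintegrable f -> cintegrable g ->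
  cintegral D (fun t => f t + g t) = cintegral D f + cintegral D g.
Proof.
move=> [f1 f2] [g1 g2]; rewrite /cintegral; apply: complexP; rewrite ?Re_add ?Im_add /=.
- rewrite -RintegralD//; last exact: measurable_halfline.
  by apply: eq_Rintegral => t _; rewrite Re_add.
- rewrite -RintegralD//; last exact: measurable_halfline.
  by apply: eq_Rintegral => t _; rewrite Im_add.
Qed.

Lemma integrable_lin (f g : R -> R) (p q : R) :
  mu.-integrable D (EFin \o f) -> mu.-integrable D (EFin \o g) ->
  mu.-integrable D (EFin \o (fun t => p * f t + q * g t)).
Proof.
move=> fi gi.
have h1 := @integrableZl _ _ R mu D measurable_halfline p _ fi.
have h2 := @integrableZl _ _ R mu D measurable_halfline q _ gi.
exact: (@integrableD _ _ R mu D measurable_halfline _ _ h1 h2).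
Qed.

Lemma Rintegral_lin (f g : R -> R) (p q : R) :
  mu.-integrable D (EFin \o f) -> mu.-integrable D (EFin \o g) ->
  Rintegral mu D (fun t => p * f t + q * g t) =
  p * Rintegral mu D f + q * Rintegral mu D g.
Proof.
move=> fi gi.
have h1 := @integrableZl _ _ R mu D measurable_halfline p _ fi.
have h2 := @integrableZl _ _ R mu D measurable_halfline q _ gi.
rewrite RintegralD//; last exact: measurable_halfline.
by rewrite !RintegralZl//; exact: measurable_halfline.
Qed.

Lemma cintegrableZ c f : cintegrable f -> cintegrable (fun t => c * f t).
Proof.
move=> [f1 f2]; split.
- have h := integrable_lin (complex.Re c) (- complex.Im c) f1 f2.
  rewrite (_ : (fun t => complex.Re (c * f t)) = (fun t => complex.Re c * complex.Re (f t) + - complex.Im c * complex.Im (f t)))//.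
  by apply/funext => t; rewrite Re_mul mulNr.
- have h := integrable_lin (complex.Re c) (complex.Im c) f2 f1.
  rewrite (_ : (fun t => complex.Im (c * f t)) = (fun t => complex.Re c * complex.Im (f t) + complex.Im c * complex.Re (f t)))//.
  by apply/funext => t; rewrite Im_mul.
Qed.

Lemma cintegralZ c f : cintegrable f ->
  cintegral D (fun t => c * f t) = c * cintegral D f.
Proof.
move=> [f1 f2]; rewrite /cintegral; apply: complexP; rewrite ?Re_mul ?Im_mul /=.
- rewrite -mulNr -Rintegral_lin//.
  by apply: eq_Rintegral => t _; rewrite Re_mul mulNr.
- rewrite -Rintegral_lin//.
  by apply: eq_Rintegral => t _; rewrite Im_mul.
Qed.

Lemma eq_cintegral f g : (forall t, 0 < t -> f t = g t) ->
  cintegral D f = cintegral D g.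
Proof.
move=> h; rewrite /cintegral; congr (_ +i* _);
  by apply: eq_Rintegral => t; rewrite inE halflineE => t0; rewrite h.
Qed.

(** The factor [2] is the price of bounding the real and imaginary parts
   separately. *)
Lemma cabs_cintegral_le f (g : R -> R) : cintegrable f ->
  mu.-integrable D (EFin \o g) -> (forall t, 0 < t -> cabs (f t) <= g t) ->
  cabs (cintegral D f) <= 2 * Rintegral mu D g.
Proof.
move=> [f1 f2] gi h; apply: (le_trans (cabs_le _)); rewrite mulr2n mulrDl mul1r /=.
have key (u : R -> R) : mu.-integrable D (EFin \o u) ->
    (forall t, 0 < t -> `|u t| <= g t) -> `|Rintegral mu D u| <= Rintegral mu D g.
  move=> ui hu; apply: (le_trans (le_normr_Rintegral _ ui)); first exact: measurable_halfline.
  apply: le_Rintegral => //; first exact: measurable_halfline.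
  - exact: (@integrable_norm _ _ R mu D).
  - by move=> t; rewrite halflineE => t0; exact: hu.
rewrite lerD// key// => t t0; apply: le_trans (h _ t0).
- exact: normr_Re.
- exact: normr_Im.
Qed.

(** * Complex powers of a positive variable *)

Lemma cpowE t z : cpow t z =
  (expR (complex.Re z * ln t) * cos (complex.Im z * ln t)) +i*
  (expR (complex.Re z * ln t) * sin (complex.Im z * ln t)).
Proof. by rewrite /cpow /cexp Re_mul Im_mul /= !mulr0 subr0 add0r. Qed.

Lemma cpowD t z w : cpow t (z + w) = cpow t z * cpow t w.
Proof. by rewrite /cpow mulrDl cexpD. Qed.

Lemma cpow0 t : cpow t 0 = 1 :> R[i].
Proof. by rewrite /cpow mul0r cexp0. Qed.

Lemma cpowN t z : cpow t (- z) = (cpow t z)^-1.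
Proof. by rewrite /cpow mulNr cexpN. Qed.

Lemma cpow1 t : 0 < t -> cpow t 1 = t%:C :> R[i].
Proof. by move=> t0; rewrite /cpow mul1r cexp_real lnK. Qed.

Lemma cpow_nat t n : 0 < t -> cpow t n%:R = (t ^+ n)%:C :> R[i].
Proof.
move=> t0; elim: n => [|n IH]; first by rewrite cpow0 expr0.
by rewrite -natr1 cpowD IH cpow1// exprSr rmorphM.
Qed.

Lemma cabs_cpow t z : cabs (cpow t z) = expR (complex.Re z * ln t).
Proof. by rewrite /cpow cabs_cexp Re_mul /= mulr0 subr0. Qed.

Lemma cpow_neq0 t z : cpow t z != 0.
Proof. exact: cexp_neq0. Qed.

Lemma cpowM s t z : 0 < s -> 0 < t -> cpow (s * t) z = cpow s z * cpow t z.
Proof.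
move=> s0 t0; rewrite /cpow lnM ?posrE// -cexpD -mulrDr.
by congr (cexp (_ * _)); rewrite rmorphD.
Qed.

Lemma is_derive_cpow t z : 0 < t ->
  is_derive t 1 (fun u => complex.Re (cpow u z)) (complex.Re (z * cpow t (z - 1))) /\
  is_derive t 1 (fun u => complex.Im (cpow u z)) (complex.Im (z * cpow t (z - 1))).
Proof.
move=> t0.
have hx := is_derive_expR_comp (is_derive_scaleR (complex.Re z) (is_derive1_ln t0)).
have hc := is_derive_cos_comp (is_derive_scaleR (complex.Im z) (is_derive1_ln t0)).
have hs := is_derive_sin_comp (is_derive_scaleR (complex.Im z) (is_derive1_ln t0)).
have E : cpow t (z - 1) = (t^-1)%:C * cpow t z.
  by rewrite cpowD cpowN cpow1// mulrC -fmorphV.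
split.
- rewrite (_ : (fun u => _) = (fun u => expR (complex.Re z * ln u) * cos (complex.Im z * ln u))); last first.
    by apply/funext => u; rewrite cpowE.
  apply: (is_derive_eq (is_derive_mulR hx hc)).
  by rewrite E cpowE !(Re_mul, Im_mul) /=; ring.
- rewrite (_ : (fun u => _) = (fun u => expR (complex.Re z * ln u) * sin (complex.Im z * ln u))); last first.
    by apply/funext => u; rewrite cpowE.
  apply: (is_derive_eq (is_derive_mulR hx hs)).
  by rewrite E cpowE !(Re_mul, Im_mul) /=; ring.
Qed.

End ComplexIntegral.

(** * The Gamma function *)

Section GammaFunction.
Context {R : realType}.
Local Notation mu := (@lebesgue_measure R).
Local Notation D := (@halfline R).
Implicit Types (t : R) (z w c : R[i]).

Definition euler z t : R[i] := cpow t (z - 1) * (expR (- t))%:C.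

Lemma cabs_euler z t : cabs (euler z t) = expR ((complex.Re z - 1) * ln t - t).
Proof.
rewrite /euler cabsM cabs_cpow cabs_real ger0_norm ?expR_ge0// -expRD.
by rewrite Re_add Re_opp /=.
Qed.

Lemma eulerS z t : 0 < t -> euler (z + 1) t = t%:C * euler z t.
Proof.
move=> t0; rewrite /euler [z + 1 - 1]addrAC (cpowD t (z - 1) 1) cpow1//.
by rewrite [cpow _ _ * _]mulrC mulrA.
Qed.

Lemma is_derive_expRN t : is_derive t 1 (fun u => expR (- u) : R) (- expR (- t)).
Proof.
have h := is_derive_expR_comp (is_deriveNid t (1 : R)).
by apply: (is_derive_eq h); rewrite mulrN1.
Qed.

Lemma is_derive_euler z t : 0 < t ->
  is_derive t 1 (fun u => complex.Re (euler (z + 1) u)) (complex.Re (z * euler z t - euler (z + 1) t)) /\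
  is_derive t 1 (fun u => complex.Im (euler (z + 1) u)) (complex.Im (z * euler z t - euler (z + 1) t)).
Proof.
move=> t0; have [h1 h2] := is_derive_cpow z t0.
have e := is_derive_expRN t.
split.
- rewrite (_ : (fun u => _) = (fun u => complex.Re (cpow u z) * expR (- u))); last first.
    by apply/funext => u; rewrite /euler addrK Re_mul /= mulr0 subr0.
  apply: (is_derive_eq (is_derive_mulR h1 e)).
  by rewrite /euler addrK mulrA Re_add Re_opp !(Re_mul, Im_mul) /=; ring.
- rewrite (_ : (fun u => _) = (fun u => complex.Im (cpow u z) * expR (- u))); last first.
    by apply/funext => u; rewrite /euler addrK Im_mul /= mulr0 add0r.
  apply: (is_derive_eq (is_derive_mulR h2 e)).
  by rewrite /euler addrK mulrA Im_add Im_opp !(Re_mul, Im_mul) /=; ring.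
Qed.

Lemma euler_continuous z t : 0 < t ->
  {for t, continuous (fun u => complex.Re (euler z u))} /\
  {for t, continuous (fun u => complex.Im (euler z u))}.
Proof.
move=> t0; have [h1 h2] := is_derive_euler (z - 1) t0; rewrite !subrK in h1 h2.
by split; [exact: is_derive_continuous h1 | exact: is_derive_continuous h2].
Qed.

Lemma measurable_euler z : cmeasurable (euler z).
Proof.
by split; apply: measurable_halfline_continuous => t t0;
  have [] := euler_continuous z t0.
Qed.

Lemma euler_dominated_exists z : 0 < complex.Re z -> exists2 C : R, 0 < C &
  forall t, 0 < t -> cabs (euler z t) * (1 + t) <= C * gdom (complex.Re z) t.
Proof.
move=> z0; exists (expR (1 - (complex.Re z + 2) + (complex.Re z + 2) * ln (complex.Re z + 2))).
  exact: expR_gt0.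
by move=> t t0; rewrite cabs_euler; exact: euler_dominated.
Qed.

Lemma cintegrable_euler z : 0 < complex.Re z -> cintegrable (euler z).
Proof.
move=> z0; have [C C0 hC] := euler_dominated_exists z0.
apply: (cintegrable_dominated z0 (measurable_euler z) (C := C)) => t t0.
apply: le_trans (hC _ t0); rewrite ler_peMr ?normc_ge0// lerDl; exact: ltW.
Qed.

Lemma cGammaE z : cGamma z = cintegral D (euler z).
Proof. by []. Qed.

Lemma expR_xlnB_cvgy (x : R) : 0 < x -> expR (x * ln t - t) @[t --> +oo%R] --> (0 : R).
Proof.
(* [K] is the maximum of [t^(x+1) e^-t], reached at [x + 1]. *)
move=> x0; pose K := expR ((x + 1) * (ln (x + 1) - 1)).
have m0 : 0 < x + 1 by rewrite addr_gt0.
apply: (@squeeze_cvgr _ _ _ _ (cst 0) (fun t => K * t^-1)).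
- near=> t; have t0 : 0 < t by near: t; exact: nbhs_pinfty_gt.
  rewrite [X in X && _]expR_ge0 /= /K -[t^-1]lnK ?posrE ?invr_gt0//.
  rewrite -expRD ler_expR lnV ?posrE//.
  have : (x + 1) * (ln t - ln (x + 1)) <= (x + 1) * (t / (x + 1) - 1).
    by rewrite ler_pM2l// -ln_div ?posrE// ln_le_subr1// divr_gt0.
  rewrite !mulrBr !mulr1 mulrCA divff ?gt_eqF// mulr1.
  set a := ln t; set b := ln (x + 1); lra.
- exact: cvg_cst.
- rewrite (_ : nbhs (0 : R) = nbhs (K * 0 : R)); last by rewrite mulr0.
  apply: cvgMr; apply/gtr0_cvgV0; last exact: cvg_id.
  by near=> t; near: t; exact: nbhs_pinfty_gt.
Unshelve. all: by end_near. Qed.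

Lemma cvg0_dominated T (F : set_system T) (FF : Filter F) (f g : T -> R) :
  (\forall i \near F, `|f i| <= g i) -> g @ F --> (0 : R) -> f @ F --> (0 : R).
Proof.
move=> h g0; have h' : \forall i \near F, - g i <= f i <= g i.
  by apply: filterS h => i; rewrite ler_norml.
have g0' : (fun i => - g i) @ F --> (0 : R).
  by rewrite (_ : nbhs (0 : R) = nbhs (- 0 : R)); [exact: cvgN | rewrite oppr0].
exact: (@squeeze_cvgr T F FF R _ _ _ h' 0 g0' g0).
Qed.

Lemma euler_cvg0 z : 0 < complex.Re z -> cabs (euler (z + 1) t) @[t --> 0^'+] --> (0 : R).
Proof.
move=> z0; apply: (@cvg0_dominated _ _ _ _ (fun t => expR (complex.Re z * ln t))); last exact: expR_xln_cvg0.
near=> t; have t0 : 0 < t by near: t; exact: nbhs_right_gt.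
rewrite ger0_norm ?normc_ge0// cabs_euler Re_add /= addrK ler_expR gerBl; exact: ltW.
Unshelve. all: by end_near. Qed.

Lemma euler_cvgy z : 0 < complex.Re z -> cabs (euler (z + 1) t) @[t --> +oo%R] --> (0 : R).
Proof.
move=> z0; rewrite (_ : (fun t => _) = (fun t => expR (complex.Re z * ln t - t))).
  exact: expR_xlnB_cvgy.
by apply/funext => t; rewrite cabs_euler Re_add /= addrK.
Qed.

(** The derivative of [t^z e^-t] is [z t^(z-1) e^-t - t^z e^-t], and [t^z e^-t]
   vanishes at both ends of the half-line. *)
Lemma cGammaS z : 0 < complex.Re z -> cGamma (z + 1) = z * cGamma z.
Proof.
move=> z0; have [C C0 hC] := euler_dominated_exists z0.
have z1 : 0 < complex.Re (z + 1) by rewrite Re_add /= addr_gt0.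
have i1 := cintegrable_euler z0; have i2 := cintegrable_euler z1.
pose f t := z * euler z t - euler (z + 1) t.
have hf t : 0 < t -> cabs (f t) <= (cabs z + 1) * C * gdom (complex.Re z) t.
  move=> t0; apply: (le_trans (cabsB _ _)); rewrite cabsM eulerS// cabsM cabs_real gtr0_norm//.
  have h := hC _ t0; have e0 := normc_ge0 (euler z t); have c0 := normc_ge0 z.
  rewrite -mulrA; apply: (@le_trans _ _ ((cabs z + 1) * (cabs (euler z t) * (1 + t)))); last first.
    by rewrite ler_wpM2l// addr_ge0.
  rewrite -subr_ge0 (_ : _ - _ = cabs z * cabs (euler z t) * t + cabs (euler z t)); last by ring.
  by rewrite addr_ge0// !mulr_ge0// ltW.
have c1 t : 0 < t -> {for t, continuous (fun u => complex.Re (f u))}.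
  move=> t0; have [h1 h2] := euler_continuous z t0; have [h3 _] := euler_continuous (z + 1) t0.
  rewrite (_ : (fun u => _) = (fun u => complex.Re z * complex.Re (euler z u) - complex.Im z * complex.Im (euler z u) - complex.Re (euler (z + 1) u))); last first.
    by apply/funext => u; rewrite /f Re_add Re_opp Re_mul.
  by apply: cvgB => //; apply: cvgB; apply: cvgMr.
have c2 t : 0 < t -> {for t, continuous (fun u => complex.Im (f u))}.
  move=> t0; have [h1 h2] := euler_continuous z t0; have [_ h3] := euler_continuous (z + 1) t0.
  rewrite (_ : (fun u => _) = (fun u => complex.Re z * complex.Im (euler z u) + complex.Im z * complex.Re (euler z u) - complex.Im (euler (z + 1) u))); last first.
    by apply/funext => u; rewrite /f Im_add Im_opp Im_mul.
  by apply: cvgB => //; apply: cvgD; apply: cvgMr.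
have If : cintegral D f = 0.
  apply: complexP => /=.
  - transitivity (0 - 0 : R); last by rewrite subr0.
    apply: (FTC_dominated z0 (F := fun t => complex.Re (euler (z + 1) t)) (C := (cabs z + 1) * C) (l0 := 0) (l1 := 0)) => //.
    + by move=> t t0; apply: le_trans (hf _ t0); exact: normr_Re.
    + by move=> t t0; have [] := is_derive_euler z t0.
    + apply: cvg0_dominated (euler_cvg0 z0); by near=> t; exact: normr_Re.
    + apply: cvg0_dominated (euler_cvgy z0); by near=> t; exact: normr_Re.
  - transitivity (0 - 0 : R); last by rewrite subr0.
    apply: (FTC_dominated z0 (F := fun t => complex.Im (euler (z + 1) t)) (C := (cabs z + 1) * C) (l0 := 0) (l1 := 0)) => //.
    + by move=> t t0; apply: le_trans (hf _ t0); exact: normr_Im.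
    + by move=> t t0; have [] := is_derive_euler z t0.
    + apply: cvg0_dominated (euler_cvg0 z0); by near=> t; exact: normr_Im.
    + apply: cvg0_dominated (euler_cvgy z0); by near=> t; exact: normr_Im.
rewrite !cGammaE -cintegralZ//.
have -> : cintegral D (fun t => z * euler z t) = cintegral D (fun t => f t + euler (z + 1) t).
  by apply: eq_cintegral => t _; rewrite /f subrK.
rewrite cintegralD// ?If ?add0r//.
rewrite (_ : f = fun t => z * euler z t + (-1) * euler (z + 1) t); last first.
  by apply/funext => t; rewrite /f mulN1r.
have := cintegrableZ z i1; have := cintegrableZ (-1) i2.
move=> [a1 a2] [b1 b2]; split.
- have := integrable_lin 1 1 b1 a1; congr (mu.-integrable D (EFin \o _)).
  by apply/funext => t; rewrite !mul1r Re_add.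
- have := integrable_lin 1 1 b2 a2; congr (mu.-integrable D (EFin \o _)).
  by apply/funext => t; rewrite !mul1r Im_add.
Unshelve. all: by end_near. Qed.

Lemma cGamma1 : cGamma 1 = 1 :> R[i].
Proof.
have e1 t : euler 1 t = (expR (- t))%:C by rewrite /euler subrr cpow0 mul1r.
rewrite cGammaE (@eq_cintegral _ _ (fun t => (expR (- t))%:C)); last by move=> t _; exact: e1.
apply: complexP => /=; last first.
  by rewrite Rintegral_cst ?mul0r//; exact: measurable_halfline.
have h1 : 0 < complex.Re (1 : R[i]) by rewrite /= ltr01.
have [C C0 hC] := euler_dominated_exists h1.
transitivity (- 0 - - 1 : R); last by rewrite oppr0 sub0r opprK.
apply: (FTC_dominated h1 (F := fun t => - expR (- t)) (C := C) (l0 := - 1) (l1 := - 0)).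
- move=> t t0; apply: le_trans (hC _ t0); rewrite e1 cabs_real.
  by rewrite ler_peMr// lerDl ltW.
- by move=> t t0; exact: is_derive_continuous (is_derive_expRN t).
- move=> t t0; have := is_derive_scaleR (-1) (is_derive_expRN t).
  rewrite mulrNN mul1r; congr (is_derive _ _ _ _).
  by apply/funext => u; rewrite mulN1r.
- apply: cvgN; rewrite (_ : nbhs (1 : R) = nbhs (expR (- 0) : R)); last by rewrite oppr0 expR0.
  apply: cvg_at_right_filter.
  exact: is_derive_continuous (is_derive_expRN 0).
- apply: cvgN; apply: (@cvg0_dominated _ _ _ _ (fun t => t^-1)).
    near=> t; have t0 : 0 < t by near: t; exact: nbhs_pinfty_gt.
    rewrite ger0_norm ?expR_ge0// expRN lef_pV2 ?posrE ?expR_gt0//.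
    by apply: le_trans (expR_ge1Dx _); rewrite lerDr.
  apply/gtr0_cvgV0; last exact: cvg_id.
  by near=> t; near: t; exact: nbhs_pinfty_gt.
Unshelve. all: by end_near. Qed.

Lemma cGamma_shift z n : 0 < complex.Re z ->
  cGamma (z + n%:R) = pochhammer z n * cGamma z.
Proof.
move=> z0; elim: n => [|n IH]; first by rewrite addr0 /pochhammer big_ord0 mul1r.
rewrite -natr1 addrA cGammaS ?IH; last first.
  by rewrite Re_add Re_nat ltr_wpDr.
by rewrite /pochhammer big_ord_recr /= mulrA [(_ + _) * _]mulrC.
Qed.

Lemma cGamma_fact n : cGamma (n%:R + 1) = n`!%:R :> R[i].
Proof.
rewrite addrC cGamma_shift /= ?ltr01// cGamma1 mulr1 /pochhammer.
elim: n => [|n IH]; first by rewrite big_ord0 fact0.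
by rewrite big_ord_recr /= IH factS natrM mulrC nat1r.
Qed.

End GammaFunction.

(** * Asymptotics of the Gamma function *)

Section GammaAsymptotics.
Context {R : realType}.
Local Notation mu := (@lebesgue_measure R).
Local Notation D := (@halfline R).
Implicit Types (t : R) (z w c : R[i]).

Lemma gamma_moment n :
  mu.-integrable D (EFin \o (fun t => t ^+ n * expR (- t))) /\
  Rintegral mu D (fun t => t ^+ n * expR (- t)) = n`!%:R.
Proof.
have h0 : 0 < complex.Re (n%:R + 1 : R[i]) by rewrite Re_add Re_nat /= ltr_wpDl.
have e t : 0 < t -> complex.Re (euler (n%:R + 1) t) = t ^+ n * expR (- t).
  by move=> t0; rewrite /euler addrK cpow_nat// Re_mul /= mul0r subr0.
split.
- have [h _] := cintegrable_euler h0.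
  apply: (@eq_integrable _ _ R mu D measurable_halfline _ _ _ h).
  by move=> t; rewrite inE halflineE => t0; congr EFin; exact: e.
- have := @cGamma_fact R n; rewrite cGammaE => h.
  have := congr1 (@complex.Re R) h; rewrite Re_nat => <-.
  by apply: eq_Rintegral => t; rewrite inE halflineE => t0; exact/esym/e.
Qed.

(** The [i]-th moment of [t / (n + 2)] under the density [t^n e^-t / n!]. *)
Definition moment_ratio (i n : nat) : R := (n + i)`!%:R / (n`!%:R * n.+2%:R ^+ i).

Lemma moment_ratio_cvg i : moment_ratio i n @[n --> \oo] --> (1 : R).
Proof.
elim: i => [|i IH].
  rewrite (_ : moment_ratio 0 = cst 1); first exact: cvg_cst.
  by apply/funext => n; rewrite /moment_ratio addn0 expr0 mulr1 divff// pnatr_eq0 -lt0n fact_gt0.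
rewrite (_ : moment_ratio i.+1 = (fun n => moment_ratio i n * (1 + (i%:R - 1) * n.+2%:R^-1))); last first.
  apply/funext => n; rewrite /moment_ratio addnS factS natrM exprS.
  have : (n`!%:R : R) != 0 by rewrite pnatr_eq0 -lt0n fact_gt0.
  have : (n.+2%:R : R) != 0 by rewrite pnatr_eq0.
  move=> h1 h2; have -> : (n + i).+1%:R = n.+2%:R + (i%:R - 1) :> R.
    by rewrite -!natr1 natrD; ring.
  move: h1 h2; move: (n.+2%:R : R) (n`!%:R : R) => N F h1 h2.
  by field; rewrite h1 h2 expf_neq0.
rewrite (_ : nbhs (1 : R) = nbhs (1 * (1 + (i%:R - 1) * 0) : R)); last by rewrite mulr0 addr0 mulr1.
apply: cvgM => //; apply: cvgD; first exact: cvg_cst.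
apply: cvgMr.
have := @cvg_harmonic R; rewrite -(cvg_shiftn 1) /=.
by under eq_fun do rewrite addn1.
Qed.

(** Under the Gamma law of shape [n + 1], the variable divided by [n + 2] has all
   its moments tending to [1]. *)
Lemma cvg_poly_moment (p : {poly R}) :
  (forall n, mu.-integrable D (EFin \o (fun t => p.[t / n.+2%:R] * (t ^+ n * expR (- t))))) /\
  (Rintegral mu D (fun t => p.[t / n.+2%:R] * (t ^+ n * expR (- t))) / n`!%:R) @[n --> \oo] --> p.[1].
Proof.
have E n t : p.[t / n.+2%:R] * (t ^+ n * expR (- t)) =
    \sum_(i < size p) (p`_i / n.+2%:R ^+ i) * (t ^+ (n + i) * expR (- t)).
  rewrite horner_coef mulr_suml; apply: eq_bigr => i _.
  by rewrite exprMn exprVn exprD; ring.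
have key n m : mu.-integrable D (EFin \o (fun t => \sum_(i < m) (p`_i / n.+2%:R ^+ i) * (t ^+ (n + i) * expR (- t)))) /\
    Rintegral mu D (fun t => \sum_(i < m) (p`_i / n.+2%:R ^+ i) * (t ^+ (n + i) * expR (- t))) =
    \sum_(i < m) (p`_i / n.+2%:R ^+ i) * (n + i)`!%:R.
  elim: m => [|m [IH1 IH2]].
    rewrite big_ord0 (_ : (fun t => _) = cst 0); last by apply/funext => t; rewrite big_ord0.
    split; last by rewrite Rintegral_cst ?mul0r//; exact: measurable_halfline.
    rewrite (_ : EFin \o cst 0 = cst 0%E)//; apply: integrable0; exact: measurable_halfline.
  have [h1 h2] := gamma_moment (n + m).
  have e : (fun t => \sum_(i < m.+1) (p`_i / n.+2%:R ^+ i) * (t ^+ (n + i) * expR (- t))) =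
     (fun t => 1 * (\sum_(i < m) (p`_i / n.+2%:R ^+ i) * (t ^+ (n + i) * expR (- t))) +
       (p`_m / n.+2%:R ^+ m) * (t ^+ (n + m) * expR (- t))).
    by apply/funext => t; rewrite big_ord_recr /= mul1r.
  rewrite e; split; first exact: integrable_lin.
  by rewrite Rintegral_lin// mul1r IH2 h2 big_ord_recr.
split.
  move=> n; have [h _] := key n (size p).
  by rewrite (_ : (fun t => _) = (fun t => \sum_(i < size p) (p`_i / n.+2%:R ^+ i) * (t ^+ (n + i) * expR (- t))))//; apply/funext => t; rewrite E.
rewrite (_ : (fun n => _) = (fun n => \sum_(i < size p) p`_i * moment_ratio i n)); last first.
  apply/funext => n; have [_ h] := key n (size p).
  rewrite (_ : (fun t => _) = (fun t => \sum_(i < size p) (p`_i / n.+2%:R ^+ i) * (t ^+ (n + i) * expR (- t)))); last first.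
    by apply/funext => t; rewrite E.
  rewrite h mulr_suml; apply: eq_bigr => i _; rewrite /moment_ratio.
  have h1 : (n`!%:R : R) != 0 by rewrite pnatr_eq0 -lt0n fact_gt0.
  have h2 : (n.+2%:R : R) != 0 by rewrite pnatr_eq0.
  move: h1 h2; move: (n.+2%:R : R) (n`!%:R : R) => N F h1 h2.
  by field; rewrite h1 expf_neq0.
rewrite (_ : p.[1] = \sum_(i < size p) p`_i * 1); last first.
  by rewrite horner_coef; apply: eq_bigr => i _; rewrite expr1n.
rewrite (_ : (fun n => _) = \sum_(i < size p) (fun n => p`_i * moment_ratio i n)); last first.
  by apply/funext => n; rewrite fct_sumE.
apply: (big_ind2 (fun (f : nat -> R) (l : R) => f @ \oo --> l)).
- exact: cvg_cst.
- by move=> f l g l' fl gl; exact: cvgD.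
- by move=> i _; apply: cvgMr; exact: moment_ratio_cvg.
Qed.

(** A polynomial majorant, of value [O(d)] at [1], of a function that is not
   polynomial: moments of integer order thus control complex powers.  It combines
   [x |ln x| <= |x - 1| (1 + x)], [|x^z| <= 1 + x^k] and
   [|x - 1| <= d + (x - 1)^2 / d]. *)
Lemma cpowB1_le (x : R) z (k : nat) (d : R) : 0 < x -> 0 < complex.Re z ->
  complex.Re z <= k%:R -> 0 < d ->
  x * cabs (cpow x z - 1) <=
  3 * cabs z * ((1 + x) * (2 + x ^+ k) * (d + d^-1 * (x - 1) ^+ 2)).
Proof.
move=> x0 z0 zk d0.
have L : x * `|ln x| <= `|x - 1| * (1 + x).
  have h1 := ln_le_subr1 x0.
  have h2 : - ln x <= x^-1 - 1 by rewrite -lnV ?posrE// ln_le_subr1// invr_gt0.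
  have h3 : x * (- ln x) <= 1 - x.
    by rewrite -(@ler_pM2l _ x) in h2 => //; rewrite mulrBr mulr1 divff ?gt_eqF in h2.
  have [x1|x1] := leP 1 x.
  - rewrite ger0_norm ?ln_ge0// ger0_norm ?subr_ge0//; nra.
  - rewrite ler0_norm; last by apply: le_trans h1 _; rewrite subr_le0 ltW.
    rewrite ltr0_norm ?subr_lt0//; nra.
have P : expR (complex.Re z * ln x) <= 1 + x ^+ k.
  have [x1|x1] := leP 1 x.
  - apply: (@le_trans _ _ (x ^+ k)); last by rewrite lerDr.
    have -> : x ^+ k = expR (k%:R * ln x) by rewrite expRM_natl lnK.
    by rewrite ler_expR ler_wpM2r// ln_ge0.
  - apply: (@le_trans _ _ 1); last by rewrite lerDl exprn_ge0// ltW.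
    rewrite -expR0 ler_expR pmulr_rle0//.
    by apply: le_trans (ln_le_subr1 x0) _; rewrite subr_le0 ltW.
have Q : `|x - 1| <= d + d^-1 * (x - 1) ^+ 2.
  rewrite -[(x - 1) ^+ 2]real_normK ?num_real//; set y := `|x - 1|.
  have : 0 <= d^-1 * ((y - d) ^+ 2 + y * d).
    by rewrite mulr_ge0 ?invr_ge0 ?(ltW d0)// addr_ge0 ?sqr_ge0// mulr_ge0 ?(ltW d0) /y.
  rewrite (_ : d^-1 * _ = d + d^-1 * y ^+ 2 - y); last by field; rewrite gt_eqF.
  by rewrite subr_ge0.
have h := cexpB1_le (z * (ln x)%:C).
have Ez : complex.Re (z * (ln x)%:C) = complex.Re z * ln x by rewrite Re_mul /= mulr0 subr0.
move: h; rewrite Ez cabsM cabs_real -/(cpow x z) => h.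
apply: (@le_trans _ _ (3 * cabs z * ((x * `|ln x|) * (1 + expR (complex.Re z * ln x))))).
  apply: le_trans (ler_wpM2l (ltW x0) h) _.
  by rewrite le_eqVlt; apply/orP; left; apply/eqP; ring.
apply: ler_wpM2l; first by rewrite mulr_ge0 ?normc_ge0.
apply: (@le_trans _ _ ((`|x - 1| * (1 + x)) * (2 + x ^+ k))).
  apply: ler_pM => //; first by rewrite mulr_ge0// ltW.
  by rewrite (_ : 2 + x ^+ k = 1 + (1 + x ^+ k)) ?lerD2l//; ring.
rewrite (_ : (1 + x) * (2 + x ^+ k) * (d + d^-1 * (x - 1) ^+ 2) =
  (d + d^-1 * (x - 1) ^+ 2) * (1 + x) * (2 + x ^+ k)); last by ring.
apply: ler_wpM2r; first by rewrite addr_ge0// exprn_ge0// ltW.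
by apply: ler_wpM2r => //; rewrite addr_ge0// ltW.
Qed.

Lemma cvgc_eps (f : nat -> R[i]) (l : R[i]) :
  (forall e : R, 0 < e -> \forall n \near \oo, cabs (f n - l) < e) ->
  f @ \oo --> (l : R[i]^o).
Proof.
move=> h; apply/cvgcP/cvgrPdist_lt => e e0; apply: filterS (h _ e0) => n.
by rewrite sub0r normrN ger0_norm ?normc_ge0.
Qed.

(** Under the Gamma law of shape [N] the variable divided by [N] concentrates at
   [1], where [x^z = 1]. *)
Lemma cGamma_ratio_cvg2 z : 0 < complex.Re z ->
  (fun n => cGamma (n.+2%:R + z) / (n.+1`!%:R * cpow n.+2%:R z)) @ \oo --> (1 : R[i]^o).
Proof.
move=> z0; apply: cvgc_eps => e e0.
pose k := (Num.truncn (complex.Re z)).+1.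
have zk : complex.Re z <= k%:R by rewrite ltW// truncnS_gt.
(* The estimate ends with [2 * 3 |z| * 2 * 7 d]: the bound on the integral, the
   majorant, [N <= 2 (N - 1)], and [7 d] just above the limit [6 d]. *)
pose d : R := e / (12 * cabs z * 7).
have cz : 0 < cabs z by rewrite cabs_gt0; apply/eqP => z1; rewrite z1 ltxx in z0.
have d0 : 0 < d by rewrite divr_gt0// !mulr_gt0.
pose p : {poly R} := (1 + 'X) * (2%:P + 'X^k) * (d%:P + d^-1 *: ('X - 1%:P) ^+ 2).
have pE x : p.[x] = (1 + x) * (2 + x ^+ k) * (d + d^-1 * (x - 1) ^+ 2).
  by rewrite /p !hornerE.
have p1 : p.[1] = 6 * d.
  by rewrite pE expr1n subrr expr0n /= mulr0 addr0; ring.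
have [pint pcvg] := cvg_poly_moment p.
rewrite p1 in pcvg.
have d7 : 6 * d < 7 * d by rewrite ltr_pM2r// ltr_nat.
near=> n.
have In : Rintegral mu D (fun t => p.[t / n.+2%:R] * (t ^+ n * expR (- t))) / n`!%:R < 7 * d.
  near: n; apply: (cvgr_lt _ pcvg _ d7).
set N : R := n.+2%:R in In *.
have N0 : 0 < N by rewrite ltr0n.
have NC : (n.+2%:R : R[i]) = N%:C by rewrite rmorph_nat.
set w : R[i] := n.+1`!%:R * cpow N z.
have f0 : (n.+1`!%:R : R[i]) != 0 by rewrite pnatr_eq0 -lt0n fact_gt0.
have w0 : w != 0 by rewrite mulf_neq0// cpow_neq0.
have b0 : 0 < complex.Re (n.+2%:R + z) by rewrite Re_add Re_nat addr_gt0.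
have c0 : 0 < complex.Re (n.+1%:R + 1 : R[i]) by rewrite Re_add Re_nat /= addr_gt0.
pose f t : R[i] := cpow N (- z) * euler (n.+2%:R + z) t + (-1) * euler (n.+1%:R + 1) t.
have i1 := cintegrableZ (cpow N (- z)) (cintegrable_euler b0).
have i2 := cintegrableZ (-1) (cintegrable_euler c0).
have fi : cintegrable f.
  move: i1 i2 => [a1 a2] [b1 b2]; split.
  - have := integrable_lin 1 1 a1 b1; congr (mu.-integrable D (EFin \o _)).
    by apply/funext => t; rewrite !mul1r Re_add.
  - have := integrable_lin 1 1 a2 b2; congr (mu.-integrable D (EFin \o _)).
    by apply/funext => t; rewrite !mul1r Im_add.
have fE : cintegral D f = cpow N (- z) * cGamma (n.+2%:R + z) - n.+1`!%:R.
  rewrite cintegralD// !cintegralZ//; try exact: cintegrable_euler.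
  by rewrite -!cGammaE cGamma_fact mulN1r.
have -> : cGamma (n.+2%:R + z) / w - 1 = cintegral D f / n.+1`!%:R.
  rewrite fE cpowN /w; field.
  by rewrite f0 cpow_neq0.
have hb t : 0 < t -> cabs (f t) <= (3 * cabs z * N) * (p.[t / N] * (t ^+ n * expR (- t))).
  move=> t0; have x0 : 0 < t / N by rewrite divr_gt0.
  have -> : f t = (t ^+ n.+1 * expR (- t))%:C * (cpow (t / N) z - 1).
    rewrite /f /euler addrK cpow_nat// mulN1r.
    rewrite (_ : n.+2%:R + z - 1 = n.+1%:R + z); last by rewrite -natr1; ring.
    rewrite cpowD cpow_nat// cpowM ?invr_gt0// (_ : cpow N^-1 z = cpow N (- z)); last first.
      by rewrite /cpow lnV ?posrE// rmorphN mulrN mulNr.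
    by rewrite rmorphM; ring.
  rewrite cabsM cabs_real ger0_norm; last by rewrite mulr_ge0 ?expR_ge0// exprn_ge0// ltW.
  have := cpowB1_le x0 z0 zk d0; rewrite -pE => h.
  have e1 : t ^+ n.+1 * expR (- t) * cabs (cpow (t / N) z - 1) =
     (N * (t ^+ n * expR (- t))) * (t / N * cabs (cpow (t / N) z - 1)).
    by rewrite exprS; field; rewrite gt_eqF.
  rewrite e1.
  apply: (@le_trans _ _ ((N * (t ^+ n * expR (- t))) * (3 * cabs z * p.[t / N]))).
    apply: ler_wpM2l => //.
    by rewrite !mulr_ge0 ?expR_ge0 ?exprn_ge0// ltW.
  by rewrite le_eqVlt; apply/orP; left; apply/eqP; ring.
have gi : mu.-integrable D (EFin \o (fun t => (3 * cabs z * N) * (p.[t / N] * (t ^+ n * expR (- t))))).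
  exact: (@integrableZl _ _ R mu D measurable_halfline _ _ (pint n)).
have := cabs_cintegral_le fi gi hb.
rewrite RintegralZl; last 2 first.
- exact: measurable_halfline.
- exact: pint.
move=> hI; rewrite cabsM cabsV cabs_nat ltr_pdivrMr ?ltr0n ?fact_gt0//.
apply: (le_lt_trans hI).
set J := Rintegral _ _ _ in In *.
have F0 : 0 < (n`!%:R : R) by rewrite ltr0n fact_gt0.
have In' : J < 7 * d * n`!%:R by rewrite -ltr_pdivrMr.
apply: (@lt_le_trans _ _ (2 * (3 * cabs z * N * (7 * d * n`!%:R)))).
  by rewrite !ltr_pM2l// !mulr_gt0.
have eE : e = 12 * cabs z * 7 * d by rewrite /d; field; rewrite gt_eqF.
rewrite eE factS natrM.
have NN : N <= 2 * n.+1%:R.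
  by rewrite /N -[n.+2%:R]natr1 -natr1; have : 0 <= (n%:R : R) by []; lra.
rewrite (_ : 2 * (3 * cabs z * N * (7 * d * n`!%:R)) = N * (42 * cabs z * d * n`!%:R)); last by ring.
rewrite (_ : 12 * cabs z * 7 * d * (n.+1%:R * n`!%:R) = 2 * n.+1%:R * (42 * cabs z * d * n`!%:R)); last by ring.
have H : 0 <= cabs z * d * n`!%:R by apply: ltW; rewrite mulr_gt0// mulr_gt0.
by apply: ler_wpM2r NN; move: H; lra.
Unshelve. all: by end_near. Qed.

(** By the functional equation a zero would propagate to all [z + n], against the
   asymptotics. *)
Lemma cGamma_neq0 z : 0 < complex.Re z -> cGamma z != 0.
Proof.
move=> z0; apply/eqP => g0.
have := cGamma_ratio_cvg2 z0.
rewrite (_ : (fun n => _) = (fun _ => 0)); last first.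
  by apply/funext => n; rewrite addrC cGamma_shift// g0 mulr0 mul0r.
move=> h; have e : (1 : R[i]^o) = 0.
  apply: (cvg_unique (@norm_hausdorff R[i] R[i]^o) h); exact: cvg_cst.
by move/eqP : e; rewrite oner_eq0.
Qed.

Lemma cGamma_ratio_cvg z : 0 < complex.Re z ->
  (fun N => cGamma (N%:R + z) / (N.-1`!%:R * cpow N%:R z)) @ \oo --> (1 : R[i]^o).
Proof.
move=> z0; apply/cvgcP; rewrite -(cvg_shiftn 2).
apply/(cvgcP _ (fun n => cGamma ((n + 2)%:R + z) / ((n + 2).-1`!%:R * cpow (n + 2)%:R z))).
rewrite (_ : (fun n => _) = (fun n => cGamma (n.+2%:R + z) / (n.+1`!%:R * cpow n.+2%:R z))).
  exact: cGamma_ratio_cvg2.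
by apply/funext => n; rewrite addn2.
Qed.

End GammaAsymptotics.

(** * Hankel determinants of shifted factorials *)

Section HankelAlgebra.
Context {R : realType}.
Implicit Types (x y : R[i]).

Lemma pochhammerS x k : pochhammer x k.+1 = pochhammer x k * (x + k%:R).
Proof. by rewrite /pochhammer big_ord_recr. Qed.

Lemma pochhammerSl x k : pochhammer x k.+1 = x * pochhammer (x + 1) k.
Proof.
rewrite /pochhammer big_ord_recl /= addr0; congr (_ * _).
by apply: eq_bigr => i _; rewrite -addrA /bump /= -nat1r.
Qed.

Lemma pochhammerD x k j : pochhammer x (k + j) = pochhammer x k * pochhammer (x + k%:R) j.
Proof.
elim: j => [|j IH]; first by rewrite addn0 [pochhammer _ 0]/pochhammer big_ord0 mulr1.
by rewrite addnS !pochhammerS IH -mulrA natrD addrA.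
Qed.

Definition binomial_transform n (f : nat -> R[i]) : R[i] :=
  \sum_(k < n.+1) (-1) ^+ k * 'C(n, k)%:R * f k.

Lemma binomial_transform_widen n m (f : nat -> R[i]) : (n < m)%N ->
  \sum_(k < m) (-1) ^+ k * 'C(n, k)%:R * f k = binomial_transform n f.
Proof.
move=> nm; rewrite /binomial_transform (big_ord_widen m (fun k => (-1) ^+ k * 'C(n, k)%:R * f k) nm).
rewrite [RHS]big_mkcond /=; apply: eq_bigr => k _.
by case: ltnP => // h; rewrite bin_small// mulr0 mul0r.
Qed.

Lemma binomial_transformS n f :
  binomial_transform n.+1 f = binomial_transform n (fun k => f k - f k.+1).
Proof.
rewrite /binomial_transform big_ord_recl /= bin0 expr0 !mul1r.
have -> : \sum_(i < n.+1) (-1) ^+ bump 0 i * 'C(n.+1, bump 0 i)%:R * f (bump 0 i) =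
  \sum_(i < n.+1) ((-1) ^+ i.+1 * 'C(n, i.+1)%:R * f i.+1 - (-1) ^+ i * 'C(n, i)%:R * f i.+1).
  by apply: eq_bigr => i _; rewrite /bump /= add1n binS natrD exprS; ring.
rewrite big_split /= sumrN addrA.
have -> : f 0 + \sum_(i < n.+1) (-1) ^+ i.+1 * 'C(n, i.+1)%:R * f i.+1 =
  \sum_(i < n.+1) (-1) ^+ i * 'C(n, i)%:R * f i.
  have := @binomial_transform_widen n n.+2 f (leqnSn _).
  by rewrite /binomial_transform big_ord_recl /= bin0 expr0 !mul1r => <-.
by rewrite -sumrB; apply: eq_bigr => i _; rewrite mulrBr.
Qed.

Lemma eq_binomial_transform n f g : f =1 g -> binomial_transform n f = binomial_transform n g.
Proof. by move=> h; apply: eq_bigr => i _; rewrite h. Qed.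

(** The transform is an [n]-th difference, and each difference lowers the degree
   by one. *)
Lemma binomial_transform_pochhammer n j x :
  (j < n)%N -> binomial_transform n (fun k => pochhammer (x + k%:R) j) = 0.
Proof.
elim: n j x => // n IH [|j] x jn; rewrite binomial_transformS.
  rewrite (@eq_binomial_transform n _ (fun _ => 0)).
    by rewrite /binomial_transform big1// => i _; rewrite mulr0.
  by move=> k; rewrite /pochhammer !big_ord0 subrr.
rewrite (@eq_binomial_transform n _ (fun k => - j.+1%:R * pochhammer (x + 1 + k%:R) j)).
  rewrite (_ : binomial_transform _ _ = - j.+1%:R * binomial_transform n (fun k => pochhammer (x + 1 + k%:R) j)).
    by rewrite IH ?mulr0.
  by rewrite /binomial_transform mulr_sumr; apply: eq_bigr => i _; ring.
move=> k; rewrite pochhammerSl pochhammerS -[k.+1%:R]natr1 -[j.+1%:R]natr1.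
have -> : x + (k%:R + 1) = x + k%:R + 1 by rewrite addrA.
have -> : x + 1 + k%:R = x + k%:R + 1 by rewrite addrAC.
ring.
Qed.

Lemma binomial_transform_pochhammer_diag n x :
  binomial_transform n (fun k => pochhammer (x + k%:R) n) = (-1) ^+ n * n`!%:R.
Proof.
elim: n x => [|n IH] x.
  by rewrite /binomial_transform big_ord1 /= bin0 expr0 /pochhammer big_ord0 !mulr1.
rewrite binomial_transformS.
rewrite (@eq_binomial_transform n _ (fun k => - n.+1%:R * pochhammer (x + 1 + k%:R) n)).
  rewrite (_ : binomial_transform _ _ = - n.+1%:R * binomial_transform n (fun k => pochhammer (x + 1 + k%:R) n)).
    by rewrite IH factS natrM exprS; ring.
  by rewrite /binomial_transform mulr_sumr; apply: eq_bigr => i _; ring.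
move=> k; rewrite pochhammerSl pochhammerS -[k.+1%:R]natr1 -[n.+1%:R]natr1.
have -> : x + (k%:R + 1) = x + k%:R + 1 by rewrite addrA.
have -> : x + 1 + k%:R = x + k%:R + 1 by rewrite addrAC.
ring.
Qed.

(** Taking differences of the rows, that is, multiplying by the triangular matrix
   of signed binomial coefficients, makes the matrix triangular. *)
Lemma det_pochhammer_shift N x :
  \det (\matrix_(k < N, j < N) pochhammer (x + k%:R) j) = \prod_(j < N) (j`!%:R : R[i]).
Proof.
set M := \matrix_(k, j) _.
pose B : 'M[R[i]]_N := \matrix_(i, k) ((-1) ^+ k * 'C(i, k)%:R).
have BM i j : (B *m M) i j = binomial_transform i (fun k => pochhammer (x + k%:R) j).
  rewrite mxE -(@binomial_transform_widen i N)//.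
  by apply: eq_bigr => k _; rewrite !mxE.
have dB : \det B = \prod_(i < N) (-1) ^+ i.
  rewrite det_trig.
    by apply: eq_bigr => i _; rewrite mxE binn mulr1.
  by apply/is_trig_mxP => i j ij; rewrite mxE bin_small// mulr0.
have dBM : \det (B *m M) = \prod_(i < N) ((-1) ^+ i * i`!%:R).
  rewrite -det_tr det_trig.
    by apply: eq_bigr => i _; rewrite mxE BM binomial_transform_pochhammer_diag.
  by apply/is_trig_mxP => i j ij; rewrite mxE BM binomial_transform_pochhammer.
move: dBM; rewrite det_mulmx dB big_split /= => /mulfI; apply.
by apply/prodf_neq0 => i _; rewrite expf_neq0// oppr_eq0 oner_eq0.
Qed.

(** Since [(x)_(j+k) = (x)_j (x + j)_k], a factor [(x)_j] comes out of each row. *)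
Lemma det_hankel_pochhammer N x :
  \det (\matrix_(j < N, k < N) pochhammer x (j + k)) =
  \prod_(j < N) (j`!%:R * pochhammer x j).
Proof.
rewrite (_ : \matrix_(j, k) _ =
   (diag_mx (\row_(k < N) pochhammer x k) *m \matrix_(k < N, j < N) pochhammer (x + k%:R) j)).
  rewrite det_mulmx det_diag det_pochhammer_shift big_split /= mulrC; congr (_ * _).
  by apply: eq_bigr => i _; rewrite mxE.
apply/matrixP => i j; rewrite !mxE (bigD1 i)//= big1 ?addr0.
  by rewrite !mxE eqxx mulr1n pochhammerD.
by move=> k ki; rewrite !mxE eq_sym (negbTE ki) mulr0n mul0r.
Qed.

(** Up to sign, the nonconstant coefficients of the Laguerre polynomial
   [1F1(-N; y; t)].  Its orthogonality to [1, ..., t^(N-1)] under [t^(y-1) e^-t]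
   expresses the column [(y)_j] through the columns [(y)_(j+k+1)]. *)
Definition laguerre_coef N y (k : nat) : R[i] := (-1) ^+ k * 'C(N, k.+1)%:R / pochhammer y k.+1.

Lemma laguerre_coefP N y (j : nat) : (forall k, pochhammer y k != 0) -> (j < N)%N ->
  \sum_(k < N) pochhammer y (j + k).+1 * laguerre_coef N y k = pochhammer y j.
Proof.
move=> y0 jN.
have := binomial_transform_pochhammer y jN.
rewrite /binomial_transform big_ord_recl /= bin0 expr0 !mul1r addr0.
move/eqP; rewrite addr_eq0 => /eqP ->.
rewrite -sumrN; apply: eq_bigr => k _.
rewrite /bump /= add1n /laguerre_coef (_ : (j + k).+1 = (k.+1 + j)%N); last by rewrite addnC addSn addnC.
by rewrite pochhammerD exprS; field; exact: y0.
Qed.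

Lemma coef1M (p q : {poly R[i]}) : (p * q)`_1 = p`_0 * q`_1 + p`_1 * q`_0.
Proof. by rewrite coefM !big_ord_recl big_ord0 /= addr0. Qed.

Lemma coef_prod1 (I : finType) (p : I -> {poly R[i]}) : (forall i, (p i)`_0 = 1) ->
  (\prod_i p i)`_0 = 1 /\ (\prod_i p i)`_1 = \sum_i (p i)`_1.
Proof.
move=> h; apply: (big_ind2 (fun (q : {poly R[i]}) s => q`_0 = 1 /\ q`_1 = s)).
- by rewrite !coef1.
- move=> q s r t [q0 q1] [r0 r1]; rewrite coef0M coef1M q0 q1 r0 r1 !mul1r mulr1.
  by split=> //; rewrite addrC.
- by move=> i _; split.
Qed.

(** To first order only the identity permutation contributes to the
   determinant of a perturbation of the identity matrix. *)
Lemma det_1X N (A : 'M[R[i]]_N) :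
  (\det (1%:M + 'X *: map_mx polyC A))`_0 = 1 /\
  (\det (1%:M + 'X *: map_mx polyC A))`_1 = \tr A.
Proof.
set M := 1%:M + _.
have ME i j : M i j = (i == j)%:R + 'X * (A i j)%:P by rewrite !mxE.
rewrite /determinant (bigD1 (1%g : {perm 'I_N}))//= odd_perm1 expr0 mul1r.
have M0 i : (M i ((1%g : {perm 'I_N}) i))`_0 = 1.
  by rewrite ME perm1 eqxx coefD coef1 coefXM /= addr0.
have [h0 h1] := coef_prod1 M0.
have rest n : (n < 2)%N ->
    (\sum_(s : {perm 'I_N} | s != 1%g) (-1) ^+ s * \prod_i M i (s i))`_n = 0.
  move=> n2; rewrite coef_sum big1// => s s1.
  have [i0 hi0] : exists i, s i != i.
    apply/existsP; rewrite -negb_forall; apply: contraNN s1 => /forallP h.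
    by apply/eqP/permP => i; rewrite perm1; apply/eqP.
  have hi1 : s (s i0) != s i0 by rewrite (inj_eq perm_inj).
  rewrite (bigD1 i0)//= (bigD1 (s i0))//= !ME eq_sym (negbTE hi0) eq_sym (negbTE hi1) !add0r.
  set r := \prod_(i | _) _.
  have reorder (S : comNzRingType) (e x a b q : S) :
      e * (x * a * (x * b * q)) = x ^+ 2 * (e * (a * b * q)) by ring.
  by rewrite reorder coefXnM n2.
rewrite !coefD !rest// !addr0; split=> //.
rewrite h1 /mxtrace; apply: eq_bigr => i _.
by rewrite ME perm1 eqxx coefD coef1 coefXM coefC /= add0r.
Qed.

(** The columns of [(y)_(j+k)] other than the first are themselves columns of
   [(y)_(j+k+1)], hence the unit vectors. *)
Definition shift_mx N y : 'M[R[i]]_N :=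
  \matrix_(i, k) (if (k : nat) is k'.+1 then (i == k' :> nat)%:R else laguerre_coef N y i).

Lemma hankel_shift N y : (forall k, pochhammer y k != 0) ->
  (\matrix_(j < N, k < N) pochhammer y (j + k).+1) *m shift_mx N y =
  \matrix_(j < N, k < N) pochhammer y (j + k).
Proof.
move=> y0; apply/matrixP => j [[|k] kN]; rewrite !mxE /=.
  rewrite addn0 -(laguerre_coefP y0 (ltn_ord j)).
  by apply: eq_bigr => i _; rewrite !mxE.
have kN' : (k < N)%N by exact: ltnW.
rewrite (bigD1 (Ordinal kN'))//= !mxE /= eqxx mulr1 big1 ?addr0 ?addnS//.
move=> i; rewrite !mxE /= -val_eqE /= => /negbTE ->.
by rewrite mulr0.
Qed.

Lemma mxtrace_shift N y : \tr (shift_mx N.+1 y) = N.+1%:R / y.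
Proof.
rewrite /mxtrace big_ord_recl big1 ?addr0.
  by rewrite mxE /= /laguerre_coef expr0 mul1r bin1 /pochhammer big_ord_recl big_ord0 /= addr0 mulr1.
move=> i _; rewrite !mxE /= /bump /= add1n.
by rewrite (_ : (i.+1 == i :> nat) = false)//; apply/negbTE; rewrite neq_ltn ltnSn orbT.
Qed.

(** The matrix is the product of its constant term by [1 + c X S], where [S] is
   the companion matrix above, of trace [(N + 1) / y]. *)
Lemma det_hankel_linear N y (g c : R[i]) : (forall k, pochhammer y k != 0) ->
  let P := \det (\matrix_(j < N.+1, k < N.+1)
     ((g * pochhammer y (j + k).+1)%:P + (g * c * pochhammer y (j + k)) *: 'X)) in
  P`_0 = \det (\matrix_(j < N.+1, k < N.+1) (g * pochhammer y (j + k).+1)) /\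
  P`_1 = c * (N.+1%:R / y) * P`_0.
Proof.
move=> y0.
set H : 'M[R[i]]_N.+1 := \matrix_(j, k) (g * pochhammer y (j + k).+1).
set M := \matrix_(j, k) _.
have ME : M = map_mx polyC H *m (1%:M + 'X *: map_mx polyC (c *: shift_mx N.+1 y)).
  have HS : H *m shift_mx N.+1 y = \matrix_(j < N.+1, k < N.+1) (g * pochhammer y (j + k)).
    rewrite (_ : H = g *: \matrix_(j < N.+1, k < N.+1) pochhammer y (j + k).+1).
      by rewrite -scalemxAl hankel_shift//; apply/matrixP => i j; rewrite !mxE.
    by apply/matrixP => i j; rewrite !mxE.
  rewrite mulmxDr mulmx1 -scalemxAr -map_mxM -scalemxAr HS.
  apply/matrixP => i j; rewrite !mxE; congr (_ + _).
  by rewrite -mul_polyC mulrC; congr (_ * _%:P); ring.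
have [d0 d1] := det_1X (c *: shift_mx N.+1 y).
move=> P; rewrite /P ME det_mulmx det_map_mx coef0M coef1M !coefC /= d0 d1 mulr1 mul0r addr0.
by rewrite linearZ /= mxtrace_shift; split=> //; ring.
Qed.

Lemma det_corner_coef1 N (H : 'M[R[i]]_N.+1) (b : R[i]) :
  (\det (\matrix_(j < N.+1, k < N.+1)
    ((H j k)%:P + (if (j == 0) && (k == 0) then b else 0) *: 'X)))`_1 =
  b * \det (row' 0 (col' 0 H)).
Proof.
set M := \matrix_(j, k) _.
rewrite (expand_det_row _ 0) coef_sum (bigD1 0)//= big1 ?addr0.
  have -> : cofactor M 0 0 = (\det (row' 0 (col' 0 H)))%:P.
    rewrite /cofactor /= addn0 expr0 mul1r -det_map_mx; congr (\det _).
    by apply/matrixP => i j; rewrite !mxE /= scale0r addr0.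
  by rewrite coefMC !mxE /= coefD coefC coefZ coefX /= add0r mulr1.
move=> j j0.
have -> : cofactor M 0 j = (cofactor H 0 j)%:P.
  rewrite /cofactor rmorphM rmorphXn rmorphN rmorph1 -det_map_mx; congr (_ * \det _).
  by apply/matrixP => i k; rewrite !mxE /= scale0r addr0.
by rewrite coefMC !mxE /= (negbTE j0) scale0r addr0 coefC /= mul0r.
Qed.

End HankelAlgebra.

(** * First-order contact at the origin *)

Section FirstOrder.
Context {R : realType}.
Implicit Types (f g : R[i] -> R[i]) (p q : {poly R[i]}) (h z A B : R[i]).

(** First-order contact at the origin: two functions are multiplied and added
   like their Taylor polynomials modulo ['X^2]. *)
Definition approx f p := exists K : R, forall h, cabs h <= 1 ->
  cabs (f h - p.[h]) <= K * cabs h ^+ 2.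

Lemma horner_bounded p : exists2 K : R, 0 <= K & forall h, cabs h <= 1 -> cabs p.[h] <= K.
Proof.
exists (\sum_(i < size p) cabs p`_i); first by rewrite sumr_ge0// => i _; exact: normc_ge0.
move=> h h1; rewrite horner_coef; apply: (le_trans (cabs_sum _ _ _)).
apply: ler_sum => i _; rewrite cabsM cabsX ler_piMr ?normc_ge0//.
by rewrite exprn_ile1// normc_ge0.
Qed.

Lemma horner_linear p : exists2 K : R, 0 <= K & forall h, cabs h <= 1 ->
  cabs (p.[h] - ((p`_0)%:P + p`_1 *: 'X).[h]) <= K * cabs h ^+ 2.
Proof.
have [K K0 hK] := horner_bounded (drop_poly 2 p); exists K => // h h1.
have -> : (p`_0)%:P + p`_1 *: 'X = take_poly 2 p.
  apply/polyP => i; rewrite coefD coefC coefZ coefX coef_take_poly.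
  by case: i => [|[|i]] /=; rewrite ?mulr0 ?mulr1 ?addr0 ?add0r.
rewrite -{1}[p](poly_take_drop 2) hornerD [_ + _.[h]]addrC addrK hornerM hornerXn.
by rewrite cabsM cabsX ler_wpM2r ?hK// exprn_ge0// normc_ge0.
Qed.

Lemma approx_cst z : approx (fun=> z) z%:P.
Proof. by exists 0 => h _; rewrite hornerC subrr ComplexField.Normc.normc0 mul0r. Qed.

Lemma approx_ge0 f p : approx f p -> exists2 K : R, 0 <= K & forall h, cabs h <= 1 ->
  cabs (f h - p.[h]) <= K * cabs h ^+ 2.
Proof.
move=> [K hK]; exists `|K| => // h h1; apply: (le_trans (hK _ h1)).
by rewrite ler_wpM2r ?ler_norm// exprn_ge0// normc_ge0.
Qed.

Lemma approxD f g p q : approx f p -> approx g q -> approx (fun h => f h + g h) (p + q).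
Proof.
move=> [K hK] [L hL]; exists (K + L) => h h1.
rewrite hornerD mulrDl (_ : _ - _ = (f h - p.[h]) + (g h - q.[h])); last by ring.
by rewrite (le_trans (cabsD _ _))// lerD// ?hK ?hL.
Qed.

Lemma approxM f g p q : approx f p -> approx g q -> approx (fun h => f h * g h) (p * q).
Proof.
move=> /approx_ge0[K K0 hK] /approx_ge0[L L0 hL].
have [P P0 hP] := horner_bounded p; have [Q Q0 hQ] := horner_bounded q.
exists (K * (L + Q) + P * L) => h h1.
have n0 := normc_ge0 h.
have h2 : cabs h ^+ 2 <= 1 by rewrite exprn_ile1.
have h20 : 0 <= cabs h ^+ 2 by rewrite exprn_ge0.
have hg : cabs (g h) <= L + Q.
  rewrite -[g h](subrK q.[h]) (le_trans (cabsD _ _))// lerD ?hQ//.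
  by apply: (le_trans (hL _ h1)); rewrite ler_piMr.
rewrite hornerM (_ : _ - _ = (f h - p.[h]) * g h + p.[h] * (g h - q.[h])); last by ring.
apply: (le_trans (cabsD _ _)); rewrite [leRHS]mulrDl !cabsM; apply: lerD.
  by rewrite mulrAC; apply: ler_pM; rewrite ?normc_ge0 ?hK.
by rewrite -mulrA; apply: ler_pM; rewrite ?normc_ge0 ?hP ?hL.
Qed.

Lemma approx_ext f g p : f =1 g -> approx f p -> approx g p.
Proof. by move=> fg [K hK]; exists K => h; rewrite -fg; exact: hK. Qed.

Lemma approx_linear f p : approx f p -> approx f ((p`_0)%:P + p`_1 *: 'X).
Proof.
move=> [K hK]; have [L L0 hL] := horner_linear p.
exists (K + L) => h h1; rewrite mulrDl.
rewrite (_ : f h - _ = (f h - p.[h]) + (p.[h] - ((p`_0)%:P + p`_1 *: 'X).[h])); last by ring.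
by rewrite (le_trans (cabsD _ _))// lerD ?hK ?hL.
Qed.

(** The entries of the determinants below are only known to first order. *)
Lemma approx_det N (F : 'I_N -> 'I_N -> R[i] -> R[i]) (P : 'I_N -> 'I_N -> {poly R[i]}) :
  (forall j k, approx (F j k) (P j k)) ->
  approx (fun h => \det (\matrix_(j, k) F j k h)) (\det (\matrix_(j, k) P j k)).
Proof.
move=> FP; rewrite /determinant.
suff H (I : finType) (s : I -> R[i] -> R[i]) (t : I -> {poly R[i]}) :
    (forall i, approx (s i) (t i)) ->
    approx (fun h => \sum_i s i h) (\sum_i t i) /\
    approx (fun h => \prod_i s i h) (\prod_i t i).
  apply: (H _ (fun (w : {perm 'I_N}) h => (-1) ^+ w * \prod_i (\matrix_(j, k) F j k h) i (w i)) _ _).1 => w.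
  have hw : approx (fun h => \prod_i (\matrix_(j, k) F j k h) i (w i)) (\prod_i (\matrix_(j, k) P j k) i (w i)).
    apply: (approx_ext (f := fun h => \prod_i F i (w i) h)).
      by move=> h; apply: eq_bigr => i _; rewrite mxE.
    have := (H _ (fun i => F i (w i)) (fun i => P i (w i)) (fun i => FP i (w i))).2.
    by congr approx; apply: eq_bigr => i _; rewrite mxE.
  have := approxM (approx_cst ((-1) ^+ w)) hw.
  by rewrite rmorphXn rmorphN rmorph1.
move=> st; split.
- have h : approx (\sum_i s i) (\sum_i t i).
    apply: (big_ind2 approx) => //.
    + exact: approx_cst.
    + by move=> f p g q; exact: approxD.
  by apply: approx_ext h => x; rewrite fct_sumE.
- have h : approx (fun x => \prod_(i <- index_enum I) s i x) (\prod_(i <- index_enum I) t i).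
    elim: (index_enum I) => [|i r IH].
      by rewrite big_nil; apply: approx_ext (approx_cst 1) => x; rewrite big_nil.
    rewrite big_cons; apply: approx_ext (approxM (st i) IH) => x.
    by rewrite big_cons.
  by [].
Qed.

Lemma approx_value f p : approx f p -> f 0 = p`_0.
Proof.
move=> [K hK]; apply/eqP; rewrite -subr_eq0 -cabs_eq0 eq_le normc_ge0 andbT.
have := hK 0; rewrite ComplexField.Normc.normc0 expr0n /= mulr0 horner_coef0.
by apply; exact: ler01.
Qed.

Lemma approx_derive1 f p : approx f p -> derive1 (f : R[i] -> R[i]^o) 0 = p`_1.
Proof.
move=> fp; have f0 := approx_value fp; have [K hK] := approx_linear fp.
apply: (@derive1_quadratic _ _ _ K) => h h1; have := hK _ h1.
by rewrite f0 !hornerE /= opprD addrA.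
Qed.

Lemma approx_cexpN : approx (fun h => cexp (- h)) (1 - 'X).
Proof.
exists (4 * expR 1) => h h1.
have := cexpB1D_le2 (- h); rewrite cabsN hornerD hornerN hornerX hornerC => hh.
rewrite opprB addrA; move: hh; rewrite opprK addrAC => hh.
apply: (le_trans hh).
rewrite mulrAC ler_wpM2r ?exprn_ge0 ?normc_ge0// ler_wpM2l// ler_expR//.
Qed.

End FirstOrder.

(** * Kummer's function to first order *)

Section Hypergeometric.
Context {R : realType}.
Implicit Types (h z A B : R[i]).

(** Ratios of shifted factorials therefore grow at most geometrically. *)
Lemma ratio_bounded A B : (forall k, B + k%:R != 0) ->
  exists2 M : R, 0 <= M & forall k, cabs (A + k%:R) <= M * cabs (B + k%:R).
Proof.
move=> B0; pose n0 := (Num.truncn (2 * cabs B + 1)).+1.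
pose M0 := \sum_(i < n0) cabs (A + i%:R) / cabs (B + i%:R).
have M00 : 0 <= M0 by rewrite sumr_ge0// => i _; rewrite divr_ge0 ?normc_ge0.
exists (M0 + (2 * cabs A + 2)).
  by rewrite addr_ge0// addr_ge0// mulr_ge0 ?normc_ge0.
move=> k; have Bk : 0 < cabs (B + k%:R) by rewrite cabs_gt0.
have [kn|kn] := ltnP k n0.
  rewrite -ler_pdivrMr//; apply: (@le_trans _ _ M0); last first.
    by rewrite lerDl addr_ge0// mulr_ge0 ?normc_ge0.
  rewrite /M0 (bigD1 (Ordinal kn))//= lerDl sumr_ge0// => i _.
  by rewrite divr_ge0 ?normc_ge0.
have hk : 2 * cabs B + 1 <= k%:R.
  by apply: ltW; apply: (lt_le_trans (truncnS_gt _)); rewrite ler_nat.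
have h1 : cabs (A + k%:R) <= cabs A + k%:R by apply: (le_trans (cabsD _ _)); rewrite cabs_nat.
have h2 : k%:R <= cabs (B + k%:R) + cabs B.
  rewrite -{1}(cabs_nat k) -{1}[k%:R](addKr B) addrC addrC.
  by rewrite [_ + (B + _)]addrC; exact: cabsB.
have a0 := normc_ge0 A; have b0 := normc_ge0 B.
apply: (@le_trans _ _ ((2 * cabs A + 2) * cabs (B + k%:R))); last first.
  by rewrite ler_wpM2r ?normc_ge0// lerDr.
set x := cabs (B + _) in Bk h2 *; nra.
Qed.

Lemma cseries_cvg (f : nat -> R[i]) (b : nat -> R) :
  (forall k, cabs (f k) <= b k) -> cvgn (series b) ->
  exists l : R[i], series (f : nat -> R[i]^o) @ \oo --> (l : R[i]^o).
Proof.
move=> fb cb.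
have key (u : nat -> R) : (forall k, `|u k| <= b k) -> cvgn (series u).
  move=> ub; apply: normed_cvg; apply: series_le_cvg cb => //.
  - by move=> k /=.
  - by move=> k; exact: le_trans (normr_ge0 _) (ub k).
have c1 : cvgn (series (fun k => complex.Re (f k))).
  by apply: key => k; apply: le_trans (fb k); exact: normr_Re.
have c2 : cvgn (series (fun k => complex.Im (f k))).
  by apply: key => k; apply: le_trans (fb k); exact: normr_Im.
exists (limn (series (fun k => complex.Re (f k))) +i* limn (series (fun k => complex.Im (f k)))).
apply/cvgc_ReIm; split=> /=.
- rewrite (_ : (fun n => _) = series (fun k => complex.Re (f k)))//.
  by apply/funext => n; rewrite /series /= Re_sum.
- rewrite (_ : (fun n => _) = series (fun k => complex.Im (f k)))//.
  by apply/funext => n; rewrite /series /= Im_sum.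
Qed.

Lemma pochhammer_neq0 B k : (forall k, B + k%:R != 0) -> pochhammer B k != 0.
Proof. by move=> B0; apply/prodf_neq0 => i _. Qed.

(** On the unit disc the terms are dominated by those of an exponential series,
   and from the third one on by [|z|^2] times these. *)
Lemma approx_hyp1F1 A B : (forall k, B + k%:R != 0) ->
  approx (hyp1F1 A B) (1 + (A / B) *: 'X).
Proof.
move=> B0; have [M M0 hM] := ratio_bounded A B0.
have pM k : cabs (pochhammer A k / pochhammer B k) <= M ^+ k.
  rewrite cabsM cabsV ler_pdivrMr ?cabs_gt0 ?pochhammer_neq0//.
  elim: k => [|k IH]; first by rewrite /pochhammer !big_ord0 expr0 mul1r.
  by rewrite !pochhammerS !cabsM exprSr mulrACA ler_pM ?normc_ge0.
exists (expR M) => z z1; rewrite /hyp1F1.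
set t := (fun k : nat => _).
have tE k : cabs (t k) = cabs (pochhammer A k / pochhammer B k) * cabs z ^+ k / k`!%:R.
  by rewrite /t cabsM (cabsM _ (z ^+ k)) cabsX (cabsV k`!%:R) cabs_nat.
have tb k : cabs (t k) <= exp_coeff M k.
  rewrite tE /exp_coeff /= ler_wpM2r ?invr_ge0//.
  rewrite -[leRHS]mulr1; apply: ler_pM; rewrite ?exprn_ge0 ?normc_ge0//.
  by rewrite exprn_ile1 ?normc_ge0.
have tb2 k : cabs (t k.+2) <= cabs z ^+ 2 * exp_coeff M k.+2.
  rewrite tE (_ : exp_coeff M k.+2 = M ^+ k.+2 / k.+2`!%:R)// [leRHS]mulrA.
  rewrite ler_wpM2r ?invr_ge0// mulrC.
  apply: ler_pM; rewrite ?exprn_ge0 ?normc_ge0//.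
  by rewrite -addn2 exprD ler_piMl ?exprn_ge0 ?normc_ge0// exprn_ile1 ?normc_ge0.
have cE : cvgn (series (exp_coeff M)) by exact: is_cvg_series_exp_coeff.
have [l hl] := cseries_cvg tb cE.
rewrite (limnc hl).
rewrite (_ : l - _ = l - (1 + (A / B) * z)); last by rewrite !hornerE.
apply: (cabs_lim_le hl); near=> n.
have n2 : (2 <= n)%N by near: n; exists 2%N.
rewrite -(subnKC n2) /series /= big_nat_recl ?addSn//= big_nat_recl//=.
rewrite {1 2}/t /pochhammer !big_ord0 !big_ord_recl !big_ord0 /= !expr0 expr1 !addr0 !mulr1 fact0 invr1 !mul1r.
set S := \sum_(_ <= _ < _) _; rewrite (_ : _ - _ = S); last by ring.
apply: (le_trans (cabs_sum _ _ _)).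
apply: (@le_trans _ _ (\sum_(0 <= i < n - 2) cabs z ^+ 2 * exp_coeff M i.+2)).
  by apply: ler_sum => i _; exact: tb2.
rewrite -mulr_sumr mulrC ler_wpM2r ?exprn_ge0 ?normc_ge0//.
apply: (@le_trans _ _ (series (exp_coeff M) n)); last first.
  rewrite /expR; apply: nondecreasing_cvgn_le => //.
  apply: nondecreasing_series => i _ _; exact: exp_coeff_ge0.
rewrite /series /= -{2}(subnKC n2) big_nat_recl ?addSn//= big_nat_recl//=.
by rewrite addrA lerDr addr_ge0// exp_coeff_ge0.
Unshelve. all: by end_near. Qed.

End Hypergeometric.

(** * The expansion coefficients at finite size *)

Lemma coef_affine {R : realType} (c d : R[i]) :
  (c%:P + d *: 'X)`_0 = c /\ (c%:P + d *: 'X)`_1 = d.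
Proof. by rewrite !coefE /=; split; ring. Qed.

Lemma coef_acoef {R : realType} (c r : R[i]) :
  (c%:P * (1 - 'X) * (1 + r *: 'X))`_0 = c /\
  (c%:P * (1 - 'X) * (1 + r *: 'X))`_1 = c * (r - 1).
Proof.
have [x0 x1] := coef_affine (1 : R[i]) (-1); have [y0 y1] := coef_affine 1 r.
rewrite (_ : 1 - 'X = 1%:P + (-1) *: 'X :> {poly R[i]}); last by rewrite scaleN1r.
rewrite (_ : 1 + r *: 'X = 1%:P + r *: 'X :> {poly R[i]})//.
rewrite -mulrA !coefCM coef0M coef1M x0 x1 y0 y1.
by split; [rewrite !mulr1 | rewrite mul1r mulr1].
Qed.

Section Coefficients.
Context {R : realType}.
Variables (a mu xi : R[i]).
Hypotheses (hmua : -1 < complex.Re (mu + a)) (hnat : forall n : nat, mu + a <> n%:R).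
Local Notation al := (mu + a).
Local Notation be := (mu + a + 1).

Lemma Re_beta_gt0 : 0 < complex.Re be.
Proof. by rewrite Re_add /= -ltrBlDr sub0r. Qed.

Lemma Re_addn_gt0 (z : R[i]) n : 0 < complex.Re z -> 0 < complex.Re (z + n%:R).
Proof. by move=> z0; rewrite Re_add Re_nat ltr_wpDr. Qed.

Lemma Re_gt0_neq0 (z : R[i]) : 0 < complex.Re z -> z != 0.
Proof. by move=> z0; apply/eqP => z1; rewrite z1 ltxx in z0. Qed.

Lemma alpha_addn_neq0 k : al + k%:R != 0.
Proof.
case: k => [|k]; first by rewrite addr0; apply/eqP; have := @hnat 0%N; rewrite mulr0n.
rewrite -nat1r addrA; apply: Re_gt0_neq0; apply: Re_addn_gt0; exact: Re_beta_gt0.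
Qed.

Lemma alpha_neq0 : al != 0.
Proof. by have := alpha_addn_neq0 0; rewrite addr0. Qed.

Lemma acoef_den_neq0 n k : - mu - a - n%:R + k%:R != 0.
Proof.
rewrite -opprD -opprD addrC subr_eq0; apply/eqP => h.
have [nk|kn] := leqP n k.
  apply: (@hnat (k - n)%N); rewrite natrB// h; ring.
have := alpha_addn_neq0 (n - k)%N; rewrite natrB ?(ltnW kn)//.
by rewrite h (_ : al + (n%:R - (al + n%:R)) = 0) ?eqxx//; ring.
Qed.

(** Both the moments at [s = 0] and their derivatives are shifted factorials
   over one constant, [Gamma (alpha + n) = g (alpha)_n]. *)
Let g := cGamma be / al.

Lemma cGamma_alpha n : cGamma (mu + n%:R + a + 1) = g * pochhammer al n.+1.
Proof.
rewrite (_ : mu + n%:R + a + 1 = be + n%:R); last by ring.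
rewrite cGamma_shift ?Re_beta_gt0// pochhammerSl /g; field; exact: alpha_neq0.
Qed.

Lemma pochhammer_alpha_neq0 k : pochhammer al k != 0.
Proof. by apply: pochhammer_neq0; exact: alpha_addn_neq0. Qed.

(** The derivative at the origin is, up to the factor [- mu], the value of the
   previous index: [Gamma (al + n + 1) ((a + n) / (al + n) - 1)] equals
   [- mu Gamma (al + n)]. *)
Lemma approx_acoef n :
  approx (acoef a mu n) ((g * pochhammer al n.+1)%:P + (g * - mu * pochhammer al n) *: 'X).
Proof.
have h1 := approxM (approx_cst (cGamma (mu + n%:R + a + 1))) (@approx_cexpN R).
have h2 := approxM h1 (approx_hyp1F1 (- a - n%:R) (acoef_den_neq0 n)).
have := approx_linear h2.
have [-> ->] := coef_acoef (cGamma (mu + n%:R + a + 1)) ((- a - n%:R) / (- mu - a - n%:R)).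
congr approx; rewrite cGamma_alpha; congr (_ + _ *: _).
rewrite pochhammerS.
have := acoef_den_neq0 n 0; rewrite addr0 => h.
have := alpha_addn_neq0 n => h'.
move: h' h; move: (n%:R : R[i]) (pochhammer _ n) (g) => N P G h' h.
rewrite (_ : - mu - a - N = - (mu + a + N)); last by ring.
field; by rewrite h'.
Qed.

Lemma det_poly_coef0 N s :
  (det_poly a mu xi N s)`_0 = \det (\matrix_(j < N, k < N) acoef a mu (j + k) s).
Proof.
rewrite /det_poly -horner_coef0 -[_.[0]]/(horner_eval 0 _) -det_map_mx; congr (\det _).
by apply/matrixP => i j; rewrite !mxE -[LHS]/(horner _ 0) horner_coef0 (coef_affine _ _).1.
Qed.

Lemma approx_det_poly0 N : exists P : {poly R[i]},
  [/\ approx (fun s => (det_poly a mu xi N.+1 s)`_0) P,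
      P`_0 = \det (\matrix_(j < N.+1, k < N.+1) (g * pochhammer al (j + k).+1)) &
      P`_1 = - mu * (N.+1%:R / al) * P`_0].
Proof.
have [d0 d1] := @det_hankel_linear R N al g (- mu) pochhammer_alpha_neq0.
eexists; split; last 2 first.
- exact: d0.
- exact: d1.
apply: (approx_ext (f := fun s => \det (\matrix_(j < N.+1, k < N.+1) acoef a mu (j + k) s))).
  by move=> s; rewrite det_poly_coef0.
by apply: approx_det => j k; exact: approx_acoef.
Qed.

Lemma det_hankel_cGamma N (b : R[i]) : 0 < complex.Re b ->
  \det (\matrix_(j < N, k < N) cGamma (b + (j + k)%:R)) =
  \prod_(j < N) (j`!%:R * cGamma (b + j%:R)).
Proof.
move=> b0; rewrite (_ : \matrix_(j, k) _ = cGamma b *: \matrix_(j < N, k < N) pochhammer b (j + k)).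
  rewrite detZ det_hankel_pochhammer -{1}[N]card_ord -prodr_const -big_split /=.
  by apply: eq_bigr => i _; rewrite cGamma_shift//; ring.
by apply/matrixP => i j; rewrite !mxE cGamma_shift// mulrC.
Qed.

Lemma CnormE N : Cnorm N al = \prod_(j < N) (j`!%:R * cGamma (be + j%:R)).
Proof.
apply: eq_bigr => j _; rewrite cGamma_fact; congr (_ * cGamma _); ring.
Qed.

Lemma Cnorm_neq0 N : Cnorm N al != 0.
Proof.
rewrite CnormE; apply/prodf_neq0 => j _; rewrite mulf_neq0 ?pnatr_eq0 -?lt0n ?fact_gt0//.
by apply: cGamma_neq0; apply: Re_addn_gt0; exact: Re_beta_gt0.
Qed.

Lemma det_acoef0 N :
  \det (\matrix_(j < N, k < N) (g * pochhammer al (j + k).+1)) = Cnorm N al.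
Proof.
rewrite CnormE -det_hankel_cGamma ?Re_beta_gt0//; congr (\det _).
apply/matrixP => i j; rewrite !mxE -cGamma_alpha; congr cGamma; ring.
Qed.

Lemma ecoefN00 N : ecoefN a mu xi N.+1 0 0 = 1.
Proof.
have [P [hP P0 _]] := approx_det_poly0 N.
rewrite /ecoefN /= [a + mu]addrC fact0 divr1.
by rewrite (approx_value hP) P0 det_acoef0 mulVf ?Cnorm_neq0.
Qed.

Lemma ecoefN01 N : ecoefN a mu xi N.+1 0 1 = - mu * (N.+1%:R / al).
Proof.
have [P [hP P0 P1]] := approx_det_poly0 N.
have h := approxM (approx_cst (Cnorm N.+1 al)^-1) hP.
rewrite /ecoefN /= [a + mu]addrC (_ : 1`! = 1%N)// divr1 (approx_derive1 h).
by rewrite coefCM P1 P0 det_acoef0 [_ * Cnorm _ _]mulrC mulKf ?Cnorm_neq0.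
Qed.

Lemma bcoef00 : bcoef a mu xi 0 0 =
  cGamma (mu + 1) * cGamma (a + 1) / cGamma (mu + a + 2) * connection_factor a mu xi.
Proof.
have h0 k : mu + a + 0%:R + 2 + k%:R != 0.
  rewrite (_ : _ + _ = be + k.+1%:R); last by rewrite -[k.+1%:R]natr1; ring.
  by apply: Re_gt0_neq0; apply: Re_addn_gt0; exact: Re_beta_gt0.
rewrite /bcoef (approx_value (approx_hyp1F1 (mu + 1) h0)).
by rewrite coefD coef1 coefZ coefX /= mulr0 !addr0 oppr0 cexp0 !mulr1 add0r.
Qed.

Lemma acoef_at0 n : acoef a mu n 0 = cGamma (be + n%:R).
Proof.
rewrite (approx_value (approx_acoef n)) (coef_affine _ _).1 -cGamma_alpha.
congr cGamma; ring.
Qed.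

(** At [s = 0] the factor [s^(j+k)] leaves only the corner entry of the
   perturbation. *)
Lemma det_poly_at0_coef1 N : (det_poly a mu xi N.+1 0)`_1 =
  bcoef a mu xi 0 0 * \prod_(j < N) (j`!%:R * cGamma (be + 2 + j%:R)).
Proof.
have b2 : 0 < complex.Re (be + 2%:R) by apply: Re_addn_gt0; exact: Re_beta_gt0.
rewrite -det_hankel_cGamma//.
pose H := \matrix_(j < N.+1, k < N.+1) acoef a mu (j + k) 0.
transitivity (bcoef a mu xi 0 0 * \det (row' 0 (col' 0 H))).
  rewrite -det_corner_coef1 /det_poly; congr (nth 0 (polyseq _) 1); congr (\det _).
  apply/matrixP => i j; rewrite !mxE; congr (_ + _ *: _).
  case: eqP => [->|i0] /=; first case: eqP => [->|j0] /=.
  - by rewrite expr0 mul1r.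
  - rewrite add0n expr0n (_ : (j == 0 :> nat) = false) ?mul0r//.
    by apply/negbTE/eqP => h; apply: j0; apply: val_inj.
  - rewrite expr0n addn_eq0 (_ : (i == 0 :> nat) = false) ?mul0r//.
    by apply/negbTE/eqP => h; apply: i0; apply: val_inj.
congr (_ * \det _); apply/matrixP => i j; rewrite !mxE acoef_at0 /= /bump /=.
apply: (congr1 cGamma); by rewrite !add1n addSn addnS -addn2 natrD addrA addrAC.
Qed.

(** Both products run over [Gamma (be + i)], one for [2 <= i <= N + 1], the other
   for [0 <= i <= N]. *)
Lemma Cnorm_ratio N :
  \prod_(j < N) (j`!%:R * cGamma (be + 2 + j%:R)) / Cnorm N.+1 al =
  cGamma (be + N.+1%:R) / (N`!%:R * cGamma be * cGamma (be + 1)).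
Proof.
rewrite CnormE !big_split /= [\prod_(i < N.+1) i`!%:R]big_ord_recr /=.
have hn (z : R[i]) : 0 < complex.Re z -> cGamma z != 0 by exact: cGamma_neq0.
have b0 := Re_beta_gt0.
have f0 : \prod_(i < N) (i`!%:R : R[i]) != 0.
  by apply/prodf_neq0 => i _; rewrite pnatr_eq0 -lt0n fact_gt0.
have e : cGamma be * (cGamma (be + 1) * \prod_(i < N) cGamma (be + 2 + i%:R)) =
    (\prod_(i < N.+1) cGamma (be + i%:R)) * cGamma (be + N.+1%:R).
  have e1 : \prod_(i < N.+2) cGamma (be + i%:R) =
      (\prod_(i < N.+1) cGamma (be + i%:R)) * cGamma (be + N.+1%:R) by rewrite big_ord_recr.
  rewrite -e1 big_ord_recl big_ord_recl addr0.
  congr (_ * (_ * _)); apply: eq_bigr => i _; congr cGamma.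
  by rewrite (_ : (lift ord0 (lift ord0 i) : nat) = (2 + i)%N)// (natrD _ 2 i) [RHS]addrA.
have p0 : \prod_(i < N.+1) cGamma (be + i%:R) != 0.
  by apply/prodf_neq0 => i _; apply: hn; exact: Re_addn_gt0.
have g0 := hn _ b0; have g1 := hn _ (Re_addn_gt0 1 b0).
have nf : (N`!%:R : R[i]) != 0 by rewrite pnatr_eq0 -lt0n fact_gt0.
move: f0 p0 g0 g1 nf e.
move: (\prod_(i < N) (i`!%:R : R[i])) (\prod_(i < N) cGamma (be + 2 + i%:R))
  (\prod_(i < N.+1) cGamma (be + i%:R)) (cGamma (be + N.+1%:R)) (cGamma be)
  (cGamma (be + 1)) (N`!%:R : R[i]) => F P2 P1 X G0 G1 n f0 p0 g0 g1 nf e.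
have -> : P2 = P1 * X / (G0 * G1).
  by apply: (mulIf (mulf_neq0 g0 g1)); rewrite divfK ?mulf_neq0// -e; ring.
by field; rewrite f0 nf p0 g0 g1.
Qed.

Lemma ecoefN10 N : ecoefN a mu xi N.+1 1 0 =
  cGamma (mu + 1) * cGamma (a + 1) / (cGamma (mu + a + 2) ^+ 2 * cGamma be)
  * connection_factor a mu xi * (cGamma (be + N.+1%:R) / N`!%:R).
Proof.
rewrite /ecoefN /= [a + mu]addrC fact0 divr1 det_poly_at0_coef1 mulrCA [_^-1 * _]mulrC Cnorm_ratio bcoef00.
rewrite (_ : be + 1 = mu + a + 2); last by ring.
have g0 : cGamma be != 0 by apply: cGamma_neq0; exact: Re_beta_gt0.
have g1 : cGamma (mu + a + 2) != 0.
  rewrite (_ : mu + a + 2 = be + 1%:R); last by ring.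
  by apply: cGamma_neq0; apply: Re_addn_gt0; exact: Re_beta_gt0.
have nf : (N`!%:R : R[i]) != 0 by rewrite pnatr_eq0 -lt0n fact_gt0.
move: g0 g1 nf; move: (cGamma be) (cGamma (mu + a + 2)) (N`!%:R : R[i]) (cGamma (be + _))
  (cGamma _) (cGamma _) (connection_factor _ _ _) => *.
by field; do ?[apply/andP; split].
Qed.

Lemma ecoefN_connection0 N m p : connection_factor a mu xi = 0 -> (0 < m)%N ->
  ecoefN a mu xi N m p = 0.
Proof.
move=> k0 m0.
have d s : (det_poly a mu xi N s)`_m = 0.
  rewrite /det_poly (_ : \matrix_(j, k) _ = map_mx polyC (\matrix_(j, k) acoef a mu (j + k) s)).
    by rewrite det_map_mx coefC gtn_eqF.
  by apply/matrixP => i j; rewrite !mxE /bcoef k0 mulr0 !mul0r mulr0 scale0r addr0.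
rewrite /ecoefN (_ : (fun s => _) = cst (0 : R[i]^o)); last by apply/funext => s; rewrite d mulr0.
suff -> : derive1n p (cst (0 : R[i]^o)) = cst (0 : R[i]^o) :> (R[i] -> R[i]^o) by rewrite mul0r.
elim: p => [//|p IH]; rewrite derive1nS IH.
by apply/funext => x; rewrite derive1_cst.
Qed.

End Coefficients.

(** * Limits of the expansion coefficients *)

Section CoefficientLimits.
Context {R : realType}.
Variables (a mu xi : R[i]).
Hypotheses (hmua : -1 < complex.Re (mu + a)) (hnat : forall n : nat, mu + a <> n%:R).
Local Notation be := (mu + a + 1).

Lemma cvgc_S (f : nat -> R[i]) (l : R[i]) :
  (fun n => f n.+1) @ \oo --> (l : R[i]^o) -> f @ \oo --> (l : R[i]^o).
Proof.
move=> /cvgcP h; apply/cvgcP.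
by rewrite -(cvg_shiftS (fun n => cabs (f n - l))).
Qed.

Lemma ecoef00 : ecoef a mu xi 0 0 = 1.
Proof.
apply: limnc; apply: cvgc_S.
rewrite (_ : (fun n => _) = (fun=> 1)); first exact: (@cvg_cst R[i]^o).
apply/funext => n; rewrite /scaled_ecoefN ecoefN00// mulr1 /exponent mul0r addr0 oppr0.
exact: cpow0.
Qed.

Lemma nat4E n : (4 * n.+1%:R : R[i]) = (4 * n.+1%:R : R)%:C.
Proof. by rewrite rmorphM !rmorph_nat. Qed.

Lemma ecoef01 : ecoef a mu xi 0 1 = - mu / (4 * (mu + a)).
Proof.
apply: limnc; apply: cvgc_S.
rewrite (_ : (fun n => _) = (fun=> - mu / (4 * (mu + a)))); first exact: (@cvg_cst R[i]^o).
apply/funext => n; rewrite /scaled_ecoefN ecoefN01// /exponent mul0r add0r.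
rewrite cpowN cpow1; last by rewrite mulr_gt0// ltr0n.
rewrite -nat4E; have h : (n.+1%:R : R[i]) != 0 by rewrite pnatr_eq0.
have h' : mu + a != 0 by exact: alpha_neq0.
move: h; move: (n.+1%:R : R[i]) => N h.
by field; rewrite h h'.
Qed.

Lemma ecoef10 : ecoef a mu xi 1 0 =
  cGamma (mu + 1) * cGamma (a + 1) / (cGamma (mu + a + 2) ^+ 2 * cGamma be)
  * connection_factor a mu xi * cpow 4 (- be).
Proof.
apply: limnc.
set c := _ / _ * connection_factor a mu xi.
have h := cGamma_ratio_cvg (Re_beta_gt0 hmua).
have hs : (fun n => cGamma (n.+1%:R + be) / (n`!%:R * cpow n.+1%:R be)) @ \oo --> (1 : R[i]^o).
  move/cvgcP : h => h; apply/cvgcP.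
  by rewrite -(cvg_shiftS (fun N => cabs (cGamma (N%:R + be) / (N.-1`!%:R * cpow N%:R be) - 1))) in h.
apply: cvgc_S.
rewrite (_ : (fun n => _) = (fun n => (c * cpow 4 (- be)) * (cGamma (n.+1%:R + be) / (n`!%:R * cpow n.+1%:R be)))).
  rewrite -[X in _ --> X]mulr1; apply: (@cvgMr R[i]^o _ _ _ _ _ _ hs).
apply/funext => n; rewrite /scaled_ecoefN ecoefN10// -/c /exponent mul1r addr0.
rewrite cpowM// ?ltr0n// [_ + be]addrC !cpowN.
rewrite invfM; ring.
Qed.

Lemma ecoef_connection0 m p : connection_factor a mu xi = 0 -> (0 < m)%N ->
  ecoef a mu xi m p = 0.
Proof.
move=> k0 m0; apply: limnc.
rewrite (_ : scaled_ecoefN a mu xi m p = (fun=> 0)); first exact: (@cvg_cst R[i]^o).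
by apply/funext => n; rewrite /scaled_ecoefN ecoefN_connection0// mulr0.
Qed.

End CoefficientLimits.

(** * Absolutely convergent double series *)

Section DoubleSeries.
Context {R : realType}.
Implicit Types (f g : nat -> nat -> R[i]).

Definition square_sum (n : nat) f : R[i] := \sum_(m < n) \sum_(p < n) f m p.
Definition square_sumR (n : nat) (f : nat -> nat -> R) : R := \sum_(m < n) \sum_(p < n) f m p.

Lemma square_sumD n f g :
  square_sum n (fun m p => f m p + g m p) = square_sum n f + square_sum n g.
Proof. by rewrite -big_split; apply: eq_bigr => m _; rewrite -big_split. Qed.

Lemma square_sumZ n c f : square_sum n (fun m p => c * f m p) = c * square_sum n f.
Proof. by rewrite mulr_sumr; apply: eq_bigr => m _; rewrite mulr_sumr. Qed.

Lemma eq_square_sum n f g : (forall m p, f m p = g m p) -> square_sum n f = square_sum n g.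
Proof. by move=> h; apply: eq_bigr => m _; apply: eq_bigr => p _. Qed.

Lemma cabs_square_sum n f : cabs (square_sum n f) <= square_sumR n (fun m p => cabs (f m p)).
Proof.
apply: (le_trans (cabs_sum _ _ _)); apply: ler_sum => m _; exact: cabs_sum.
Qed.

Lemma le_square_sumR n (f g : nat -> nat -> R) : (forall m p, f m p <= g m p) ->
  square_sumR n f <= square_sumR n g.
Proof. by move=> h; apply: ler_sum => m _; apply: ler_sum. Qed.

Lemma square_sumRZ n c (f : nat -> nat -> R) :
  square_sumR n (fun m p => c * f m p) = c * square_sumR n f.
Proof. by rewrite mulr_sumr; apply: eq_bigr => m _; rewrite mulr_sumr. Qed.

Lemma square_sumR_nd (f : nat -> nat -> R) : (forall m p, 0 <= f m p) ->
  nondecreasing_seq (square_sumR^~ f).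
Proof.
move=> f0; apply/nondecreasing_seqP => n; rewrite /square_sumR big_ord_recr /= -[leLHS]addr0.
apply: lerD; last by rewrite sumr_ge0.
by apply: ler_sum => m _; rewrite big_ord_recr /= lerDl.
Qed.

Lemma square_sumR_cvg (f : nat -> nat -> R) M : (forall m p, 0 <= f m p) ->
  (forall n, square_sumR n f <= M) -> cvgn (square_sumR^~ f).
Proof.
move=> f0 fM; apply: nondecreasing_is_cvgn; first exact: square_sumR_nd.
by exists M => _ [n _ <-].
Qed.

(** Adding the modulus to the real and imaginary parts makes their square partial
   sums monotone. *)
Lemma square_sum_cvg f M : (forall n, square_sumR n (fun m p => cabs (f m p)) <= M) ->
  exists l : R[i], square_sum^~ f @ \oo --> (l : R[i]^o).
Proof.
move=> fM.
have key (u : nat -> nat -> R) : (forall m p, `|u m p| <= cabs (f m p)) -> cvgn (square_sumR^~ u).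
  move=> uf.
  have c1 := square_sumR_cvg (fun m p => normc_ge0 (f m p)) fM.
  have c2 : cvgn (square_sumR^~ (fun m p => cabs (f m p) + u m p)).
    apply: (@square_sumR_cvg _ (2 * M)) => [m p|n].
      by have := uf m p; rewrite ler_norml => /andP[h _]; rewrite addrC -lerBlDr sub0r.
    apply: (@le_trans _ _ (square_sumR n (fun m p => 2 * cabs (f m p)))).
      apply: le_square_sumR => m p; have := le_trans (ler_norm _) (uf m p); lra.
    by rewrite square_sumRZ ler_pM2l.
  rewrite (_ : square_sumR^~ u = (fun n => square_sumR n (fun m p => cabs (f m p) + u m p) - square_sumR n (fun m p => cabs (f m p)))).
    exact: is_cvgB.
  apply/funext => n; rewrite /square_sumR -sumrB; apply: eq_bigr => m _.
  by rewrite -sumrB; apply: eq_bigr => p _; rewrite addrC addrA addNr add0r.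
have c1 := key (fun m p => complex.Re (f m p)) (fun m p => normr_Re _).
have c2 := key (fun m p => complex.Im (f m p)) (fun m p => normr_Im _).
exists (limn (square_sumR^~ (fun m p => complex.Re (f m p))) +i*
        limn (square_sumR^~ (fun m p => complex.Im (f m p)))).
apply/cvgc_ReIm; split=> /=.
- rewrite (_ : (fun n => _) = square_sumR^~ (fun m p => complex.Re (f m p)))//.
  apply/funext => n; rewrite /square_sum Re_sum; apply: eq_bigr => m _.
  by rewrite Re_sum.
- rewrite (_ : (fun n => _) = square_sumR^~ (fun m p => complex.Im (f m p)))//.
  apply/funext => n; rewrite /square_sum Im_sum; apply: eq_bigr => m _.
  by rewrite Im_sum.
Qed.

Lemma summable_square_sum f :
  summable [set: nat * nat] (fun mp => (cabs (f mp.1 mp.2))%:E) ->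
  exists2 M : R, 0 <= M & forall n, square_sumR n (fun m p => cabs (f m p)) <= M.
Proof.
rewrite /summable => h.
set S := esum _ _ in h.
have S0 : (0 <= S)%E by apply: esum_ge0 => x _.
have Sfin : S \is a fin_num by rewrite ge0_fin_numE.
exists (fine S); first exact: fine_ge0.
move=> n; rewrite -lee_fin fineK//.
apply: esum_ge; exists (`I_n `*` `I_n).
  by split; [exact: finite_setX | ].
rewrite /square_sumR.
rewrite -(@pair_fsbig _ _ _ _ _ _ _ (fun m p => `|(cabs (f m p))%:E|%E))//=.
rewrite -fsbig_ord -sumEFin; apply: lee_sum => m _.
rewrite -fsbig_ord -sumEFin; apply: lee_sum => p _.
by rewrite /= lee_fin ler_norm.
Qed.

Lemma square_sum_supp1 f m0 p0 n : (forall m p, (m, p) != (m0, p0) -> f m p = 0) ->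
  (m0 < n)%N -> (p0 < n)%N -> square_sum n f = f m0 p0.
Proof.
move=> f0 mn pn; rewrite /square_sum (bigD1 (Ordinal mn))//= (bigD1 (Ordinal pn))//=.
rewrite [X in _ + X + _]big1 ?addr0; last first.
  move=> p pp0; apply: f0; rewrite xpair_eqE eqxx /=.
  by apply: contra pp0 => /eqP h; apply/eqP/val_inj.
rewrite big1 ?addr0// => m mm0; rewrite big1// => p _; apply: f0.
rewrite xpair_eqE negb_and; apply/orP; left.
by apply: contra mm0 => /eqP h; apply/eqP/val_inj.
Qed.

End DoubleSeries.

(** * Series of complex powers and their derivatives *)

Lemma is_derive_quadratic {R : realType} (f : R -> R) (u d C delta : R) : 0 < delta ->
  (forall v, `|v| <= delta -> `|f (u + v) - f u - v * d| <= C * v ^+ 2) ->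
  is_derive u 1 f d.
Proof.
move=> de0 H.
have C0 : 0 <= C.
  have := H delta; rewrite ger0_norm ?(ltW de0)// lexx => /(_ isT) h.
  by have := le_trans (normr_ge0 _) h; rewrite pmulr_lge0// exprn_gt0.
have h : (fun h => h^-1 *: (f (h *: 1 + u) - f u)) @ 0^' --> d.
  apply/cvgrPdist_lt => eps eps0.
  have q0 : 0 < Num.min delta (eps / (C + 1)).
    by rewrite lt_min de0 divr_gt0// ltr_wpDl.
  near=> v.
  have vq : `|v| < Num.min delta (eps / (C + 1)) by near: v; exact: dnbhs0_lt.
  have v0 : v != 0 by near: v; exact: nbhs_dnbhs_neq.
  move: vq; rewrite lt_min => /andP[v1 v2].
  rewrite distrC /GRing.scale /= mulr1 [v + u]addrC.
  rewrite (_ : _ - d = v^-1 * (f (u + v) - f u - v * d)); last by rewrite [RHS]mulrBr mulKf.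
  rewrite normrM normfV ltr_pdivrMl ?normr_gt0//.
  apply: (le_lt_trans (H _ (ltW v1))).
  rewrite -real_normK ?num_real// expr2 mulrCA ltr_pM2l ?normr_gt0//.
  move: v2; rewrite ltr_pdivlMr; last by rewrite ltr_wpDl.
  by apply: le_lt_trans; rewrite mulrC ler_wpM2l// lerDl.
by apply: DeriveDef; [apply/cvg_ex; exists d | exact: cvg_lim].
Unshelve. all: by end_near. Qed.

Section PowerExpansion.
Context {R : realType}.
Variables (be : R[i]) (e : nat -> nat -> R[i]) (s0 M : R).
Hypotheses (be0 : 0 < complex.Re be) (s00 : 0 < s0) (M0 : 0 <= M).
Implicit Types (c : nat -> nat -> R[i]) (s t : R).

Definition expo (m p : nat) : R[i] := m%:R * be + p%:R.
Definition term s m p : R[i] := e m p * cpow s (expo m p).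

Hypothesis hM : forall n, square_sumR n (fun m p => cabs (term s0 m p)) <= M.

Definition wsum c s : R[i] := limn ((fun n => square_sum n (fun m p => c m p * term s m p)) : nat -> R[i]^o).

Lemma Re_expo m p : complex.Re (expo m p) = m%:R * complex.Re be + p%:R.
Proof. by rewrite /expo Re_add Re_mul Re_nat Im_nat mul0r subr0 Re_nat. Qed.

Lemma Re_expo_ge0 m p : 0 <= complex.Re (expo m p).
Proof. by rewrite Re_expo addr_ge0// mulr_ge0// ltW. Qed.

(** All exponents lie in a sector around the positive axis. *)
Definition sector : R := 1 + cabs be / complex.Re be.

Lemma sector_ge1 : 1 <= sector.
Proof. by rewrite lerDl divr_ge0 ?normc_ge0// ltW. Qed.

Lemma expo_sector m p : cabs (expo m p) <= sector * complex.Re (expo m p).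
Proof.
apply: (le_trans (cabsD _ _)); rewrite cabsM !cabs_nat Re_expo mulrDr.
have k1 := sector_ge1.
apply: lerD; last by rewrite ler_peMl.
rewrite mulrCA; apply: ler_wpM2l => //.
rewrite mulrDl mul1r divfK ?gt_eqF// lerDr; exact: ltW.
Qed.

Lemma cabs_term s m p : 0 < s ->
  cabs (term s m p) = cabs (term s0 m p) * expR (complex.Re (expo m p) * (ln s - ln s0)).
Proof.
by move=> s0'; rewrite /term !cabsM !cabs_cpow -mulrA -expRD mulrBr addrC subrK.
Qed.

Lemma linear_expR_bound (k d x : R) : 0 <= k -> 0 < d -> 0 <= x ->
  (k * x + 1) * expR (- (x * d)) <= k / d + 1.
Proof.
move=> k0 d0 x0.
have e1 : expR (- (x * d)) <= 1 by rewrite -expR0 ler_expR oppr_le0 mulr_ge0// ltW.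
have e2 : x * expR (- (x * d)) <= d^-1.
  rewrite expRN ler_pdivrMr ?expR_gt0// mulrC ler_pdivlMr//.
  by apply: le_trans (expR_ge1Dx _); rewrite lerDr.
rewrite mulrDl mul1r -mulrA; apply: lerD => //; exact: ler_wpM2l.
Qed.

Lemma quadratic_expR_bound (d x : R) : 0 < d -> 0 <= x ->
  x ^+ 2 * expR (- (x * d)) <= 4 / d ^+ 2.
Proof.
move=> d0 x0; rewrite expRN ler_pdivrMr ?expR_gt0// mulrAC ler_pdivlMr ?exprn_gt0//.
have -> : x * d = x * d / 2 + x * d / 2 by field.
rewrite expRD -expr2.
have h : 0 <= x * d / 2 by rewrite !mulr_ge0// ltW.
have h2 : x * d / 2 <= expR (x * d / 2) by apply: le_trans (expR_ge1Dx _); rewrite lerDr.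
have := lerXn2r 2; move=> /(_ _ (x * d / 2) (expR (x * d / 2))); rewrite !nnegrE h expR_ge0 => /(_ isT isT h2).
move=> h3; have := ler_wpM2l (_ : 0 <= 4) h3 => /(_ (ler0n _ _)).
by apply: le_trans; rewrite le_eqVlt; apply/orP; left; apply/eqP; field.
Qed.

(** Growth at most linear in the exponent covers the weights of a derivative. *)
Definition weight_ok (q : R) c := forall m p,
  cabs (c m p) <= cabs (expo m p) + 1 /\
  (q <= complex.Re (expo m p) \/ c m p = 0).

(** On [(0, s0 / 2]] the geometric decay of the terms absorbs a factor linear in
   the exponent. *)
Lemma wsum_bound q c : 0 <= q -> weight_ok q c -> exists2 C : R, 0 <= C &
  forall s, 0 < s <= s0 / 2 ->
    ((fun n => square_sum n (fun m p => c m p * term s m p)) @ \oo --> (wsum c s : R[i]^o)) /\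
    cabs (wsum c s) <= C * s `^ q.
Proof.
move=> q0 wc; have l2 : 0 < ln (2 : R) by rewrite ln_gt0// ltr1n.
pose C1 := (sector / ln 2 + 1) * expR (q * ln 2).
have C10 : 0 <= C1.
  rewrite mulr_ge0 ?expR_ge0// addr_ge0// divr_ge0 ?(ltW l2)//.
  exact: le_trans sector_ge1.
exists (C1 * expR (- (q * ln s0)) * M); first by rewrite mulr_ge0// mulr_ge0// expR_ge0.
move=> s /andP[sp ss].
have ls : ln 2 <= ln s0 - ln s.
  rewrite lerBrDr -lnM ?posrE// ler_ln ?posrE ?mulr_gt0// mulrC -ler_pdivlMr//.
have B m p : cabs (c m p * term s m p) <=
    C1 * expR (q * (ln s - ln s0)) * cabs (term s0 m p).
  have [h1 h2] := wc m p; rewrite cabsM.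
  case: h2 => [h2|->]; last first.
    by rewrite ComplexField.Normc.normc0 mul0r mulr_ge0 ?normc_ge0// mulr_ge0// expR_ge0.
  rewrite cabs_term// mulrCA mulrC; apply: ler_wpM2r; first exact: normc_ge0.
  set x := complex.Re (expo m p) in h2 *; have x0 : 0 <= x by exact: Re_expo_ge0.
  have -> : x * (ln s - ln s0) = (x - q) * (ln s - ln s0) + q * (ln s - ln s0) by ring.
  rewrite expRD mulrA; apply: ler_wpM2r; first exact: expR_ge0.
  apply: (@le_trans _ _ ((sector * x + 1) * expR (- (x * ln 2) + q * ln 2))).
    apply: ler_pM; rewrite ?normc_ge0 ?expR_ge0//.
      by apply: (le_trans h1); rewrite lerD2r; exact: expo_sector.
    rewrite ler_expR (_ : - (x * ln 2) + q * ln 2 = - ((x - q) * ln 2)); last by ring.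
    rewrite -lerN2 opprK -mulrN opprB; apply: ler_wpM2l => //; by rewrite subr_ge0.
  rewrite expRD mulrA; apply: ler_wpM2r; first exact: expR_ge0.
  apply: linear_expR_bound => //; exact: le_trans sector_ge1.
have hn n : square_sumR n (fun m p => cabs (c m p * term s m p)) <= C1 * expR (- (q * ln s0)) * M * s `^ q.
  apply: (le_trans (le_square_sumR n B)); rewrite square_sumRZ.
  rewrite /powR gt_eqF// [leRHS]mulrAC -[X in _ <= X * M]mulrA -expRD.
  rewrite (_ : - (q * ln s0) + q * ln s = q * (ln s - ln s0)); last by ring.
  by apply: ler_wpM2l; rewrite ?hM// mulr_ge0// expR_ge0.
have [l hl] := square_sum_cvg hn.
have E : wsum c s = l by exact: limnc.
rewrite E; split=> //.
rewrite -[l]subr0; apply: (cabs_lim_le hl); near=> n.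
by rewrite subr0; apply: (le_trans (cabs_square_sum _ _)).
Unshelve. all: by end_near. Qed.

Lemma wsumD c c' s : 0 < s <= s0 / 2 -> weight_ok 0 c -> weight_ok 0 c' ->
  wsum (fun m p => c m p + c' m p) s = wsum c s + wsum c' s.
Proof.
move=> hs w1 w2; apply: limnc.
have [C1 _ h1] := wsum_bound (lexx 0) w1; have [C2 _ h2] := wsum_bound (lexx 0) w2.
have [h1' _] := h1 _ hs; have [h2' _] := h2 _ hs.
rewrite (_ : (fun n => _) = (fun n => square_sum n (fun m p => c m p * term s m p) + square_sum n (fun m p => c' m p * term s m p))).
  exact: (@cvgD _ R[i]^o _ _ _ _ _ _ _ h1' h2').
by apply/funext => n; rewrite -square_sumD; apply: eq_square_sum => m p; rewrite mulrDl.
Qed.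

Lemma wsum_supp1 c m0 p0 s : (forall m p, (m, p) != (m0, p0) -> c m p = 0) ->
  wsum c s = c m0 p0 * term s m0 p0.
Proof.
move=> h; apply: limnc; apply/cvgcP/cvgrPdist_lt => eps eps0; near=> n.
rewrite (@square_sum_supp1 _ _ m0 p0).
- by rewrite subrr ComplexField.Normc.normc0 subrr normr0.
- by move=> m p mp; rewrite h// mul0r.
- by near: n; exists m0.+1.
- by near: n; exists p0.+1.
Unshelve. all: by end_near. Qed.

Lemma wsum0 c s : (forall m p, c m p * e m p = 0) -> wsum c s = 0.
Proof.
move=> h; apply: limnc; rewrite (_ : (fun n => _) = (fun=> 0)); first exact: (@cvg_cst R[i]^o).
apply/funext => n; rewrite /square_sum big1// => m _; rewrite big1// => p _.
by rewrite /term mulrA h mul0r.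
Qed.

(** The terms are sorted by the leading powers [1], [s], [s^be]; the three
   remainders collect [m = 0], [m = 1] and [m >= 2].  The second one is relative
   to its leading term, which cannot vanish unless its block does. *)
Lemma wsum_expansion (w : nat -> nat -> R[i]) :
  (forall m p, cabs (w m p) <= cabs (expo m p) + 1) ->
  (e 1 0 = 0 -> forall p, e 1 p = 0) -> w 1 0 != 0 ->
  exists (K : R) (a b c : R -> R[i]), 0 <= K /\ forall s, 0 < s <= s0 / 2 ->
   [/\ wsum w s = w 0 0 * e 0 0 + w 0 1 * e 0 1 * s%:C + a s
                  + w 1 0 * e 1 0 * cpow s be * (1 + b s) + c s,
       cabs (a s) <= K * s `^ 2, cabs (b s) <= K * s `^ 1 &
       cabs (c s) <= K * s `^ (2 * complex.Re be)].
Proof.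
move=> hw he w10.
pose r (P : nat -> nat -> bool) := fun m p => if P m p then w m p else 0.
have ok q (P : nat -> nat -> bool) : (forall m p, P m p -> q <= complex.Re (expo m p)) -> weight_ok q (r P).
  move=> h m p; rewrite /r; case: ifP => [Pmp|_].
    by split; [exact: hw | left; exact: h].
  by split; [rewrite ComplexField.Normc.normc0 addr_ge0 ?normc_ge0 | right].
have ok0 (P : nat -> nat -> bool) : weight_ok 0 (r P) by apply: ok => m p _; exact: Re_expo_ge0.
pose P00 (m p : nat) := (m == 0)%N && (p == 0)%N.
pose P01 (m p : nat) := (m == 0)%N && (p == 1)%N.
pose Pa (m p : nat) := (m == 0)%N && (2 <= p)%N.
pose P10 (m p : nat) := (m == 1)%N && (p == 0)%N.
pose Pb (m p : nat) := (m == 1)%N && (1 <= p)%N.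
pose Pc (m p : nat) := (2 <= m)%N.
have [Ka Ka0 ha] : exists2 C : R, 0 <= C & forall s, 0 < s <= s0 / 2 ->
    ((fun n => square_sum n (fun m p => r Pa m p * term s m p)) @ \oo --> (wsum (r Pa) s : R[i]^o)) /\
    cabs (wsum (r Pa) s) <= C * s `^ 2.
  apply: wsum_bound => //; apply: ok => m p /andP[/eqP -> p2].
  by rewrite Re_expo mul0r add0r ler_nat.
have [Kb Kb0 hb] : exists2 C : R, 0 <= C & forall s, 0 < s <= s0 / 2 ->
    ((fun n => square_sum n (fun m p => r Pb m p * term s m p)) @ \oo --> (wsum (r Pb) s : R[i]^o)) /\
    cabs (wsum (r Pb) s) <= C * s `^ (complex.Re be + 1).
  apply: wsum_bound; first by rewrite addr_ge0// ltW.
  apply: ok => m p /andP[/eqP -> p1].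
  by rewrite Re_expo mul1r lerD2l ler1n.
have [Kc Kc0 hc] : exists2 C : R, 0 <= C & forall s, 0 < s <= s0 / 2 ->
    ((fun n => square_sum n (fun m p => r Pc m p * term s m p)) @ \oo --> (wsum (r Pc) s : R[i]^o)) /\
    cabs (wsum (r Pc) s) <= C * s `^ (2 * complex.Re be).
  apply: wsum_bound; first by rewrite mulr_ge0// ltW.
  apply: ok => m p m2; rewrite Re_expo; apply: (@le_trans _ _ (m%:R * complex.Re be)); last by rewrite lerDl.
  by rewrite ler_wpM2r ?ler_nat// ltW.
pose W := w 1 0 * e 1 0.
exists (Ka + Kb / cabs W + Kc), (wsum (r Pa)), (fun s => wsum (r Pb) s / (W * cpow s be)), (wsum (r Pc)).
have Kb' : 0 <= Kb / cabs W by rewrite divr_ge0// normc_ge0.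
split; first by rewrite !addr_ge0.
move=> s hs; have sp : 0 < s by case/andP: hs.
split.
- have -> : wsum w s = wsum (fun m p => r P00 m p + (r P01 m p + (r Pa m p + (r P10 m p + (r Pb m p + r Pc m p))))) s.
    congr (wsum _ s); apply/funext => m; apply/funext => p; rewrite /r /P00 /P01 /Pa /P10 /Pb /Pc.
    by case: m => [|[|m]]; case: p => [|[|p]] /=; rewrite ?addr0 ?add0r.
  have okD c c' : weight_ok 0 c -> weight_ok 0 c' -> (forall m p, c m p = 0 \/ c' m p = 0) -> weight_ok 0 (fun m p => c m p + c' m p).
    move=> h h' hh m p; case: (hh m p) => ->; rewrite ?add0r ?addr0.
      by have [h1 _] := h' m p; split=> //; left; exact: Re_expo_ge0.
    by have [h1 _] := h m p; split=> //; left; exact: Re_expo_ge0.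
  have o1 : weight_ok 0 (fun m p => r Pb m p + r Pc m p).
    apply: okD => // m p; rewrite /r /Pb /Pc.
    by case: m => [|[|m]] /=; [left|right|left].
  have o2 : weight_ok 0 (fun m p => r P10 m p + (r Pb m p + r Pc m p)).
    apply: okD => // m p; rewrite /r /P10 /Pb /Pc.
    by case: m => [|[|m]]; case: p => [|p] /=; rewrite ?addr0; first [by left | by right].
  have o3 : weight_ok 0 (fun m p => r Pa m p + (r P10 m p + (r Pb m p + r Pc m p))).
    apply: okD => // m p; rewrite /r /Pa /P10 /Pb /Pc.
    by case: m => [|m]; case: p => [|[|p]] /=; rewrite ?addr0; first [by left | by right].
  have o4 : weight_ok 0 (fun m p => r P01 m p + (r Pa m p + (r P10 m p + (r Pb m p + r Pc m p)))).
    apply: okD => // m p; rewrite /r /P01 /Pa /P10 /Pb /Pc.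
    by case: m => [|m]; case: p => [|[|p]] /=; rewrite ?addr0; first [by left | by right].
  rewrite !wsumD//.
  rewrite (wsum_supp1 (m0 := 0) (p0 := 0)); last first.
    by move=> [|m] [|p]; rewrite /r /P00 //= eqxx.
  rewrite (wsum_supp1 (m0 := 0) (p0 := 1)); last first.
    by move=> [|m] [|[|p]]; rewrite /r /P01 //= eqxx.
  rewrite (wsum_supp1 (c := r P10) (m0 := 1) (p0 := 0)); last first.
    by move=> [|[|m]] [|p]; rewrite /r /P10 //= eqxx.
  have t00 : term s 0 0 = e 0 0 by rewrite /term /expo mulr0n mul0r addr0 cpow0 mulr1.
  have t01 : term s 0 1 = e 0 1 * s%:C by rewrite /term /expo mulr0n mul0r add0r cpow1.
  have t10 : term s 1 0 = e 1 0 * cpow s be by rewrite /term /expo mulr0n mul1r addr0.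
  rewrite t00 t01 t10 (_ : r P00 0 0 = w 0 0)// (_ : r P01 0 1 = w 0 1)// (_ : r P10 1 0 = w 1 0)//.
  have : W * cpow s be * (wsum (r Pb) s / (W * cpow s be)) = wsum (r Pb) s.
    have [W0|W0] := eqVneq W 0.
      rewrite W0 !mul0r wsum0// => m p; rewrite /r /Pb; case: m => [|[|m]] /=; rewrite ?mul0r//.
      case: ifP => _; last by rewrite mul0r.
      by rewrite he ?mulr0//; move/eqP: W0; rewrite mulf_eq0 (negbTE w10) /= => /eqP.
    by rewrite mulrCA divff ?mulr1// mulf_neq0// cpow_neq0.
  rewrite /W => hB; rewrite mulrDr mulr1 hB; ring.
- have [_ h] := ha _ hs; apply: (le_trans h); rewrite ler_wpM2r ?powR_ge0//.
  by rewrite -addrA lerDl addr_ge0.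
- have [_ h] := hb _ hs.
  apply: (@le_trans _ _ (Kb / cabs W * s `^ 1)); last first.
    by rewrite ler_wpM2r ?powR_ge0// -addrA addrCA lerDl addr_ge0.
  rewrite cabsM cabsV cabsM cabs_cpow invfM mulrA mulrAC -[leRHS]mulrA [leRHS]mulrA.
  have [W0|W0] := eqVneq (cabs W) 0; first by rewrite W0 invr0 !(mul0r, mulr0).
  rewrite [leRHS]mulrAC ler_pM2r ?invr_gt0 ?lt_def ?W0 ?normc_ge0//.
  rewrite ler_pdivrMr ?expR_gt0//; apply: (le_trans h).
  rewrite -mulrA ler_wpM2l// /powR gt_eqF// -expRD mulrDl addrC//.
- have [_ h] := hc _ hs; apply: (le_trans h); rewrite ler_wpM2r ?powR_ge0//.
  by rewrite lerDr addr_ge0.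
Qed.

(** Termwise differentiation in the variable [ln s]: each term is an exponential
   there, and the second-order remainders are summable. *)
Lemma series_is_derive (E : R -> R[i]) (s : R) :
  (forall t, 0 < t <= s0 -> (fun n => square_sum n (term t)) @ \oo --> (E t : R[i]^o)) ->
  0 < s <= s0 / 2 ->
  is_derive s 1 (fun t => complex.Re (E t)) (complex.Re (wsum expo s) / s) /\
  is_derive s 1 (fun t => complex.Im (E t)) (complex.Im (wsum expo s) / s).
Proof.
move=> hE hs; have /andP[sp ss] := hs.
have k1 := sector_ge1; have k0 : 0 < sector by exact: lt_le_trans k1.
have ss0 : s < s0 by apply: (le_lt_trans ss); rewrite ltr_pdivrMr// mulr_natr mulr2n ltrDl.
pose d := ln s0 - ln s; have d0 : 0 < d by rewrite subr_gt0 ltr_ln ?posrE.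
(* [delta] leaves half of the decay [expR (- x d)] in each term. *)
pose delta := d / (2 * sector); have de0 : 0 < delta by rewrite divr_gt0// mulr_gt0.
have deE : 2 * sector * delta = d by rewrite /delta mulrC divfK// mulf_neq0// gt_eqF.
pose C := 4 * sector ^+ 2 * (4 / (d / 2) ^+ 2) * M.
have ok : weight_ok 0 expo.
  by move=> m p; split; [rewrite lerDl | left; exact: Re_expo_ge0].
have [C' _ hC'] := wsum_bound (lexx 0) ok; have [hX _] := hC' _ hs.
have key v : `|v| <= delta ->
    cabs (E (expR (ln s + v)) - E s - v%:C * wsum expo s) <= C * v ^+ 2.
  move=> hv; pose t := expR (ln s + v).
  have tp : 0 < t by exact: expR_gt0.
  have ts0 : t <= s0.
    rewrite -[leRHS]lnK ?posrE// ler_expR -lerBrDl -/d.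
    apply: (le_trans (ler_norm _)); apply: (le_trans hv).
    have : 1 * delta <= 2 * sector * delta by apply: ler_wpM2r; [exact: ltW | lra].
    by rewrite mul1r deE.
  have B m p : cabs (term t m p + (-1) * term s m p + (- v%:C) * (expo m p * term s m p)) <=
      4 * sector ^+ 2 * (4 / (d / 2) ^+ 2) * v ^+ 2 * cabs (term s0 m p).
    have -> : term t m p + (-1) * term s m p + (- v%:C) * (expo m p * term s m p) =
        term s m p * (cexp (expo m p * v%:C) - 1 - expo m p * v%:C).
      have -> : term t m p = term s m p * cexp (expo m p * v%:C).
        rewrite /term -mulrA; congr (_ * _); rewrite /cpow -cexpD -mulrDr.
        by congr (cexp (_ * _)); rewrite /t expRK rmorphD.
      ring.
    rewrite cabsM cabs_term// -mulrA mulrC; apply: ler_wpM2r; first exact: normc_ge0.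
    have q := cexpB1D_le2 (expo m p * v%:C).
    apply: (le_trans (ler_wpM2l (expR_ge0 _) q)); rewrite cabsM cabs_real.
    set x := complex.Re (expo m p); set g := cabs (expo m p).
    have x0 : 0 <= x by exact: Re_expo_ge0.
    have gx : g <= sector * x by exact: expo_sector.
    have g0 : 0 <= g by exact: normc_ge0.
    have gv : g * `|v| <= x * (d / 2).
      apply: (@le_trans _ _ (sector * x * delta)); first exact: ler_pM.
      by rewrite -deE le_eqVlt; apply/orP; left; apply/eqP; field.
    have e1 : expR (g * `|v|) <= expR (x * (d / 2)) by rewrite ler_expR.
    rewrite exprMn real_normK ?num_real//.
    apply: (@le_trans _ _ (expR (x * (ln s - ln s0)) * (4 * ((sector * x) ^+ 2 * v ^+ 2) * expR (x * (d / 2))))).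
      apply: ler_wpM2l; first exact: expR_ge0.
      apply: ler_pM; rewrite ?expR_ge0//.
        by apply: mulr_ge0 => //; apply: mulr_ge0; rewrite sqr_ge0.
      apply: ler_wpM2l => //; apply: ler_wpM2r; first by rewrite sqr_ge0.
      by rewrite lerXn2r ?nnegrE// (le_trans g0).
    have h2 : expR (x * (ln s - ln s0)) * expR (x * (d / 2)) = expR (- (x * (d / 2))).
      by rewrite -expRD; congr expR; rewrite /d; field.
    rewrite (_ : _ * (4 * _ * _) = 4 * sector ^+ 2 * v ^+ 2 * (x ^+ 2 * (expR (x * (ln s - ln s0)) * expR (x * (d / 2))))); last by ring.
    rewrite h2 (_ : 4 * sector ^+ 2 * (4 / (d / 2) ^+ 2) * v ^+ 2 = 4 * sector ^+ 2 * v ^+ 2 * (4 / (d / 2) ^+ 2)); last by ring.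
    apply: ler_wpM2l; last by apply: quadratic_expR_bound => //; rewrite divr_gt0.
    by apply: mulr_ge0; rewrite ?sqr_ge0//; apply: mulr_ge0; rewrite ?sqr_ge0.
  have hlim : (fun n => square_sum n (fun m p => term t m p + (-1) * term s m p + (- v%:C) * (expo m p * term s m p)))
      @ \oo --> (E t - E s - v%:C * wsum expo s : R[i]^o).
    rewrite (_ : (fun n => _) = (fun n => square_sum n (term t) - square_sum n (term s) - v%:C * square_sum n (fun m p => expo m p * term s m p))).
      have h1 : (fun n => square_sum n (term t)) @ \oo --> (E t : R[i]^o) by apply: hE; rewrite tp.
      have h2 : (fun n => square_sum n (term s)) @ \oo --> (E s : R[i]^o) by apply: hE; rewrite sp ltW.
      apply: (@cvgB _ R[i]^o); last exact: (@cvgMr R[i]^o _ _ _ _ _ _ hX).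
      exact: (@cvgB _ R[i]^o _ _ _ _ _ _ _ h1 h2).
    apply/funext => n; rewrite !square_sumD !square_sumZ mulN1r; congr (_ + _).
    by rewrite mulNr.
  rewrite -[X in cabs X]subr0; apply: (cabs_lim_le hlim); near=> n.
  rewrite subr0; apply: (le_trans (cabs_square_sum _ _)).
  apply: (le_trans (le_square_sumR n B)); rewrite square_sumRZ.
  rewrite /C [leRHS]mulrAC; apply: ler_wpM2l; last exact: hM.
  apply: mulr_ge0; rewrite ?sqr_ge0//; apply: mulr_ge0; last by apply: divr_ge0; rewrite ?sqr_ge0.
  by apply: mulr_ge0; rewrite ?sqr_ge0.
have conv (P : R[i] -> R) : (forall z, `|P z| <= cabs z) ->
    (forall z w, P (z - w) = P z - P w) -> (forall v z, P (v%:C * z) = v * P z) ->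
    is_derive s 1 (fun t => P (E t)) (P (wsum expo s) / s).
  move=> P1 P2 P3.
  have h : is_derive (ln s) 1 (fun u => P (E (expR u))) (P (wsum expo s)).
    apply: (is_derive_quadratic (C := C) de0) => v hv.
    apply: le_trans (key _ hv); rewrite lnK ?posrE//.
    by rewrite -P3 -!P2; exact: P1.
  have := is_derive_compR h (is_derive1_ln sp).
  apply: near_eq_is_derive; near=> t.
  have tp : 0 < t by near: t; exact: lt_nbhsr.
  by rewrite lnK.
split; apply: conv.
- exact: normr_Re.
- by move=> z w; rewrite Re_add Re_opp.
- by move=> v z; rewrite Re_mul /= mul0r subr0.
- exact: normr_Im.
- by move=> z w; rewrite Im_add Im_opp.
- by move=> v z; rewrite Im_mul /= mul0r addr0.
Unshelve. all: by end_near. Qed.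

End PowerExpansion.

(** * Orders of magnitude at the origin *)

Section PowerOrder.
Context {R : realType}.
Implicit Types (f g : R -> R[i]) (q r : R).

Definition order_pow f q := exists K : R, \forall s \near (0 : R)^'+, cabs (f s) <= K * s `^ q.

Lemma order_pow_ge0 f q : order_pow f q -> exists2 K : R, 0 <= K &
  \forall s \near (0 : R)^'+, cabs (f s) <= K * s `^ q.
Proof.
move=> [K hK]; exists `|K| => //; apply: filterS hK => s h; apply: (le_trans h).
by rewrite ler_wpM2r ?powR_ge0 ?ler_norm.
Qed.

Lemma order_powD f g q : order_pow f q -> order_pow g q -> order_pow (fun s => f s + g s) q.
Proof.
move=> [K hK] [L hL]; exists (K + L); apply: filterS2 hK hL => s h1 h2.
by rewrite mulrDl (le_trans (cabsD _ _))// lerD.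
Qed.

Lemma order_powM f g q r : order_pow f q -> order_pow g r ->
  order_pow (fun s => f s * g s) (q + r).
Proof.
move=> /order_pow_ge0[K K0 hK] /order_pow_ge0[L L0 hL]; exists (K * L); near=> s.
have s0 : 0 < s by near: s; exact: nbhs_right_gt.
rewrite cabsM powRD; last by rewrite (gt_eqF s0) implybT.
rewrite mulrACA; apply: ler_pM; rewrite ?normc_ge0//; near: s; [exact: hK | exact: hL].
Unshelve. all: by end_near. Qed.

Lemma order_powMr f g q : order_pow f q -> order_pow g 0 ->
  order_pow (fun s => f s * g s) q.
Proof. by move=> hf hg; have := order_powM hf hg; rewrite addr0. Qed.

Lemma order_powMl f g q : order_pow f 0 -> order_pow g q ->
  order_pow (fun s => f s * g s) q.
Proof. by move=> hf hg; have := order_powM hf hg; rewrite add0r. Qed.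

Lemma order_powN f q : order_pow f q -> order_pow (fun s => - f s) q.
Proof. by move=> [K hK]; exists K; apply: filterS hK => s; rewrite cabsN. Qed.

Lemma order_powB f g q : order_pow f q -> order_pow g q -> order_pow (fun s => f s - g s) q.
Proof. by move=> hf /order_powN; exact: order_powD. Qed.

Lemma order_pow_weaken f q r : r <= q -> order_pow f q -> order_pow f r.
Proof.
move=> rq /order_pow_ge0[K K0 hK]; exists K; near=> s.
have s0 : 0 < s by near: s; exact: nbhs_right_gt.
have s1 : s < 1 by near: s; exact: nbhs_right_lt.
apply: (@le_trans _ _ (K * s `^ q)); first by near: s; exact: hK.
by apply: ler_wpM2l => //; rewrite /powR gt_eqF// ler_expR ler_wnM2r// ln_le0// ltW.
Unshelve. all: by end_near. Qed.

Lemma order_pow_cst (z : R[i]) : order_pow (fun=> z) 0.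
Proof. by exists (cabs z); near=> s; rewrite powRr0 mulr1. Unshelve. all: by end_near. Qed.

Lemma order_pow_id : order_pow (fun s => s%:C) 1.
Proof.
exists 1; near=> s; have s0 : 0 < s by near: s; exact: nbhs_right_gt.
by rewrite mul1r powRr1 ?(ltW s0)// cabs_real gtr0_norm.
Unshelve. all: by end_near. Qed.

Lemma order_pow_cpow (z : R[i]) : order_pow (fun s => cpow s z) (complex.Re z).
Proof.
exists 1; near=> s; have s0 : 0 < s by near: s; exact: nbhs_right_gt.
by rewrite mul1r cabs_cpow /powR gt_eqF.
Unshelve. all: by end_near. Qed.

Lemma order_pow_small f q (eps : R) : 0 < q -> 0 < eps -> order_pow f q ->
  \forall s \near (0 : R)^'+, cabs (f s) <= eps.
Proof.
move=> q0 eps0 /order_pow_ge0[K K0 hK].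
have h := @expR_xln_cvg0 R q q0; move/cvgrPdist_lt : h => h.
have K1 : 0 < K + 1 by rewrite ltr_wpDl.
have e0 : 0 < eps / (K + 1) by rewrite divr_gt0.
near=> s; have s0 : 0 < s by near: s; exact: nbhs_right_gt.
apply: (@le_trans _ _ (K * s `^ q)); first by near: s; exact: hK.
have : expR (q * ln s) < eps / (K + 1).
  have : `|0 - expR (q * ln s)| < eps / (K + 1) by near: s; exact: h.
  by rewrite sub0r normrN ger0_norm ?expR_ge0.
rewrite /powR gt_eqF// ltr_pdivlMr// => h'; apply: le_trans (ltW h').
by rewrite mulrC ler_wpM2l ?expR_ge0// lerDl.
Unshelve. all: by end_near. Qed.

Lemma cabs_1D_ge (z : R[i]) : cabs z <= 1 / 2 -> 1 / 2 <= cabs (1 + z).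
Proof.
move=> h; have := cabsB (1 + z) z; rewrite addrK ComplexField.Normc.normc1; lra.
Qed.

Lemma cabs_1D_neq0 (z : R[i]) : cabs z <= 1 / 2 -> 1 + z != 0.
Proof.
move=> /cabs_1D_ge h; rewrite -cabs_gt0; apply: lt_le_trans h.
by rewrite divr_gt0.
Qed.

Lemma order_pow_inv1D f q : 0 < q -> order_pow f q ->
  order_pow (fun s => (1 + f s)^-1) 0.
Proof.
move=> q0 /(@order_pow_small _ _ (1 / 2) q0) h; exists 2.
have h2 : 0 < 1 / 2 :> R by rewrite divr_gt0.
apply: filterS (h h2) => s /cabs_1D_ge hs; rewrite powRr0 mulr1 cabsV.
have hp : 0 < cabs (1 + f s) by apply: lt_le_trans hs.
by rewrite -[leRHS]invrK lef_pV2 ?posrE ?invr_gt0//; apply: le_trans hs; rewrite div1r.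
Qed.

Lemma order_pow_eqO f q (g : R -> R) : order_pow f q ->
  (forall s, 0 < s -> g s = s `^ q) ->
  (fun s => cabs (f s)) =O_ (0^'+) g.
Proof.
move=> /order_pow_ge0[K K0 hK] gE; apply/eqO_exP; exists (K + 1).
  by rewrite ltr_wpDl.
near=> s; have s0 : 0 < s by near: s; exact: nbhs_right_gt.
rewrite ger0_norm ?normc_ge0// gE// ger0_norm ?powR_ge0//.
apply: (@le_trans _ _ (K * s `^ q)); first by near: s; exact: hK.
by rewrite ler_wpM2r ?powR_ge0// lerDl.
Unshelve. all: by end_near. Qed.

(** Dividing the two expansions: [A], [B], [C] and [A'], [B'], [C'] are their
   parts of orders [s], [s^be] and [s^(2 be)].  Since [B] and [B'] are multiples
   of [p s^be], so is [B' / (1 + A) - A' B / (1 + A)^2], the part of the quotient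
   that is linear in them. *)
Lemma quotient_expansion (be x p : R[i]) (a0 b0 c0 a1 b1 c1 : R -> R[i]) :
  0 < complex.Re be ->
  order_pow a0 2 -> order_pow b0 1 -> order_pow c0 (2 * complex.Re be) ->
  order_pow a1 2 -> order_pow b1 1 -> order_pow c1 (2 * complex.Re be) ->
  let X0 s := 1 + x * s%:C + a0 s + p * cpow s be * (1 + b0 s) + c0 s in
  let X1 s := x * s%:C + a1 s + be * p * cpow s be * (1 + b1 s) + c1 s in
  (\forall s \near (0 : R)^'+, cabs (X0 s - 1) <= 1 / 2) /\
  exists r1 r2 r3 : R -> R[i],
  [/\ order_pow r1 2, order_pow r2 1, order_pow r3 (2 * complex.Re be) &
      \forall s \near (0 : R)^'+, X1 s / X0 s =
        x * s%:C + r1 s + be * p * cpow s be * (1 + r2 s) + r3 s].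
Proof.
move=> be0 oa0 ob0 oc0 oa1 ob1 oc1 X0 X1.
have bn : be != 0 by apply/eqP => h; rewrite h ltxx in be0.
have half : 0 < 1 / 2 :> R by rewrite divr_gt0.
have ox : order_pow (fun s => x * s%:C) 1.
  by apply: order_powMl; [exact: order_pow_cst | exact: order_pow_id].
pose A s := x * s%:C + a0 s; pose A' s := x * s%:C + a1 s.
have w12 : (1 : R) <= 2 by rewrite ler1n.
have oA : order_pow A 1 by apply: order_powD => //; exact: order_pow_weaken oa0.
have oA' : order_pow A' 1 by apply: order_powD => //; exact: order_pow_weaken oa1.
pose B s := p * cpow s be * (1 + b0 s); pose B' s := be * p * cpow s be * (1 + b1 s).
have w01 : (0 : R) <= 1 by [].
have o1b f : order_pow f 1 -> order_pow (fun s => 1 + f s) 0.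
  by move=> h; apply: order_powD; [exact: order_pow_cst | exact: order_pow_weaken h].
have oB : order_pow B (complex.Re be).
  apply: order_powMr; last exact: o1b.
  by apply: order_powMl; [exact: order_pow_cst | exact: order_pow_cpow].
have oB' : order_pow B' (complex.Re be).
  apply: order_powMr; last exact: o1b.
  by apply: order_powMl; [exact: order_pow_cst | exact: order_pow_cpow].
have wb2 : complex.Re be <= 2 * complex.Re be by rewrite mulr_natl mulr2n lerDl ltW.
pose D s := B s + c0 s.
have oD : order_pow D (complex.Re be) by apply: order_powD => //; exact: order_pow_weaken oc0.
have oX : order_pow (fun s => A s + D s) (Num.min 1 (complex.Re be)).
  by apply: order_powD; [apply: order_pow_weaken oA | apply: order_pow_weaken oD];
    rewrite ge_min lexx ?orbT.
have m0 : 0 < Num.min 1 (complex.Re be) by rewrite lt_min ltr01.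
have X0E s : X0 s = 1 + (A s + D s) by rewrite /X0 /A /D /B; ring.
pose q s := (1 + A s)^-1.
have oq : order_pow q 0 by exact: order_pow_inv1D oA.
have oi : order_pow (fun s => (X0 s)^-1) 0.
  rewrite (_ : (fun s => (X0 s)^-1) = (fun s => (1 + (A s + D s))^-1)).
    exact: order_pow_inv1D oX.
  by apply/funext => s; rewrite X0E.
have smallX := order_pow_small m0 half oX.
have smallA := order_pow_small ltr01 half oA.
split; first by apply: filterS smallX => s; rewrite X0E [1 + _]addrC addrK.
have oA'0 : order_pow A' 0 by exact: order_pow_weaken oA'.
(* Use [1 / X0 = q - q D / X0], and once more in the term [A' q B / X0]. *)
exists (fun s => (a1 s - x * s%:C * A s) * q s).
exists (fun s => (b1 s - A s) * q s - be^-1 * A' s * (1 + b0 s) * (q s * q s)).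
exists (fun s => (c1 s - A' s * q s * c0 s - B' s * D s * q s + A' s * (q s * q s) * (B s * D s)) * (X0 s)^-1).
split.
- apply: order_powMr => //; apply: order_powB => //.
  by rewrite (_ : 2 = 1 + 1 :> R)//; exact: order_powM.
- have oqq : order_pow (fun s => q s * q s) 0 by exact: order_powMr.
  apply: order_powB; first by apply: order_powMr => //; exact: order_powB.
  apply: order_powMr => //; apply: order_powMr; last exact: o1b.
  by apply: order_powMl => //; exact: order_pow_cst.
- have dbl : 2 * complex.Re be = complex.Re be + complex.Re be by rewrite mulr_natl.
  have oqq : order_pow (fun s => q s * q s) 0 by exact: order_powMr.
  have oBD : order_pow (fun s => B s * D s) (2 * complex.Re be) by rewrite dbl; exact: order_powM.
  have oBD' : order_pow (fun s => B' s * D s) (2 * complex.Re be) by rewrite dbl; exact: order_powM.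
  apply: order_powMr => //; apply: order_powD; last first.
    by apply: order_powMl => //; exact: order_powMr.
  apply: order_powB; last exact: order_powMr.
  apply: order_powB => //; apply: order_powMl => //.
  exact: order_powMr.
- apply: filterS2 smallX smallA => s /cabs_1D_neq0 h1 /cabs_1D_neq0 h2.
  have h1' := h1; rewrite -X0E in h1'.
  apply: (mulIf h1'); rewrite divfK//.
  have e3 (u w : R[i]) : (u + w * (X0 s)^-1) * X0 s = u * X0 s + w.
    by rewrite mulrDl divfK.
  rewrite e3// X0E /q /X1 /B' /D /B /A'.
  move: h2; move: (A s) (a1 s) (b0 s) (b1 s) (c0 s) (c1 s) (cpow s be) (s%:C : R[i]).
  move=> As a1s b0s b1s c0s c1s ps sC h2.
  by field; do ?[apply/andP; split].
Qed.

End PowerOrder.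

(** * The derivative of the logarithm *)

Section LogDerivative.
Context {R : realType}.

Lemma is_derive_sqrt_comp (g : R -> R) (t b : R) : 0 < g t -> is_derive t 1 g b ->
  is_derive t 1 (fun u => Num.sqrt (g u)) ((2 * Num.sqrt (g t))^-1 * b).
Proof.
by move=> g0 gb; exact: (@is_derive_compR _ Num.sqrt g t _ _ (is_derive1_sqrt g0) gb).
Qed.

Lemma is_derive_log_arg (f g : R -> R) (s f' g' : R) : 0 < f s ->
  is_derive s 1 f f' -> is_derive s 1 g g' ->
  is_derive s 1 (fun t => ln (Num.sqrt (f t * f t + g t * g t)))
    ((f' * f s + g' * g s) / (f s * f s + g s * g s)) /\
  is_derive s 1 (fun t => 2 * atan (g t / (Num.sqrt (f t * f t + g t * g t) + f t)))
    ((g' * f s - f' * g s) / (f s * f s + g s * g s)).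
Proof.
move=> f0 hf hg.
have n0 : 0 < f s * f s + g s * g s.
  by apply: ltr_wpDr; [rewrite -expr2 sqr_ge0 | rewrite mulr_gt0].
have dn := is_derive_addR (is_derive_mulR hf hf) (is_derive_mulR hg hg).
have dr := @is_derive_sqrt_comp (fun t => f t * f t + g t * g t) s _ n0 dn.
have r0 : 0 < Num.sqrt (f s * f s + g s * g s) by rewrite sqrtr_gt0.
have rr : Num.sqrt (f s * f s + g s * g s) * Num.sqrt (f s * f s + g s * g s) = f s * f s + g s * g s.
  by rewrite -expr2 sqr_sqrtr// ltW.
have q0 : 0 < Num.sqrt (f s * f s + g s * g s) + f s by rewrite addr_gt0.
split.
- have h := @is_derive_compR _ (@ln R) (fun t => Num.sqrt (f t * f t + g t * g t)) s _ _ (is_derive1_ln r0) dr.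
  apply: (is_derive_eq h).
  move: rr r0; move: (Num.sqrt _) => r rr r0; rewrite -rr.
  by field; rewrite gt_eqF.
- have dq := is_derive_addR dr hf.
  have dw := is_derive_mulR hg (@is_deriveV _ _ s _ 1 (lt0r_neq0 q0) dq).
  have da := is_derive_scaleR 2 (@is_derive_compR _ (@atan R) _ s _ _ (is_derive1_atan _) dw).
  apply: (is_derive_eq da); rewrite /GRing.scale /=.
  clear dn dr dq dw da; set r := Num.sqrt (f s * f s + g s * g s) in rr r0 q0 *; clearbody r.
  move: rr q0; move: (f s) (g s) => x y rr q0; rewrite -rr.
  have qn : r + x != 0 by rewrite gt_eqF.
  have rn : r != 0 by rewrite gt_eqF.
  (* The tangent of half the argument, where the modulus is [r]. *)
  have E : 1 + (y / (r + x)) ^+ 2 = 2 * r / (r + x).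
    have -> : 1 + (y / (r + x)) ^+ 2 = (r * r + 2 * r * x + (x * x + y * y)) / (r + x) ^+ 2 by field.
    by rewrite -rr; field.
  rewrite E; apply: (mulIf (mulf_neq0 rn rn)); rewrite divfK ?mulf_neq0//.
  have -> : 2 * ((2 * r / (r + x))^-1 * (g' / (r + x) +
      y * (- (r + x) ^- 2 * ((2 * r)^-1 * (f' * x + x * f' + (g' * y + y * g')) + f')))) * (r * r) =
    (g' * r * (r + x) - y * (f' * x + g' * y + f' * r)) / (r + x).
    by field; do ?[apply/andP; split].
  apply: (mulIf qn); rewrite divfK//.
  have -> : g' * r * (r + x) - y * (f' * x + g' * y + f' * r) =
     g' * (r * r) + g' * r * x - y * f' * x - g' * (y * y) - y * f' * r by ring.
  have -> : y * y = r * r - x * x by rewrite rr addrC addKr.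
  ring.
Qed.

(** On the right half-plane the half-angle formula is smooth and the logarithmic
   derivative takes its usual form. *)
Lemma is_derive_clog (E : R -> R[i]) (s : R) (d : R[i]) :
  0 < complex.Re (E s) ->
  is_derive s 1 (fun t => complex.Re (E t)) (complex.Re d) ->
  is_derive s 1 (fun t => complex.Im (E t)) (complex.Im d) ->
  is_derive s 1 (fun t => complex.Re (clog (E t))) (complex.Re (d / E s)) /\
  is_derive s 1 (fun t => complex.Im (clog (E t))) (complex.Im (d / E s)).
Proof.
move=> E0 hf hg.
have nE t : cabs (E t) = Num.sqrt (complex.Re (E t) * complex.Re (E t) + complex.Im (E t) * complex.Im (E t)).
  by case: (E t) => x y /=; rewrite !expr2.
have [h1 h2] := is_derive_log_arg E0 hf hg.
have n0 : 0 < complex.Re (E s) * complex.Re (E s) + complex.Im (E s) * complex.Im (E s).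
  by apply: ltr_wpDr; [rewrite -expr2 sqr_ge0 | rewrite mulr_gt0].
have dE : d / E s =
    ((complex.Re d * complex.Re (E s) + complex.Im d * complex.Im (E s)) /
      (complex.Re (E s) * complex.Re (E s) + complex.Im (E s) * complex.Im (E s))) +i*
    ((complex.Im d * complex.Re (E s) - complex.Re d * complex.Im (E s)) /
      (complex.Re (E s) * complex.Re (E s) + complex.Im (E s) * complex.Im (E s))).
  case: (E s) n0 => x y /= n0; case: (d) => u v; apply: complexP => /=.
  - by rewrite !expr2; field; rewrite gt_eqF.
  - by rewrite !expr2; field; rewrite gt_eqF.
rewrite dE /=; split.
- rewrite (_ : (fun t => _) = (fun t => ln (Num.sqrt (complex.Re (E t) * complex.Re (E t) + complex.Im (E t) * complex.Im (E t)))))//.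
  by apply/funext => t; rewrite nE.
- apply: near_eq_is_derive h2.
  have cf : {for s, continuous (fun t => complex.Re (E t))} by exact: is_derive_continuous hf.
  have nf : \forall t \near s, 0 < complex.Re (E t) by apply: (cvgr_gt _ cf _ E0).
  near=> t; rewrite /clog /carg /=.
  have ft : 0 < complex.Re (E t) by near: t; exact: nf.
  by rewrite [complex.Re _ < 0]ltNge (ltW ft) /= andbF nE.
Unshelve. all: by end_near. Qed.

End LogDerivative.

(** * Expansions at the hard edge *)

Lemma Re_mul_real {R : realType} (z : R[i]) (x : R) :
  complex.Re (z * x%:C) = complex.Re z * x.
Proof. by rewrite Re_mul /= mulr0 subr0. Qed.

Lemma Im_mul_real {R : realType} (z : R[i]) (x : R) :
  complex.Im (z * x%:C) = complex.Im z * x.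
Proof. by rewrite Im_mul /= mulr0 add0r. Qed.

Section HardEdge.
Context {R : realType}.
Variables (xi mu a : R[i]).
Hypotheses (hmu : -1 < complex.Re mu) (ha : -1 < complex.Re a)
  (hmua : -1 < complex.Re (mu + a)) (hnat : forall n : nat, mu + a <> n%:R)
  (hterm : term_by_term a mu xi).
Local Notation be := (mu + a + 1).
Local Notation x := (- mu / (4 * (mu + a))).
Local Notation p := (ecoef a mu xi 1 0).

(** The leading coefficient of the block [m = 1] is a nonzero multiple of the
   connection factor, which is a factor of the whole block. *)
Lemma ecoef1_eq0 : p = 0 -> forall k, ecoef a mu xi 1 k = 0.
Proof.
move=> p0 k; apply: ecoef_connection0 => //.
have G (z : R[i]) : -1 < complex.Re z -> cGamma (z + 1) != 0.
  by move=> hz; apply: cGamma_neq0; rewrite Re_add /= -ltrBlDr sub0r.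
have G2 : cGamma (mu + a + 2) != 0.
  rewrite (_ : mu + a + 2 = be + 1%:R); last by ring.
  by apply: cGamma_neq0; apply: Re_addn_gt0; exact: Re_beta_gt0.
move/eqP : p0; rewrite ecoef10// mulf_eq0 (negbTE (cpow_neq0 _ _)) orbF mulf_eq0.
case/orP => [|/eqP//]; rewrite mulf_eq0 invr_eq0 !mulf_eq0 /=.
by rewrite (negbTE (G _ hmu)) (negbTE (G _ ha)) (negbTE (G _ hmua)) (negbTE G2).
Qed.

(** The function and its derivative in [ln s] are the same series with weights
   [1] and [m be + p], so that one sorting of the terms serves for both. *)
Lemma hard_edge_expansions : exists (D a0 b0 c0 a1 b1 c1 : R -> R[i]),
  [/\ order_pow a0 2, order_pow b0 1 & order_pow c0 (2 * complex.Re be)] /\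
  [/\ order_pow a1 2, order_pow b1 1 & order_pow c1 (2 * complex.Re be)] /\
  \forall s \near (0 : R)^'+,
    [/\ E2hard a mu xi s = 1 + x * s%:C + a0 s + p * cpow s be * (1 + b0 s) + c0 s,
        D s = x * s%:C + a1 s + be * p * cpow s be * (1 + b1 s) + c1 s,
        is_derive s 1 (fun t => complex.Re (E2hard a mu xi t)) (complex.Re (D s) / s) &
        is_derive s 1 (fun t => complex.Im (E2hard a mu xi t)) (complex.Im (D s) / s)].
Proof.
have be0 := Re_beta_gt0 hmua.
have [_ [s0 s00 [hsum hE]]] := hterm.
have [M M0 hM] := summable_square_sum hsum.
have be_neq0 : be != 0 by apply: Re_gt0_neq0.
have [|||K0 [a0 [b0 [c0 [K00 h0]]]]] := @wsum_expansion R be (ecoef a mu xi) s0 M be0 s00 M0 hM (fun _ _ => 1).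
- by move=> m k; rewrite ComplexField.Normc.normc1 lerDr normc_ge0.
- exact: ecoef1_eq0.
- exact: oner_neq0.
have [|||K1 [a1 [b1 [c1 [K10 h1]]]]] := @wsum_expansion R be (ecoef a mu xi) s0 M be0 s00 M0 hM (expo be).
- by move=> m k; rewrite lerDl.
- exact: ecoef1_eq0.
- by rewrite /expo mulr0n addr0 mul1r.
have nearI : \forall s \near (0 : R)^'+, 0 < s <= s0 / 2.
  near=> s; apply/andP; split; first by near: s; exact: nbhs_right_gt.
  by near: s; apply: nbhs_right_le; rewrite divr_gt0.
have near_order (f : R -> R[i]) (K q : R) :
    (forall s, 0 < s <= s0 / 2 -> cabs (f s) <= K * s `^ q) -> order_pow f q.
  by move=> hf; exists K; apply: filterS nearI.
exists (wsum be (ecoef a mu xi) (expo be)), a0, b0, c0, a1, b1, c1.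
split; first by split; apply: (near_order _ K0 _) => s hs; have [_ ? ? ?] := h0 _ hs.
split; first by split; apply: (near_order _ K1 _) => s hs; have [_ ? ? ?] := h1 _ hs.
apply: filterS nearI => s hs; have [d1 d2] := series_is_derive be0 s00 M0 hM hE hs.
split=> //.
- have [w0 _ _ _] := h0 _ hs.
  have -> : E2hard a mu xi s = wsum be (ecoef a mu xi) (fun _ _ => 1) s.
    apply/esym; apply: limnc; rewrite (_ : (fun n => _) = (fun n => square_sum n (term be (ecoef a mu xi) s))).
      apply: hE; have /andP[-> h] := hs.
      by apply: (le_trans h); rewrite ler_pdivrMr// ler_peMr ?ler1n// ltW.
    by apply/funext => n; apply: eq_square_sum => m k; rewrite mul1r.
  by rewrite w0 ecoef00// ecoef01// !mul1r.
- have [w1 _ _ _] := h1 _ hs; rewrite w1 ecoef01//.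
  rewrite (_ : expo be 0 0 = 0); last by rewrite /expo mulr0n mul0r addr0.
  rewrite (_ : expo be 0 1 = 1); last by rewrite /expo mulr0n mul0r add0r.
  rewrite (_ : expo be 1 0 = be); last by rewrite /expo mulr0n addr0 mul1r.
  by rewrite mul0r add0r mul1r.
Unshelve. all: by end_near. Qed.

Lemma ecoef10_cpow s : 0 < s -> p * cpow s be =
  cGamma (mu + 1) * cGamma (a + 1) / (cGamma (mu + a + 2) ^+ 2 * cGamma be)
  * connection_factor a mu xi * cpow (s / 4) be.
Proof.
move=> sp; rewrite ecoef10// -mulrA; congr (_ * _).
rewrite cpowM ?invr_gt0// mulrC; congr (_ * _).
by rewrite /cpow lnV ?posrE// rmorphN mulrN mulNr.
Qed.

Lemma sigma_coefficient : be * (cGamma (mu + 1) * cGamma (a + 1) / (cGamma (mu + a + 2) ^+ 2 * cGamma be)) =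
  cGamma (mu + 1) * cGamma (a + 1) / (cGamma (mu + a + 2) * cGamma be ^+ 2).
Proof.
have be0 := Re_beta_gt0 hmua.
have -> : cGamma (mu + a + 2) = be * cGamma be.
  by rewrite -cGammaS//; congr cGamma; ring.
have g0 := cGamma_neq0 be0; have b0 := Re_gt0_neq0 be0.
move: g0 b0; move: (cGamma be) (cGamma (mu + 1)) (cGamma (a + 1)) be => g u v b g0 b0.
by field; rewrite b0 g0.
Qed.

End HardEdge.

Unset Implicit Arguments.

Theorem corollary4p1 (R : realType) (xi mu a : R[i])
    (hmu : -1 < complex.Re mu) (ha : -1 < complex.Re a)
    (hmua : -1 < complex.Re (mu + a))
    (hnat : forall n : nat, mu + a <> n%:R)
    (hlim : \forall s \near (0 : R)^'+,
      cvgn (fun N : nat => E2N a mu xi N (s / (4 * N%:R)) : R[i]^o))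
    (hterm : term_by_term a mu xi) :
  (exists r1 r2 r3 : R -> R[i],
    [/\ (fun s => cabs (r1 s)) =O_ (0^'+) (fun s => s ^+ 2),
        (fun s => cabs (r2 s)) =O_ (0^'+) (fun s => s),
        (fun s => cabs (r3 s)) =O_ (0^'+)
          (fun s => s `^ complex.Re (2 * (mu + a + 1))) &
        \forall s \near 0^'+,
          E2hard a mu xi s =
            1 - mu / (4 * (a + mu)) * s%:C + r1 s
            + cGamma (mu + 1) * cGamma (a + 1)
                / (cGamma (mu + a + 2) ^+ 2 * cGamma (mu + a + 1))
              * ((1 - xi) * cexp ((0 +i* pi) * mu)
                 - csin (pi%:C * a) / csin (pi%:C * (mu + a)))
              * cpow (s / 4) (mu + a + 1) * (1 + r2 s)
            + r3 s]) /\
  (\forall s \near (0 : R)^'+,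
     cderivable (fun t => clog (E2hard a mu xi t)) s) /\
  (exists r1 r2 r3 : R -> R[i],
    [/\ (fun s => cabs (r1 s)) =O_ (0^'+) (fun s => s ^+ 2),
        (fun s => cabs (r2 s)) =O_ (0^'+) (fun s => s),
        (fun s => cabs (r3 s)) =O_ (0^'+)
          (fun s => s `^ complex.Re (2 * (mu + a + 1))) &
        \forall s \near 0^'+,
          sigmaIII a mu xi s =
            - (mu * (mu + a) / 2) + mu / (4 * (mu + a)) * s%:C + r1 s
            - cGamma (mu + 1) * cGamma (a + 1)
                / (cGamma (mu + a + 2) * cGamma (mu + a + 1) ^+ 2)
              * ((1 - xi) * cexp ((0 +i* pi) * mu)
                 - csin (pi%:C * a) / csin (pi%:C * (mu + a)))
              * cpow (s / 4) (mu + a + 1) * (1 + r2 s)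
            + r3 s]).
Proof.
have be0 := Re_beta_gt0 hmua.
have [D [a0 [b0 [c0 [a1 [b1 [c1 [[oa0 ob0 oc0] [[oa1 ob1 oc1] near_exp]]]]]]]]] :=
  hard_edge_expansions hmu ha hmua hnat hterm.
rewrite -/(connection_factor a mu xi).
have Re2 : complex.Re (2 * (mu + a + 1)) = 2 * complex.Re (mu + a + 1).
  by rewrite Re_mul (Re_nat 2) (Im_nat 2) mul0r subr0.
have O2 (f : R -> R[i]) : order_pow f 2 -> (fun s => cabs (f s)) =O_ (0^'+) (fun s : R => s ^+ 2).
  by move=> hf; apply: (order_pow_eqO hf) => s s0; rewrite powR_mulrn// ltW.
have O1 (f : R -> R[i]) : order_pow f 1 -> (fun s => cabs (f s)) =O_ (0^'+) (fun s : R => s).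
  by move=> hf; apply: (order_pow_eqO hf) => s s0; rewrite powRr1// ltW.
have Ob (f : R -> R[i]) : order_pow f (2 * complex.Re (mu + a + 1)) ->
    (fun s => cabs (f s)) =O_ (0^'+) (fun s : R => s `^ complex.Re (2 * (mu + a + 1))).
  by move=> hf; apply: (order_pow_eqO hf) => s s0; rewrite Re2.
have [small [r1 [r2 [r3 [ord1 ord2 ord3 quot]]]]] :=
  quotient_expansion (- mu / (4 * (mu + a))) (ecoef a mu xi 1 0) be0 oa0 ob0 oc0 oa1 ob1 oc1.
have right0 : \forall s \near (0 : R)^'+, 0 < s by exact: nbhs_right_gt.
have logd : \forall s \near (0 : R)^'+,
    is_derive s (1:R) (fun t : R => complex.Re (clog (E2hard a mu xi t)))
      (complex.Re (D s * (s^-1)%:C / E2hard a mu xi s)) /\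
    is_derive s (1:R) (fun t : R => complex.Im (clog (E2hard a mu xi t)))
      (complex.Im (D s * (s^-1)%:C / E2hard a mu xi s)).
  apply: filterS2 near_exp small => s [eE _ dR dI]; rewrite -eE => E1.
  have E0 : 0 < complex.Re (E2hard a mu xi s).
    have := le_trans (normr_Re _) E1; rewrite Re_add Re_opp /= ler_norml => /andP[h _].
    by move: h; lra.
  exact: (@is_derive_clog R (E2hard a mu xi) s (D s * (s^-1)%:C) E0
    (is_derive_eq dR (esym (Re_mul_real _ _))) (is_derive_eq dI (esym (Im_mul_real _ _)))).
split; last split.
- exists a0, b0, c0; split; [exact: O2 | exact: O1 | exact: Ob | ].
  apply: filterS2 near_exp right0 => s [-> _ _ _] s0.
  by rewrite ecoef10_cpow// [a + mu]addrC !mulNr.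
- by apply: filterS logd => s [h1 h2]; split; apply: ex_derive.
- exists (fun s => - r1 s), r2, (fun s => - r3 s).
  split; [by apply: O2; exact: order_powN | exact: O1 | by apply: Ob; exact: order_powN | ].
  apply: filterS3 near_exp quot (filterI right0 logd) => s [eE eD _ _].
  rewrite -eE -eD => qE [s0 [d1 d2]].
  have dE : cderive (fun t => clog (E2hard a mu xi t)) s = D s * (s^-1)%:C / E2hard a mu xi s.
    by apply: complexP; rewrite /cderive /= derive1E derive_val.
  rewrite /sigmaIII dE.
  have -> : s%:C * (D s * (s^-1)%:C / E2hard a mu xi s) = D s / E2hard a mu xi s.
    by rewrite mulrA mulrCA -rmorphM divff ?gt_eqF// mulr1.
  rewrite qE -(mulrA (mu + a + 1)) ecoef10_cpow//.
  rewrite -(sigma_coefficient hmua); ring.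
Qed.
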